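(* Assume that the batch size is geometrically distributed with parameter $q\in[0,1[$, i.e. $\mathbb{P}(B=b)=(1-q)q^{b-1}$ for $b\ge1$, and that $0<\varrho<1-q$. Let $\mathbb{D}=\{u\in\mathbb{C}:|u|<1\}$ and $$E(x,u,v)=\sum_{b\ge1}\sum_{n\ge0}E_{n,b}(x)\,u^n v^b,\qquad x\in\mathbb{R}^+,\ (u,v)\in\mathbb{D}^2 .$$ Then $E$ verifies the linear second order partial differential equation $$ \begin{aligned} & u\,\frac{\partial^2E}{\partial x\,\partial u}(x,u,v)+v\,\frac{\partial^2E}{\partial x\,\partial v}(x,u,v)+\frac{u(u-1)(\varrho+q-u)}{u-q}\,\frac{\partial E}{\partial u}(x,u,v)\\ &+v(1+\varrho-v)\,\frac{\partial E}{\partial v}(x,u,v)-\frac{\varrho(1-q)v}{u-q}\left[\frac{\partial E}{\partial v}(x,u,v)-\frac{\partial E}{\partial v}(x,q,v)\right]\\ &-(u+v)E(x,u,v)+\frac{\varrho(1-q)u}{(u-q)^2}\bigl(E(x,u,v)-E(x,q,v)\bigr)=0 \end{aligned} $$ for $x\in\mathbb{R}^+$ and $(u,v)\in\mathbb{D}^2$ (at $u=q$, the left-hand side being understood as its limit when $u\to q$).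
   Context: Queue: $M^{[X]}/M/1$ Processor-Sharing queue. Batches of jobs arrive according to a Poisson process of rate $\varrho$; batch sizes are i.i.d. with the law of $B$; the service requirements of all jobs are i.i.d. exponential with parameter $1$; arrivals, batch sizes and service requirements are independent. A single server of unit capacity serves all jobs present according to Processor Sharing: when $k\ge1$ jobs are present, each is served at rate $1/k$. The condition $\varrho<1-q$ is the stability condition $\varrho\,\mathbb{E}(B)<1$. $\Omega_{n,b}$ denotes the sojourn time of a (tagged) batch given that it contains $b\ge1$ jobs and that $n\ge0$ other jobs are already present at its arrival instant, i.e. the time from its arrival until all of its $b$ jobs are completed. For $n\ge0$, $b\ge1$, $E_{n,b}(x)=\mathbb{P}(\Omega_{n,b}>x)$, $x\in\mathbb{R}^+$. *)

(* Defs.v *)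
From HB Require Import structures.
From mathcomp Require Import all_boot all_order all_algebra.
From mathcomp Require Import complex.
From mathcomp Require Import all_classical all_reals all_analysis.

Set Implicit Arguments.
Unset Strict Implicit.
Unset Printing Implicit Defensive.

Import Order.TTheory GRing.Theory Num.Theory.
Import numFieldNormedType.Exports.

Local Open Scope classical_set_scope.
Local Open Scope ring_scope.
Local Open Scope complex_scope.

(* Ascribing R[i] to numFieldType is what gives it the topology of its modulus.
   The order of R[i] is partial: `|u| < 1 still means that u lies in the open
   unit disc, because both sides are real. *)
Definition Cplx (R : realType) : numFieldType := R[i].

Definition ofR (R : realType) (x : R) : Cplx R := x%:C.

Section ProcessorSharing.
Context {R : realType}.

(* One realisation of the random inputs seen from the arrival instant of the
   tagged batch, taken as time 0. Later batches are numbered from 0: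
   [gap 0] separates time 0 from the arrival of batch 0, and [gap k.+1] the
   arrivals of batches k and k.+1. *)
Record inputs := Inputs {
  tagged_req : nat -> R;         (* requirement of the i-th tagged job *)
  other_req : nat -> R;          (* requirement, at time 0, of the i-th job
                                    already present *)
  gap : nat -> R;
  batch_size : nat -> nat;
  req : nat -> nat -> R          (* requirement of job j of batch k *)
}.

Record state := State {
  tagged_jobs : seq R;                (* residual requirements *)
  other_jobs : seq R;
  until_arrival : R;
  arrived : nat
}.

Definition present (s : state) : seq R := tagged_jobs s ++ other_jobs s.

(* Time until the next arrival or departure. With k jobs each served at rate
   1/k, a residual requirement r takes k * r units of time. *)
Definition phase_length (s : state) : R :=
  if present s is r :: rs then
    Num.min (until_arrival s)
            ((size (present s))%:R * \big[Num.min/r]_(y <- rs) y)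
  else until_arrival s.

Definition serve (k : nat) (t : R) (l : seq R) : seq R :=
  [seq r <- [seq r - t / k%:R | r <- l] | 0 < r].

Definition step (w : inputs) (s : state) : state :=
  let t := phase_length s in
  let k := size (present s) in
  let m := arrived s in
  if t == until_arrival s then
    State (serve k t (tagged_jobs s))
          (serve k t (other_jobs s) ++ mkseq (req w m) (batch_size w m))
          (gap w m.+1) m.+1
  else
    State (serve k t (tagged_jobs s)) (serve k t (other_jobs s))
          (until_arrival s - t) m.

Definition start (w : inputs) (n b : nat) : state :=
  State (mkseq (tagged_req w) b) (mkseq (other_req w) n) (gap w 0) 0.

Definition state_after (w : inputs) (n b m : nat) : state :=
  iter m (step w) (start w n b).

Definition event_time (w : inputs) (n b m : nat) : R :=
  \sum_(0 <= k < m) phase_length (state_after w n b k).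

(* The tagged batch leaves at the end of the last inter-event period during
   which one of its jobs is present; the value is +oo if it never leaves. *)
Definition Omega (w : inputs) (n b : nat) : \bar R :=
  ereal_sup [set (event_time w n b m.+1)%:E
            | m in [set m | tagged_jobs (state_after w n b m) != [::]]].

End ProcessorSharing.
Arguments inputs : clear implicits.
Arguments state : clear implicits.

Definition mutually_independent (d : measure_display) (T : measurableType d)
    (R : realType) (P : probability T R) (I : Type) (F : I -> set (set T)) :
    Prop :=
  forall (m : nat) (f : 'I_m -> I) (A : 'I_m -> set T),
    injective f -> (forall i, F (f i) (A i)) ->
    P (\big[setI/setT]_(i < m) A i) = (\prod_(i < m) P (A i))%E.

Section Queue.
Context {d : measure_display} {T : measurableType d} {R : realType}
        (P : probability T R).

Record random_inputs := RandomInputs {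
  rtagged_req : nat -> {RV P >-> R};
  rother_req : nat -> {RV P >-> R};
  rgap : nat -> {RV P >-> R};
  rbatch_size : nat -> {RV P >-> nat};
  rreq : nat -> nat -> {RV P >-> R}
}.

Definition sample (X : random_inputs) (w : T) : inputs R :=
  Inputs (fun i => rtagged_req X i w) (fun i => rother_req X i w)
         (fun k => rgap X k w) (fun k => rbatch_size X k w)
         (fun k j => rreq X k j w).

Definition generated_by d' (T' : measurableType d') (Y : T -> T') :
    set (set T) :=
  preimage_set_system setT Y measurable.

Inductive source :=
  | TaggedReq of nat | OtherReq of nat | Gap of nat | BatchSize of nat
  | Req of nat & nat.

Definition events (X : random_inputs) (c : source) : set (set T) :=
  match c with
  | TaggedReq i => generated_by (rtagged_req X i)
  | OtherReq i => generated_by (rother_req X i)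
  | Gap k => generated_by (rgap X k)
  | BatchSize k => generated_by (rbatch_size X k)
  | Req k j => generated_by (rreq X k j)
  end.

Definition exponentially_distributed (Y : {RV P >-> R}) (rate : R) : Prop :=
  forall A : set R, measurable A ->
    distribution P Y A = exponential_prob rate A.

Definition geometrically_distributed (Y : {RV P >-> nat}) (q : R) : Prop :=
  forall b : nat, (1 <= b)%N ->
    P (Y @^-1` [set b]) = ((1 - q) * q ^+ b.-1)%:E.

(* The independent exponential gaps make the arrivals of batches a Poisson
   process of rate rho. A job already in service when the tagged batch arrives
   has, by lack of memory, an exponential residual requirement of parameter 1,
   independent of everything else: this is the law of [rother_req]. *)
Record MX_M_1_inputs (X : random_inputs) (rho q : R) : Prop := {
  tagged_req_law : forall i, exponentially_distributed (rtagged_req X i) 1;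
  other_req_law : forall i, exponentially_distributed (rother_req X i) 1;
  gap_law : forall k, exponentially_distributed (rgap X k) rho;
  batch_size_law : forall k, geometrically_distributed (rbatch_size X k) q;
  req_law : forall k j, exponentially_distributed (rreq X k j) 1;
  inputs_independent : mutually_independent P (events X)
}.

Definition tail (X : random_inputs) (n b : nat) (x : R) : R :=
  fine (P [set w | (x%:E < Omega (sample X w) n b)%E]).

End Queue.

Section GeneratingFunction.
Context {R : realType}.
Local Notation C := (Cplx R).
Implicit Types (e : nat -> nat -> R -> R) (F : R -> C -> C -> C).

Definition inner_partial_sum e (x : R) (u v : C) (b N : nat) : C :=
  \sum_(0 <= n < N) ofR (e n b x) * u ^+ n * v ^+ b.

Definition outer_partial_sum e (x : R) (u v : C) (B : nat) : C :=
  \sum_(1 <= b < B) limn (inner_partial_sum e x u v b).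

Definition gen_fun e (x : R) (u v : C) : C := limn (outer_partial_sum e x u v).

Definition partial_u F : R -> C -> C -> C :=
  fun x u v => derive1 (fun z : C => F x z v) u.

Definition partial_v F : R -> C -> C -> C :=
  fun x u v => derive1 (fun z : C => F x u z) v.

(* The variable x ranges over [0, +oo[, so the derivative at 0 is the right
   derivative. *)
Definition diff_quotients_x F (x : R) (u v : C) : set_system C :=
  ofR (y - x)^-1 * (F y u v - F x u v)
    @[y --> within [set y | 0 <= y] x^'].

Definition partial_x F : R -> C -> C -> C :=
  fun x u v => lim (diff_quotients_x F x u v).

Definition pde_lhs (rho q : R) F (x : R) (u v : C) : C :=
  let r := ofR rho in
  let p := ofR q in
  u * partial_x (partial_u F) x u v
  + v * partial_x (partial_v F) x u v
  + u * (u - 1) * (r + p - u) / (u - p) * partial_u F x u v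
  + v * (1 + r - v) * partial_v F x u v
  - r * (1 - p) * v / (u - p) * (partial_v F x u v - partial_v F x p v)
  - (u + v) * F x u v
  + r * (1 - p) * u / (u - p) ^+ 2 * (F x u v - F x p v).

End GeneratingFunction.

(* Main.v *)
(* The random inputs form one random point of the space of maps from [source]
   to the reals, with the cylinder sigma-algebra, where the law of a family of
   independent coordinates is determined by its marginals. By lack of memory
   the law mu of this point is reproduced both when time advances by h without
   any event (each clock loses a deterministic amount) and at the first event
   (each surviving clock loses an amount proportional to the clock that rings).
   Splitting according to the first event in [0, h] and using that the tail
   e(n, b, x) = P(Omega_{n,b} > x) is nonincreasing in x gives, with
   L = 1 + rho and H the mean of the tails after the first event,
     (1 - exp(-L h)) H(x + h) <= e(x + h) - exp(-L h) e(x)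
                              <= (1 - exp(-L h)) H(x),
   so that e is differentiable in x, with derivative L (H - e) and an error that
   is quadratic and uniform in n and b. Multiplied by (n + b) u^n v^b and summed,
   these backward equations are the partial differential equation, because
   D(n) = sum_m q^m e(n + 1 + m) satisfies D(n) = e(n + 1) + q D(n + 1), i.e.
   (u - q) sum_n D(n) u^n = E(u) - E(q). *)

Require Import Defs.
From HB Require Import structures.
From mathcomp Require Import all_boot all_order all_algebra.
From mathcomp Require Import complex.
From mathcomp Require Import all_classical all_reals all_analysis.
From mathcomp Require Import measurable_realfun.
From mathcomp Require Import zify ring lra.

Set Implicit Arguments.
Unset Strict Implicit.
Unset Printing Implicit Defensive.

Import Order.TTheory GRing.Theory Num.Theory.
Import numFieldNormedType.Exports.

Local Open Scope classical_set_scope.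
Local Open Scope ring_scope.

(** * The space of configurations of the clocks *)

(** The first event occurs at rate [1 + rho] whatever n and b are: each of the n + b requirements
    has rate 1 and is served at speed 1/(n + b). All error constants are therefore uniform in n and
    b, which permits termwise differentiation in x of a series already differentiated in u or v. The
    obstacle is that the queue is given path by path, so its Markov property has to be produced.
    Every transition is brought to one form, [w (sigma c) - a c * t]: coordinates are renamed by an
    injection [sigma] and decreased in proportion to the clock that rings. One invariance statement
    for such maps then covers tagged departures, other departures and arrivals. The outcomes of the
    first event are shown to be disjoint and to exclude an eventless period; since their
    probabilities add up to that of an event in [0, h], whatever they miss, such as ties, is null.
    The factor n + b clears the rates 1/(n + b) of processor sharing and is also the eigenvalue of u
    d/du + v d/dv on u^n v^b, whence the mixed derivatives of the equation. *)

HB.instance Definition _ := gen_eqMixin source.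

Section CylinderSigmaAlgebra.
Context {R : realType}.

Definition cylinder (K : seq source) (A : source -> set R) :
    set (source -> R) :=
  [set w | forall c, c \in K -> A c (w c)].

Definition cylinders : set (set (source -> R)) :=
  [set C | exists K A, (forall c, measurable (A c)) /\ C = cylinder K A].

Lemma cylinders_setI : setI_closed cylinders.
Proof.
move=> _ _ [K [A [mA ->]]] [L [B [mB ->]]].
pose D c := (if c \in K then A c else setT) `&` (if c \in L then B c else setT).
exists (K ++ L), D; split.
  by move=> c; apply: measurableI; case: ifP.
apply/seteqP; split=> [w [Kw Lw] c _|w KLw].
  by split; case: ifPn => // cK; [exact: Kw|exact: Lw].
split=> c cK; have := KLw c; rewrite mem_cat cK ?orbT => /(_ isT)[];
  by rewrite cK.
Qed.

Lemma cylinders_setT : cylinders setT.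
Proof.
exists [::], (fun=> setT); split => //.
by apply/seteqP; split.
Qed.

End CylinderSigmaAlgebra.

Definition config (R : realType) := g_sigma_algebraType (@cylinders R).

HB.instance Definition _ (R : realType) := Measurable.on (config R).

Section Config.
Context {R : realType}.

Lemma measurable_cylinder (K : seq source) (A : source -> set R) :
  (forall c, measurable (A c)) -> measurable (cylinder K A : set (config R)).
Proof. by move=> mA; apply: sub_sigma_algebra; exists K, A. Qed.

Lemma measurable_coord (c : source) :
  measurable_fun [set: config R] (fun w : config R => w c).
Proof.
move=> _ B mB; rewrite setTI.
rewrite (_ : _ @^-1` _ = cylinder [:: c] (fun=> B)); last first.
  apply/seteqP; split=> [w Bw c'|w /(_ c)]; first by rewrite inE => /eqP ->.
  by rewrite inE eqxx; exact.
exact: measurable_cylinder.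
Qed.

Lemma measurable_to_config d (S : measurableType d) (f : S -> config R) :
  (forall c, measurable_fun [set: S] (fun s => f s c)) ->
  measurable_fun [set: S] f.
Proof.
move=> mf; apply: (@measurability _ _ _ (config R) setT f (@cylinders R)) => //.
move=> _ [_ [K [A [mA ->]]] <-].
rewrite (_ : _ `&` _ = \bigcap_(c in [set` K]) ((fun s => f s c) @^-1` A c)).
  apply: fin_bigcap_measurable; first exact: finite_seq.
  by move=> c _; rewrite -[X in measurable X]setTI; exact: mf.
rewrite setTI.
by apply/seteqP; split=> s.
Qed.

(** Cylinders are stable under intersection and include the whole space, so they determine a finite
    measure. Repetitions in [K] are removed because the product formula speaks of distinct
    coordinates. *)
Lemma config_measure_unique (m1 m2 : {measure set (config R) -> \bar R}) :
  (m1 setT < +oo)%E ->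
  (forall K A, uniq K -> (forall c, measurable (A c)) ->
    m1 (cylinder K A) = m2 (cylinder K A)) ->
  forall C, measurable C -> m1 C = m2 C.
Proof.
move=> m1oo m12 C mC.
apply: (@measure_unique _ R (config R) (@cylinders R) (fun=> setT)) => //.
- exact: cylinders_setI.
- by move=> _; exact: cylinders_setT.
- by rewrite bigcup_const//; exists 0%N.
- move=> _ [K [A [mA ->]]].
  rewrite (_ : cylinder K A = cylinder (undup K) A) ?m12 ?undup_uniq//.
  by apply/seteqP; split=> w wA c cK; apply: wA; move: cK; rewrite mem_undup.
Qed.

End Config.

(** * Exponential clocks *)

Section Exp.
Context {R : realType}.
Variables (nu : probability R R) (r : R).
Hypothesis r0 : 0 < r.
Hypothesis nuE : forall A, measurable A -> nu A = exponential_prob r A.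

Lemma exponential_itvoy (a : R) : 0 <= a ->
  nu `]a, +oo[%classic = (expR (- r * a))%:E.
Proof.
move=> a0.
have N0 : nu `]-oo, 0[%classic = 0%E.
  rewrite nuE//; apply: integral0_eq => x /=; rewrite in_itv/= => x0.
  by rewrite lt0_exponential_pdf.
have Ea : nu `[0, a]%classic = (1 - (expR (- r * a))%:E)%E.
  rewrite nuE//.
  move: a0; rewrite le_eqVlt => /predU1P[<-|a0]; last exact: exponential_prob_itv0c.
  by rewrite set_itv1 /exponential_prob integral_set1 mulr0 expR0 subee.
have EC : nu (~` `]a, +oo[%classic) = (1 - (expR (- r * a))%:E)%E.
  rewrite -[LHS](_ : nu (`]-oo, 0[%classic `|` `[0, a]%classic) = _); last first.
    congr (nu _); rewrite setCitvr; apply/seteqP; split=> x /=; rewrite !in_itv/=.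
      by case=> [/ltW/le_trans->//|/andP[]].
    by move=> ->; rewrite andbT; case: ltP; [left|right].
  rewrite measureU//=; first by rewrite N0 add0e.
  by apply/seteqP; split=> x //= []; rewrite !in_itv/= => xl /andP[]; rewrite leNgt xl.
have := probability_setC nu (measurableC (measurable_itv `]a, +oo[)).
by rewrite EC setCK => ->; rewrite -!EFinB opprB addrC subrK.
Qed.

Lemma exponential_gt0 : nu `]0, +oo[%classic = 1%E.
Proof. by rewrite exponential_itvoy// mulr0 expR0. Qed.

(** Both sides are measures in [A]: the law restricted to []a, +oo[] and translated, and a multiple
    of the law restricted to []0, +oo[]. They are compared on half-lines. The inclusion of [A] in
    []0, +oo[] is what makes the two restrictions harmless. *)
Lemma exponential_memoryless (a : R) (A : set R) : 0 <= a ->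
  measurable A -> A `<=` `]0, +oo[%classic ->
  nu [set y | A (y - a)] = ((expR (- r * a))%:E * nu A)%E.
Proof.
move=> a0 mA A0.
have mD : measurable (`]0, +oo[%classic : set R) by [].
have mDa : measurable (`]a, +oo[%classic : set R) by [].
have ms : measurable_fun [set: R] (fun y : R => y - a).
  exact: measurable_funB.
pose e : {nonneg R} := NngNum (expR_ge0 (- r * a)).
pose m1 := pushforward (mrestr nu mDa) (fun y : R => y - a).
pose m2 := mscale e (mrestr nu mD).
have m1E B : m1 B = nu [set y | B (y - a) /\ a < y].
  rewrite /m1 /pushforward /mrestr; congr (nu _).
  by apply/seteqP; split=> y /=; rewrite in_itv/= andbT.
have m2E B : m2 B = ((expR (- r * a))%:E * nu (B `&` `]0%R, +oo[%classic))%E by [].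
have -> : nu [set y | A (y - a)] = m1 A.
  rewrite m1E; congr (nu _); apply/seteqP; split=> y /=; last by case.
  by move=> Ay; split => //; have /= := A0 _ Ay; rewrite in_itv/= andbT subr_gt0.
have -> : ((expR (- r * a))%:E * nu A)%E = m2 A.
  by rewrite m2E; congr (_ * nu _)%E; apply/esym/setIidl.
apply: (@measure_unique _ R R (@RGenOInfty.G R) (fun k => `]- k%:R, +oo[%classic)) => //.
- exact: RGenOInfty.measurableE.
- move=> _ _ [x ->] [y ->]; exists (Num.max x y).
  by apply/seteqP; split=> z /=; rewrite !in_itv/= !andbT gt_max => /andP.
- by move=> k; exists (- k%:R).
- apply/seteqP; split=> // x _; exists (Num.Def.trunc `|x|).+1 => //=.
  rewrite in_itv/= andbT ltrNl.
  apply: (le_lt_trans (ler_norm _)); rewrite normrN.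
  by have := truncnS_gt `|x|.
- move=> _ [x ->]; rewrite [LHS]m1E [RHS]m2E.
  have x0 : 0 <= Num.max x 0 by rewrite le_max lexx orbT.
  rewrite (_ : [set y | _] = `]a + Num.max x 0, +oo[%classic); last first.
    apply/seteqP; split=> y /=; rewrite !in_itv/= !andbT -ltrBrDl gt_max subr_gt0.
      by move=> [-> ->].
    by move=> /andP.
  rewrite (_ : _ `&` _ = `]Num.max x 0, +oo[%classic); last first.
    by apply/seteqP; split=> y /=; rewrite !in_itv/= !andbT gt_max => /andP.
  by rewrite !exponential_itvoy ?addr_ge0// -EFinM -expRD mulrDr.
- move=> k; rewrite [m in (m < _)%E]m1E.
  apply: (le_lt_trans (probability_le1 _ _)); last exact: ltry.
  rewrite (_ : [set y | _] = `]a - k%:R, +oo[%classic `&` `]a, +oo[%classic).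
    exact: measurableI.
  by apply/seteqP; split=> y /=; rewrite !in_itv/= !andbT ltrBrDl.
Qed.

(** The density of rate [r] times [expR (- k * s)] is [r / (r + k)] times the density of rate
    [r + k]. For [k > 0] the integral is the probability that a clock of rate [r] rings before [h]
    and before an independent clock of rate [k]. *)
Lemma exponential_race (k h : R) : 0 <= k -> 0 <= h ->
  (\int[nu]_(s in `[0%R, h]) (expR (- k * s))%:E =
   (r / (r + k) * (1 - expR (- (r + k) * h)))%:E)%E.
Proof.
move=> k0 h0.
pose E := exponential_distribution_exponential_prob__canonical__probability_measure_Probability r0.
pose mR := measurableTypeR R.
pose f (s : R) : \bar R := (expR (- k * s))%:E.
have mf : measurable_fun [set: R] f.
  by apply/measurable_EFinP; apply: measurableT_comp => //; exact: mulrl_measurable.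
(* The pushforward along the identity carries the exponential law from [mR] to [R], two
   presentations of the real line. *)
have -> : (\int[nu]_(s in `[0%R, h]) f s =
           \int[pushforward E (id : mR -> R)]_(s in `[0%R, h]) f s)%E.
  apply: eq_measure_integral => A mA _.
  exact: nuE.
rewrite ge0_integral_pushforward//; last 2 first.
  exact: measurable_funS mf.
  by move=> s _; rewrite lee_fin expR_ge0.
pose leb := @lebesgue_measure R.
have pdf_ge0 x : 0 <= exponential_pdf r x by apply: exponential_pdf_ge0; exact: ltW.
have mpdf : measurable_fun [set: mR] (EFin \o exponential_pdf r).
  by apply/measurable_EFinP; exact: measurable_exponential_pdf.
have ipdf := integrable_exponential_pdf r0.
have dom : E `<< leb.
  apply/null_content_dominatesP => A mA A0.
  by apply: null_set_integral => //; exact: measurable_funS mpdf.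
rewrite -(Radon_Nikodym_SigmaFinite.change_of_variables dom)//=; last 3 first.
- by move=> x; rewrite /f lee_fin expR_ge0.
- exact: measurable_itv.
- exact: measurable_funS mf.
(* The Radon-Nikodym derivative is known only through its integrals; these identify it almost
   everywhere with the density. *)
have RNE : ae_eq leb `[0%R, h]%classic (Radon_Nikodym_SigmaFinite.f E leb)
    (EFin \o exponential_pdf r).
  apply: integral_ae_eq => //.
  - apply: (integrableS measurableT) => //.
    exact: Radon_Nikodym_SigmaFinite.f_integrable.
  - exact: measurable_funS mpdf.
  - by move=> A A0 mA; rewrite -Radon_Nikodym_SigmaFinite.f_integral.
transitivity (\int[leb]_(x in `[0%R, h])
    ((r / (r + k))%:E * (exponential_pdf (r + k) x)%:E))%E.
  transitivity (\int[leb]_(x in `[0%R, h]) (f x * (EFin \o exponential_pdf r) x))%E.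
    apply: ae_eq_integral => //.
    - exact: measurable_itv.
    - apply: emeasurable_funM; first exact: measurable_funS mf.
      apply: measurable_funTS; apply: measurable_int.
      exact: Radon_Nikodym_SigmaFinite.f_integrable.
    - apply: emeasurable_funM; first exact: measurable_funS mf.
      exact: measurable_funS mpdf.
    - exact: ae_eqe_mul2l.
  apply: eq_integral => x; rewrite inE/= in_itv/= => /andP[x0 _].
  have rk : 0 < r + k by exact: ltr_wpDr.
  rewrite !exponential_pdfE// -!EFinM /f; congr (_%:E).
  rewrite mulrCA -expRD mulrA divfK ?gt_eqF//; congr (_ * expR _).
  by rewrite opprD mulrDl addrC.
rewrite ge0_integralZl//=; last 3 first.
- apply: measurable_funTS; apply/measurable_EFinP.
  exact: measurable_exponential_pdf.
- by move=> x _; rewrite lee_fin exponential_pdf_ge0// addr_ge0// ltW.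
- by rewrite lee_fin divr_ge0// ?addr_ge0// ltW.
move: h0; rewrite le_eqVlt => /predU1P[<-|h_gt0].
  by rewrite set_itv1 integral_set1 mulr0 expR0 subrr mulr0 mule0.
by rewrite [X in (_ * X)%E](exponential_prob_itv0c (r + k) h_gt0) -EFinB -EFinM.
Qed.

End Exp.

(** * Product laws: redrawing one coordinate *)

Section Resample.
Context {R : realType}.
Variable mu : probability (config R) R.
Variable law : source -> probability R R.

(* [f] enumerates distinct coordinates, so that this covers both a family of
   coordinates and its reindexings. *)
Definition has_product_law := forall (I : eqType) (K : seq I) (f : I -> source)
    (A : I -> set R), uniq (map f K) -> (forall i, measurable (A i)) ->
  mu [set w | forall i, i \in K -> A i (w (f i))] =
  (\prod_(i <- K) law (f i) (A i))%E.

Hypothesis muE : has_product_law.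

Definition upd (c : source) (sw : R * config R) : config R :=
  fun c' => if c' == c then sw.1 else sw.2 c'.

Lemma measurable_upd c : measurable_fun [set: R * config R] (upd c).
Proof.
apply: measurable_to_config => c'; rewrite /upd.
case: (c' == c); first exact: measurable_fst.
exact: (measurableT_comp (measurable_coord c') measurable_snd).
Qed.

(** Fubini for one coordinate: replacing coordinate [c] by an independent draw from [law c]
    preserves [mu]. On a cylinder this only moves the factor of [c] to the front of the product. *)
Lemma resample c (C : set (config R)) : measurable C ->
  mu C = (\int[law c]_s mu [set w | C (upd c (s, w))])%E.
Proof.
move=> mC.
pose m2 := pushforward (law c \x mu)%E (upd c).
have -> : (\int[law c]_s mu [set w | C (upd c (s, w))] = m2 C)%E.
  rewrite /m2 /pushforward/= /product_measure1/=.
  apply: eq_integral => s _ /=; congr (mu _).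
  by apply/seteqP; split=> w; rewrite /xsection/= inE.
apply: config_measure_unique mC; first exact: measurable_upd.
  by apply: (le_lt_trans (probability_le1 mu measurableT)); exact: ltry.
move=> mupd K A uK mA; change (mu (cylinder K A) = (law c \x mu)%E (upd c @^-1` cylinder K A)).
have muK L : uniq L -> mu (cylinder L A) = (\prod_(c <- L) law c (A c))%E.
  by move=> uL; apply: (muE (f := id)) => //; rewrite map_id.
have [cK|cK] := boolP (c \in K).
  rewrite (_ : _ @^-1` _ = A c `*` cylinder (rem c K) A); last first.
    apply/seteqP; split=> -[s w]/=.
      move=> H; split; first by have := H _ cK; rewrite /upd eqxx.
      move=> c'; rewrite mem_rem_uniq// inE/= => /andP[c'c c'K].
      by have := H _ c'K; rewrite /upd (negbTE c'c).
    move=> [As H] c' c'K; rewrite /upd; case: eqVneq => [->//|c'c] /=.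
    by apply: H; rewrite mem_rem_uniq// inE/= c'c.
  rewrite [RHS]product_measure1E//; last exact: measurable_cylinder.
  by rewrite (muK _ uK) (big_rem _ cK)/= (muK _ (rem_uniq c uK)).
rewrite (_ : _ @^-1` _ = setT `*` cylinder K A); last first.
  apply/seteqP; split=> -[s w]/=.
    move=> H; split=> // c' c'K; have := H _ c'K.
    by rewrite /upd; case: eqVneq => // c'c; rewrite -c'c c'K in cK.
  move=> [_ H] c' c'K; rewrite /upd; case: eqVneq => [c'c|_] /=; last exact: H.
  by rewrite -c'c c'K in cK.
rewrite [RHS]product_measure1E//; last exact: measurable_cylinder.
by rewrite [X in (X * _)%E]probability_setT mul1e.
Qed.

End Resample.

Lemma probability_setI1 d (T : measurableType d) (R : realType)
    (P : probability T R) (A B : set T) :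
  measurable A -> measurable B -> P B = 1%E -> P (A `&` B) = P A.
Proof.
move=> mA mB B1; have -> : P A = (P (A `\` B) + P (A `&` B))%E := measureDI P mA mB.
rewrite (_ : P (A `\` B) = 0%E) ?add0e//.
apply/eqP; rewrite eq_le measure_ge0 andbT.
have <- : P (~` B) = 0%E by rewrite probability_setC// B1 subee.
by apply: le_measure; rewrite ?inE; [exact: measurableD|exact: measurableC|exact: subIsetr].
Qed.

(** * Lack of memory under relabelling of the coordinates *)

Section Relabel.
Context {R : realType}.
Variable mu : probability (config R) R.
Variable law : source -> probability R R.
Hypothesis muE : has_product_law mu law.

Definition exponential_law (c : source) (r : R) :=
  forall A, measurable A -> law c A = exponential_prob r A.

Variables (S X : seq source) (sigma : source -> source) (a rate : source -> R).
Variable (A1 : source -> set R).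
Hypotheses (uS : uniq S) (uX : uniq X) (sigma_inj : injective sigma).
Hypothesis sigmaX : forall c, sigma c \notin X.
Hypothesis mA1 : forall c, measurable (A1 c).
Variable p : R.
Hypothesis p0 : 0 <= p.
Hypothesis lawX : (\prod_(c <- X) law c (A1 c) = p%:E)%E.
Hypotheses (a0 : forall c, 0 <= a c) (aS : forall c, c \notin S -> a c = 0).
Hypothesis rate_gt0 : forall c, c \in S -> 0 < rate c.
Hypothesis lawS : forall c, c \in S -> exponential_law c (rate c).
Hypothesis law_sigma : forall c A, measurable A -> law (sigma c) A = law c A.

Let kappa := \sum_(c <- S) rate c * a c.

(** [S] lists the clocks that must outlive the loss [a c * s], [X] the coordinates consumed by the
    event and constrained to [A1], and [sigma c] the old coordinate that becomes coordinate [c]. The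
    sources read are distinct, so the probability factorises: each clock of [S] contributes
    [expR (- (rate c * a c) * s)] by lack of memory, the coordinates of [X] contribute [p], and the
    others lose nothing. *)
Lemma relabelled_cylinder (K : seq source) (A : source -> set R) (s : R) :
  uniq K -> (forall c, measurable (A c)) -> 0 <= s ->
  mu [set w | [/\ forall c, c \in S -> 0 < w (sigma c) - a c * s,
                  forall c, c \in X -> A1 c (w c) &
                  forall c, c \in K -> A c (w (sigma c) - a c * s)]] =
  ((expR (- kappa * s) * p)%:E * mu (cylinder K A))%E.
Proof.
move=> uK mA s0.
pose U := undup (S ++ K).
(* The tags separate conditions read through [sigma] from those read directly on [X]; [sigmaX] and
   the injectivity of [sigma] make all the sources distinct. *)
pose f (i : source + source) := match i with inl c => sigma c | inr c => c end.
pose Q (i : source + source) := match i with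
  | inl c => [set y | (c \in S -> 0 < y - a c * s) /\
                      (c \in K -> A c (y - a c * s))]
  | inr c => A1 c end.
have mshift c : measurable_fun [set: R] (fun y : R => y - a c * s).
  exact: measurable_funB.
have mQl (B : set R) c : measurable B -> measurable [set y | B (y - a c * s)].
  by move=> mB; rewrite -[X in measurable X]setTI; exact: mshift.
have mpos : measurable (`]0, +oo[%classic : set R) by [].
have QlE c : Q (inl c) = (if c \in S then [set y | `]0, +oo[%classic (y - a c * s)] else setT) `&`
      (if c \in K then [set y | A c (y - a c * s)] else setT).
  rewrite /Q; apply/seteqP; split=> y /=.
    move=> [Hs Hk]; split; first by case: ifP => //= h; rewrite in_itv/= Hs.
    by case: ifP => //= h; exact: Hk.
  case: ifP => _; case: ifP => _ /= []; rewrite ?in_itv/= ?andbT //.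
have mQ i : measurable (Q i).
  case: i => c; last exact: mA1.
  rewrite QlE; apply: measurableI; case: ifP => // _; exact: mQl.
pose KK := map inl U ++ map inr X : seq (source + source).
rewrite [X in mu X](_ : _ = [set w | forall i, i \in KK -> Q i (w (f i))]); last first.
  apply/seteqP; split=> w /=.
    move=> [wS wX wK] i; rewrite mem_cat => /orP[] /mapP[c cU ->] /=; last exact: wX.
    by split; [exact: wS|exact: wK].
  move=> wQ; split=> c cH.
  - have /wQ[/(_ cH)//] : inl c \in KK.
    by rewrite mem_cat map_f// mem_undup mem_cat cH.
  - have /wQ // : inr c \in KK by rewrite mem_cat (map_f _ cH) orbT.
  - have /wQ[_ /(_ cH)//] : inl c \in KK.
    by rewrite mem_cat map_f// mem_undup mem_cat cH orbT.
rewrite muE//; last first.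
  rewrite map_cat -!map_comp/= cat_uniq map_id uX andbT map_inj_uniq//.
  rewrite undup_uniq/=; apply/hasPn => c cX; apply/mapP => -[c' _ cE].
  by have := sigmaX c'; rewrite -[sigma c']cE cX.
rewrite big_cat/= !big_map/= EFinM -muleA lawX [LHS]muleC muleCA; congr (_ * _)%E.
rewrite (muE (f := id)) ?map_id//.
pose e c := (if c \in S then expR (- (rate c * a c) * s) else 1 : R).
pose l c := (if c \in K then law c (A c) else 1%E).
transitivity (\prod_(c <- U) ((e c)%:E * l c))%E.
  apply: eq_big_seq => c cU; rewrite -/(Q (inl c)) QlE /e /l.
  case: ifPn => cS; last first.
    rewrite mul1e setTI aS//; case: ifPn => cK; last by rewrite probability_setT.
    rewrite -[RHS]law_sigma//; congr (law _ _).
    by apply/seteqP; split=> y /=; rewrite mul0r subr0.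
  pose B := `]0, +oo[%classic `&` (if c \in K then A c else setT).
  have mB : measurable B by apply: measurableI => //; case: ifP.
  rewrite (_ : _ `&` _ = [set y | B (y - a c * s)]); last first.
    by rewrite /B; case: ifP.
  have lsE : exponential_law (sigma c) (rate c).
    by move=> D mD; rewrite law_sigma//; exact: lawS.
  rewrite (exponential_memoryless lsE (a := a c * s))//; last 2 first.
    by rewrite mulr_ge0.
    by rewrite /B; exact: subIsetl.
  rewrite mulrA mulNr; congr (_ * _)%E.
  rewrite law_sigma// /B.
  have l1 := exponential_gt0 (lawS cS).
  case: ifP => _; last by rewrite setIT.
  by rewrite setIC probability_setI1.
rewrite big_split/=; congr (_ * _)%E.
  rewrite prodEFin; congr (_%:E); rewrite /e -big_mkcond/= -big_filter.
  rewrite (perm_big S); last first.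
    apply: uniq_perm => //; first by rewrite filter_uniq// undup_uniq.
    by move=> c; rewrite mem_filter mem_undup mem_cat; case: (c \in S).
  rewrite -expR_sum; congr expR; rewrite /kappa -mulr_suml -sumrN//.
rewrite /l -big_mkcond/= -big_filter; apply: perm_big.
apply: uniq_perm => //; first by rewrite filter_uniq// undup_uniq.
by move=> c; rewrite mem_filter mem_undup mem_cat orbC; case: (c \in K).
Qed.

Let D (t : config R -> R) : set (config R) :=
  [set w | (forall c, c \in S -> 0 < w (sigma c) - a c * t w) /\
           (forall c, c \in X -> A1 c (w c))].

Let relabel (t : config R -> R) (w : config R) : config R :=
  fun c => w (sigma c) - a c * t w.

Let measurable_relabel t : measurable_fun [set: config R] t ->
  measurable_fun [set: config R] (relabel t).
Proof.
move=> mt; apply: measurable_to_config => c.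
apply: measurable_funB; first exact: measurable_coord.
by apply: measurable_funM.
Qed.

Let measurable_D t : measurable_fun [set: config R] t -> measurable (D t).
Proof.
move=> mt.
rewrite (_ : D t = relabel t @^-1` cylinder S (fun=> `]0, +oo[%classic) `&`
                   cylinder X A1); last first.
  apply/seteqP; split=> w /=.
    move=> [wS wX]; split=> // c cS; rewrite /= in_itv/= andbT; exact: wS.
  by move=> [wS wX]; split=> // c cS; have := wS _ cS; rewrite /= in_itv/= andbT.
apply: measurableI; last exact: measurable_cylinder.
rewrite -[X in measurable X]setTI; apply: measurable_relabel => //.
exact: measurable_cylinder.
Qed.

Lemma measurable_relabel_shift (s : R) (C : set (config R)) : measurable C ->
  measurable ([set w | [/\ forall c, c \in S -> 0 < w (sigma c) - a c * s,
    forall c, c \in X -> A1 c (w c) &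
    C (fun c => w (sigma c) - a c * s)]] : set (config R)).
Proof.
move=> mC; have mt : measurable_fun [set: config R] (fun=> s : R) by [].
rewrite (_ : [set w | _] = D (fun=> s) `&` relabel (fun=> s) @^-1` C).
  apply: measurableI; first exact: measurable_D.
  by rewrite -[X in measurable X]setTI; exact: measurable_relabel.
by apply/seteqP; split=> w /= [] => [? ? ?|[]].
Qed.

(** Both sides are finite measures in [C], so cylinders suffice. Probabilistically, conditioned on
    the survival of the clocks and on [X], the relabelled configuration has law [mu] again. *)
Lemma relabel_shift (s : R) (C : set (config R)) : 0 <= s -> measurable C ->
  mu [set w | [/\ forall c, c \in S -> 0 < w (sigma c) - a c * s,
                  forall c, c \in X -> A1 c (w c) &
                  C (fun c => w (sigma c) - a c * s)]] =
  ((expR (- kappa * s) * p)%:E * mu C)%E.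
Proof.
move=> s0 mC.
have mt : measurable_fun [set: config R] (fun=> s : R) by [].
have mphi := measurable_relabel mt.
pose m1 := pushforward (mrestr mu (measurable_D mt)) (relabel (fun=> s)).
have e0 : 0 <= expR (- kappa * s) * p by rewrite mulr_ge0// expR_ge0.
pose m2 := mscale (NngNum e0) mu.
have m1E B : m1 B = mu [set w | [/\ forall c, c \in S -> 0 < w (sigma c) - a c * s,
    forall c, c \in X -> A1 c (w c) & B (fun c => w (sigma c) - a c * s)]].
  rewrite /m1 /pushforward /mrestr; congr (mu _).
  by apply/seteqP; split=> w /= [] => [? []|].
rewrite -m1E -[RHS]/(m2 C).
apply: config_measure_unique mC.
  change (mu (relabel (fun=> s) @^-1` setT `&` D (fun=> s)) < +oo)%E.
  rewrite preimage_setT setTI.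
  by apply: (le_lt_trans (probability_le1 mu (measurable_D mt))); exact: ltry.
move=> K A uK mA; rewrite [LHS]m1E.
exact: relabelled_cylinder.
Qed.

Variables (c0 : source) (r0 : R).
Hypothesis r0_gt0 : 0 < r0.
Hypothesis law_c0 : exponential_law c0 r0.
Hypotheses (c0X : c0 \notin X) (sigma_c0 : forall c, sigma c != c0).

Let jump_set (h : R) (C : set (config R)) : set (config R) :=
  [set w | [/\ 0 <= w c0 <= h, forall c, c \in S -> 0 < w (sigma c) - a c * w c0,
               forall c, c \in X -> A1 c (w c) &
               C (fun c => w (sigma c) - a c * w c0)]].

Lemma measurable_relabel_jump (h : R) (C : set (config R)) : measurable C ->
  measurable ([set w | [/\ 0 <= w c0 <= h,
    forall c, c \in S -> 0 < w (sigma c) - a c * w c0,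
    forall c, c \in X -> A1 c (w c) &
    C (fun c => w (sigma c) - a c * w c0)]] : set (config R)).
Proof.
move=> mC; rewrite -/(jump_set h C); have mt := @measurable_coord R c0.
rewrite (_ : jump_set h C = ((fun w : config R => w c0) @^-1` `[0, h]%classic) `&`
    (D (fun w => w c0) `&` relabel (fun w => w c0) @^-1` C)); last first.
  apply/seteqP; split=> w /=; rewrite in_itv/=; first by case.
  by case=> ? [[]].
apply: measurableI; first by rewrite -[X in measurable X]setTI; exact: mt.
apply: measurableI; first exact: measurable_D.
by rewrite -[X in measurable X]setTI; exact: measurable_relabel.
Qed.

(* The clock [c0] is frozen at the value [s]; every coordinate in [S] then has to
   outlive [a c * s] and, by lack of memory, starts afresh. *)
Lemma relabel_jump (h : R) (C : set (config R)) : 0 <= h -> measurable C ->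
  mu [set w | [/\ 0 <= w c0 <= h, forall c, c \in S -> 0 < w (sigma c) - a c * w c0,
                  forall c, c \in X -> A1 c (w c) &
                  C (fun c => w (sigma c) - a c * w c0)]] =
  ((r0 / (r0 + kappa) * (1 - expR (- (r0 + kappa) * h)) * p)%:E * mu C)%E.
Proof.
move=> h0 mC; rewrite -/(jump_set h C).
have k0 : 0 <= kappa.
  rewrite /kappa big_seq; apply: sumr_ge0 => c cS.
  by rewrite mulr_ge0// ltW// rate_gt0.
have mt := @measurable_coord R c0.
have mphi := measurable_relabel mt.
pose H := (fun w : config R => w c0) @^-1` `[0, h]%classic `&` D (fun w => w c0).
have mH : measurable H.
  apply: measurableI; last exact: measurable_D.
  by rewrite -[X in measurable X]setTI; exact: mt.
pose m1 := pushforward (mrestr mu mH) (relabel (fun w => w c0)).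
have e0 : 0 <= r0 / (r0 + kappa) * (1 - expR (- (r0 + kappa) * h)) * p.
  apply: mulr_ge0 => //; apply: mulr_ge0.
    by rewrite divr_ge0// ?addr_ge0// ltW.
  by rewrite subr_ge0 -expR0 ler_expR mulNr oppr_le0 mulr_ge0// addr_ge0// ltW.
pose m2 := mscale (NngNum e0) mu.
have m1E B : m1 B = mu (jump_set h B).
  rewrite /m1 /pushforward /mrestr; congr (mu _).
  apply/seteqP; split=> w /=; rewrite /H/= in_itv/=; last by case.
  by case=> ? [? []].
rewrite -m1E -[RHS]/(m2 C).
apply: config_measure_unique mC.
  change (mu (relabel (fun w => w c0) @^-1` setT `&` H) < +oo)%E.
  rewrite preimage_setT setTI.
  by apply: (le_lt_trans (probability_le1 mu mH)); exact: ltry.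
move=> K A uK mA; rewrite [LHS]m1E.
(* Neither [sigma] nor [X] reaches [c0], so once [c0] is redrawn as [s] the inner event is the one
   for a deterministic loss, and is empty for [s] outside [[0, h]]. *)
rewrite (resample muE c0); last by apply: measurable_relabel_jump; exact: measurable_cylinder.
change (\int[law c0]_s mu [set w | jump_set h (cylinder K A) (upd c0 (s, w))] = m2 (cylinder K A))%E.
transitivity (\int[law c0]_(s in `[0%R, h]) ((expR (- kappa * s))%:E * (p%:E * mu (cylinder K A))))%E.
  rewrite [RHS]integral_mkcond; apply: eq_integral => s _.
  rewrite patchE; case: ifPn => sh.
    have s0 : 0 <= s by move: sh; rewrite inE/= in_itv/= => /andP[].
    rewrite muleA -EFinM -relabelled_cylinder//; congr (mu _).
    apply/seteqP; split=> w /=; rewrite /jump_set/upd/= eqxx.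
      move=> [_ wS wX wK]; split=> c cH.
      - by have := wS _ cH; rewrite (negbTE (sigma_c0 c)).
      - by have := wX _ cH; case: eqVneq => // cc; move: c0X; rewrite -cc cH.
      - by have := wK _ cH; rewrite (negbTE (sigma_c0 c)).
    move=> [wS wX wK]; split => [|c cH|c cH|c cH].
    - by move: sh; rewrite inE/= in_itv.
    - by rewrite (negbTE (sigma_c0 c)); exact: wS.
    - by case: eqVneq => cc; [move: c0X; rewrite -cc cH|exact: wX].
    - by rewrite (negbTE (sigma_c0 c)); exact: wK.
  rewrite (_ : [set w | _] = set0) ?measure0//.
  apply/seteqP; split=> w //; rewrite /jump_set/upd/= eqxx => -[s0h].
  by move/negP: sh; rewrite inE/= in_itv/= s0h.
rewrite ge0_integralZr//=; last 2 first.
- by apply/measurable_EFinP; apply: measurable_funTS; apply: measurableT_comp => //; exact: mulrl_measurable.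
- by rewrite mule_ge0.
by rewrite (exponential_race r0_gt0 law_c0)// muleA -EFinM.
Qed.

End Relabel.

(** * Measurability of the sojourn time *)

Section MeasurableDynamics.
Context {d : measure_display} {S : measurableType d} {R : realType}.

Lemma measurable_fun_nat (N : S -> nat) :
  (forall k, measurable [set s | N s = k]) -> measurable_fun [set: S] N.
Proof.
move=> mN _ B _; rewrite setTI.
rewrite (_ : _ @^-1` _ = \bigcup_(k in B) [set s | N s = k]).
  exact: bigcup_measurable.
by apply/seteqP; split=> s /=; [exists (N s)|case=> k Bk /= ->].
Qed.

(** The countable partition by the values of [N] reduces to fixed indices. This handles every
    quantity whose shape depends on the current number of jobs or of arrivals. *)
Lemma measurable_random_index d' (T : measurableType d') (N : S -> nat)
    (F : nat -> S -> T) :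
  measurable_fun [set: S] N -> (forall k, measurable_fun [set: S] (F k)) ->
  measurable_fun [set: S] (fun s => F (N s) s).
Proof.
move=> mN mF _ B mB; rewrite setTI.
rewrite (_ : _ @^-1` _ = \bigcup_k ((N @^-1` [set k]) `&` (F k @^-1` B))).
  apply: bigcupT_measurable => k; apply: measurableI.
    by rewrite -[X in measurable X]setTI; exact: mN.
  by rewrite -[X in measurable X]setTI; exact: mF.
by apply/seteqP; split=> s /=; [exists (N s)|case=> k _ [/= <-]].
Qed.

(** A list of random length is tested through its length and its entries, the latter extended by 0
    beyond the end. *)
Definition measurable_seq (f : S -> seq R) :=
  measurable_fun [set: S] (fun s => size (f s)) /\
  forall j, measurable_fun [set: S] (fun s => nth 0 (f s) j).

Lemma measurable_ltn_cst j (N : S -> nat) : measurable_fun [set: S] N ->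
  measurable_fun [set: S] (fun s => j < N s)%N.
Proof. by move=> mN; exact: measurable_fun_ltn. Qed.

Lemma measurable_seq_nil : measurable_seq (fun=> [::]).
Proof. by split=> [|j]; exact: measurable_cst. Qed.

Lemma measurable_seq_random_index (N : S -> nat) (F : nat -> S -> seq R) :
  measurable_fun [set: S] N -> (forall k, measurable_seq (F k)) ->
  measurable_seq (fun s => F (N s) s).
Proof.
move=> mN mF; split=> [|j].
  by apply: (measurable_random_index (F := fun k s => size (F k s))) => // k; case: (mF k).
by apply: (measurable_random_index (F := fun k s => nth 0 (F k s) j)) => // k; case: (mF k).
Qed.

Lemma measurable_seq_map (g : R -> S -> R) (f : S -> seq R) :
  measurable_seq f ->
  (forall h : S -> R, measurable_fun [set: S] h ->
    measurable_fun [set: S] (fun s => g (h s) s)) ->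
  measurable_seq (fun s => [seq g r s | r <- f s]).
Proof.
move=> [mz mn] mg; split=> [|j].
  by under eq_fun do rewrite size_map.
rewrite (_ : (fun s => _) = fun s =>
    if (j < size (f s))%N then g (nth 0 (f s) j) s else 0).
  apply: measurable_fun_ifT => //; first exact: measurable_ltn_cst.
  exact: mg.
apply/funext => s; case: ltnP => js; first by rewrite (nth_map 0).
by rewrite nth_default// size_map.
Qed.

Lemma measurable_seq_cat (f g : S -> seq R) :
  measurable_seq f -> measurable_seq g -> measurable_seq (fun s => f s ++ g s).
Proof.
move=> [mzf mf] [mzg mg]; split=> [|j].
  under eq_fun do rewrite size_cat.
  exact: measurable_fun_addn.
under eq_fun do rewrite nth_cat.
apply: measurable_fun_ifT => //; first exact: measurable_ltn_cst.
apply: (measurable_random_index (N := fun s => (j - size (f s))%N)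
  (F := fun k s => nth 0 (g s) k)) => //.
exact: measurable_fun_subn.
Qed.

Lemma measurable_seq_mkseq (h : nat -> S -> R) (N : S -> nat) :
  measurable_fun [set: S] N -> (forall j, measurable_fun [set: S] (h j)) ->
  measurable_seq (fun s => mkseq (h ^~ s) (N s)).
Proof.
move=> mN mh; split=> [|j]; first by under eq_fun do rewrite size_mkseq.
rewrite (_ : (fun s => _) = fun s => if (j < N s)%N then h j s else 0).
  by apply: measurable_fun_ifT => //; exact: measurable_ltn_cst.
apply/funext => s; case: ltnP => js; first by rewrite nth_mkseq.
by rewrite nth_default// size_mkseq.
Qed.

(** For a prefix of fixed length, induction appends the next entry or the empty list according to
    its sign; the random length is then substituted. *)
Lemma measurable_seq_filter (f : S -> seq R) : measurable_seq f ->
  measurable_seq (fun s => [seq r <- f s | 0 < r]).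
Proof.
move=> [mz mn].
pose F k s := [seq r <- mkseq (nth 0 (f s)) k | 0 < r].
rewrite (_ : (fun s => _) = fun s => F (size (f s)) s); last first.
  by apply/funext => s; rewrite /F mkseq_nth.
apply: measurable_seq_random_index => // k.
elim: k => [|k IHk]; first exact: measurable_seq_nil.
pose g s := if 0 < nth 0 (f s) k then [:: nth 0 (f s) k] else [::].
rewrite (_ : F k.+1 = fun s => F k s ++ g s); last first.
  apply/funext => s; rewrite /F/g mkseqS filter_rcons.
  by case: ifP; rewrite ?cats0// cats1.
apply: measurable_seq_cat => //.
have mpos : measurable_fun [set: S] (fun s => 0 < nth 0 (f s) k).
  exact: measurable_fun_ltr.
split=> [|j].
  rewrite (_ : (fun s => _) = fun s => if 0 < nth 0 (f s) k then 1%N else 0%N).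
    by apply: measurable_fun_ifT.
  by apply/funext => s; rewrite /g; case: ifP.
rewrite (_ : (fun s => _) = fun s => if 0 < nth 0 (f s) k then
    nth 0 [:: nth 0 (f s) k] j else 0).
  by apply: measurable_fun_ifT => //; case: j => [|j] //; exact: mn.
by apply/funext => s; rewrite /g; case: ifP; rewrite ?nth_nil.
Qed.

Lemma measurable_bigmin (I : seq nat) (h0 : S -> R) (h : nat -> S -> R) :
  measurable_fun [set: S] h0 -> (forall i, measurable_fun [set: S] (h i)) ->
  measurable_fun [set: S] (fun s => \big[Num.min/h0 s]_(i <- I) h i s).
Proof.
move=> m0 mh; elim: I => [|i I IH].
  by under eq_fun do rewrite big_nil.
under eq_fun do rewrite big_cons.
exact: measurable_minr.
Qed.

Definition measurable_state (f : S -> state R) :=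
  [/\ measurable_seq (fun s => tagged_jobs (f s)),
      measurable_seq (fun s => other_jobs (f s)),
      measurable_fun [set: S] (fun s => until_arrival (f s)) &
      measurable_fun [set: S] (fun s => arrived (f s))].

Lemma measurable_phase_length (f : S -> state R) :
  measurable_state f -> measurable_fun [set: S] (fun s => phase_length (f s)).
Proof.
move=> [mt mo mu _].
have [mz mn] : measurable_seq (fun s => present (f s)).
  exact: measurable_seq_cat.
pose F k s := if k is k'.+1 then Num.min (until_arrival (f s))
    (k%:R * \big[Num.min/nth 0 (present (f s)) 0]_(i <- iota 0 k')
       nth 0 (present (f s)) i.+1) else until_arrival (f s).
rewrite (_ : (fun s => _) = fun s => F (size (present (f s))) s).
  apply: measurable_random_index => // -[//|k].
  apply: measurable_minr => //; apply: measurable_funM => //.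
  by apply: measurable_bigmin => // i; exact: mn.
apply/funext => s; rewrite /phase_length /F.
case: present => [//|r rs] /=; congr (Num.min _ (_ * _)).
by rewrite [LHS](big_nth 0) /index_iota subn0.
Qed.

Variable W : S -> inputs R.
Hypotheses
  (mtagged : forall i, measurable_fun [set: S] (fun s => tagged_req (W s) i))
  (mother : forall i, measurable_fun [set: S] (fun s => other_req (W s) i))
  (mgap : forall k, measurable_fun [set: S] (fun s => gap (W s) k))
  (mbatch : forall k, measurable_fun [set: S] (fun s => batch_size (W s) k))
  (mreq : forall k j, measurable_fun [set: S] (fun s => req (W s) k j)).

Lemma measurable_serve (N : S -> nat) (t : S -> R) (l : S -> seq R) :
  measurable_fun [set: S] N -> measurable_fun [set: S] t -> measurable_seq l ->
  measurable_seq (fun s => serve (N s) (t s) (l s)).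
Proof.
move=> mN mt ml; apply: measurable_seq_filter.
apply: (measurable_seq_map (g := fun r s => r - t s / (N s)%:R)) => // h mh.
apply: measurable_funB => //; apply: measurable_funM => //.
exact: (measurable_random_index (T := R) (F := fun k (_ : S) => k%:R^-1)).
Qed.

Lemma measurable_step (f : S -> state R) :
  measurable_state f -> measurable_state (fun s => step (W s) (f s)).
Proof.
move=> mf; have mp := measurable_phase_length mf; move: mf => [mt mo mu ma].
have mz : measurable_fun [set: S] (fun s => size (present (f s))).
  by case: (measurable_seq_cat mt mo).
pose c s := phase_length (f s) == until_arrival (f s).
have mc : measurable_fun [set: S] c by exact: measurable_fun_eqr.
pose st s := serve (size (present (f s))) (phase_length (f s)) (tagged_jobs (f s)).
pose so s := serve (size (present (f s))) (phase_length (f s)) (other_jobs (f s)).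
have mst : measurable_seq st by exact: measurable_serve.
have mso : measurable_seq so by exact: measurable_serve.
have stepE s : step (W s) (f s) = if c s then
    State (st s) (so s ++ mkseq (req (W s) (arrived (f s)))
                                (batch_size (W s) (arrived (f s))))
          (gap (W s) (arrived (f s)).+1) (arrived (f s)).+1
  else State (st s) (so s) (until_arrival (f s) - phase_length (f s)) (arrived (f s)).
  by [].
split.
- by rewrite (_ : (fun s => _) = st)//; apply/funext => s; rewrite stepE; case: ifP.
- have mnew : measurable_seq (fun s => so s ++
      mkseq (req (W s) (arrived (f s))) (batch_size (W s) (arrived (f s)))).
    apply: measurable_seq_cat => //.
    apply: (measurable_seq_random_index (F := fun k s =>
      mkseq (req (W s) k) (batch_size (W s) k))) => // k.
    by apply: (measurable_seq_mkseq (h := fun j s => req (W s) k j)).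
  split=> [|j].
    rewrite (_ : (fun s => _) = fun s => if c s then size (so s ++
      mkseq (req (W s) (arrived (f s))) (batch_size (W s) (arrived (f s))))
      else size (so s)).
      by apply: measurable_fun_ifT => //; [case: mnew|case: mso].
    by apply/funext => s; rewrite stepE; case: ifP.
  rewrite (_ : (fun s => _) = fun s => if c s then nth 0 (so s ++
      mkseq (req (W s) (arrived (f s))) (batch_size (W s) (arrived (f s)))) j
      else nth 0 (so s) j).
    by apply: measurable_fun_ifT => //; [case: mnew|case: mso].
  by apply/funext => s; rewrite stepE; case: ifP.
- rewrite (_ : (fun s => _) = fun s => if c s then gap (W s) (arrived (f s)).+1
      else until_arrival (f s) - phase_length (f s)).
    apply: measurable_fun_ifT => //; last exact: measurable_funB.
    exact: (measurable_random_index (F := fun k s => gap (W s) k.+1)).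
  by apply/funext => s; rewrite stepE; case: ifP.
- rewrite (_ : (fun s => _) = fun s => if c s then (arrived (f s)).+1
      else arrived (f s)).
    apply: measurable_fun_ifT => //.
    exact: (measurable_random_index (T := nat) (F := fun k (_ : S) => k.+1)).
  by apply/funext => s; rewrite stepE; case: ifP.
Qed.

Lemma measurable_state_after n b m :
  measurable_state (fun s => state_after (W s) n b m).
Proof.
elim: m => [|m IHm]; last exact: measurable_step IHm.
split => //=.
- exact: (measurable_seq_mkseq (h := fun j s => tagged_req (W s) j)).
- exact: (measurable_seq_mkseq (h := fun j s => other_req (W s) j)).
Qed.

Lemma measurable_event_time n b m :
  measurable_fun [set: S] (fun s => event_time (W s) n b m).
Proof.
apply: measurable_sum => k.
exact: measurable_phase_length (measurable_state_after n b k).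
Qed.

Lemma measurable_Omega_gt n b x :
  measurable [set s | (x%:E < Omega (W s) n b)%E].
Proof.
rewrite (_ : [set s | _] = \bigcup_m
    ([set s | (0 < size (tagged_jobs (state_after (W s) n b m)))%N] `&`
     [set s | x < event_time (W s) n b m.+1])).
  apply: bigcupT_measurable => m; apply: measurableI.
    have [[mz _] _ _ _] := measurable_state_after n b m.
    by have := measurable_ltn_cst 0%N mz measurableT (Y := [set true]) I; rewrite setTI.
  have := measurable_fun_ltr (measurable_cst x) (measurable_event_time n b m.+1)
    measurableT (Y := [set true]) I.
  by rewrite setTI.
apply/seteqP; split=> s /=.
  move=> /ereal_sup_gt[_ [m /= tm <-]]; rewrite lte_fin => xm.
  by exists m => //; split=> //=; rewrite lt0n size_eq0.
move=> [m _ [/= tm xm]]; apply: (@lt_le_trans _ _ (event_time (W s) n b m.+1)%:E).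
  by rewrite lte_fin.
apply: ereal_sup_ubound; exists m => //=.
by rewrite -size_eq0 -lt0n.
Qed.

End MeasurableDynamics.

(** * The first event of the processor-sharing dynamics *)

Section Dynamics.
Context {R : realType}.
Implicit Types (w : inputs R) (s : state R) (x y t h : R).

Lemma Omega_gtP w n b x : (x%:E < Omega w n b)%E <->
  exists2 m, tagged_jobs (state_after w n b m) != [::] & x < event_time w n b m.+1.
Proof.
split=> [/ereal_sup_gt[_ [m /= tm <-]]|[m tm xm]].
  by rewrite lte_fin => xm; exists m.
apply: (@lt_le_trans _ _ (event_time w n b m.+1)%:E); first by rewrite lte_fin.
by apply: ereal_sup_ubound; exists m.
Qed.

(** The supremum runs over the empty set and is [-oo]. This is the boundary value of the backward
    equation, reached when the last tagged job leaves. *)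
Lemma Omega_gt0jobs w n x : ~ (x%:E < Omega w n 0)%E.
Proof.
have nil m : tagged_jobs (state_after w n 0 m) = [::].
  elim: m => [//|m IHm]; rewrite /state_after iterS -/(state_after w n 0 m) /step.
  by case: ifP => _ /=; rewrite IHm.
by move=> /Omega_gtP[m]; rewrite nil.
Qed.

Definition incr_arrived (k : nat) s :=
  State (tagged_jobs s) (other_jobs s) (until_arrival s) (arrived s + k).

(** The inputs not yet consulted agree up to renumbering of the batches. The first gap is left out
    since the state already holds it in [until_arrival]. *)
Definition same_future (k : nat) w w' := forall m,
  [/\ gap w (m + k).+1 = gap w' m.+1, batch_size w (m + k) = batch_size w' m &
      req w (m + k) = req w' m].

Lemma step_incr_arrived k w w' s : same_future k w w' ->
  step w (incr_arrived k s) = incr_arrived k (step w' s).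
Proof.
move=> ww'; have [gE bE rE] := ww' (arrived s).
rewrite /step /=; case: ifP => _; rewrite /incr_arrived/=; last by [].
by rewrite gE bE rE addSn.
Qed.

Lemma state_afterS k w w' n b n' b' m : same_future k w w' ->
  step w (start w n b) = incr_arrived k (start w' n' b') ->
  state_after w n b m.+1 = incr_arrived k (state_after w' n' b' m).
Proof.
move=> ww' st; rewrite /state_after iterSr st.
elim: m => [//|m IHm]; rewrite !iterS IHm.
exact: step_incr_arrived.
Qed.

Lemma event_timeS w n b m : event_time w n b m.+1 =
  phase_length (start w n b) +
  \sum_(0 <= k < m) phase_length (state_after w n b k.+1).
Proof. by rewrite /event_time big_nat_recl. Qed.

(** From the first event on, [w] follows the trajectory of [w'] delayed by the first phase; [k] is 0
    after a departure and 1 after an arrival. *)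
Lemma Omega_first_event k w w' n b n' b' x : (0 < b)%N -> same_future k w w' ->
  step w (start w n b) = incr_arrived k (start w' n' b') ->
  phase_length (start w n b) <= x ->
  (x%:E < Omega w n b)%E <->
  ((x - phase_length (start w n b))%:E < Omega w' n' b')%E.
Proof.
move=> b0 ww' st tx.
have stm m := state_afterS m ww' st.
have etE m : event_time w n b m.+1 =
    phase_length (start w n b) + event_time w' n' b' m.
  by rewrite event_timeS; congr (_ + _); apply: eq_bigr => i _; rewrite stm.
split=> /Omega_gtP[m tm xm]; apply/Omega_gtP.
  (* The index 0 cannot be a witness: the first event does not come later than [x]. *)
  case: m tm xm => [|m]; first by rewrite etE /event_time big_nil addr0 ltNge tx.
  rewrite stm etE => tm xm; exists m => //.
  by rewrite ltrBlDl.
exists m.+1; first by rewrite stm.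
by rewrite etE -ltrBlDl.
Qed.

(** The trajectories coincide after one step, so every event time beyond 0 differs by the same
    [h]. *)
Lemma Omega_time_shift w w' n b h x : (0 < b)%N -> same_future 0 w w' ->
  step w (start w n b) = step w' (start w' n b) ->
  phase_length (start w n b) = phase_length (start w' n b) + h ->
  ((x + h)%:E < Omega w n b)%E <-> (x%:E < Omega w' n b)%E.
Proof.
move=> b0 ww' st tE.
have incr0 s : incr_arrived 0 s = s by case: s => *; rewrite /incr_arrived/= addn0.
have stm m : state_after w n b m.+1 = state_after w' n b m.+1.
  rewrite /state_after !iterSr st; elim: m => [//|m IHm]; rewrite !iterS IHm.
  by rewrite -[X in step w X]incr0 (step_incr_arrived _ ww') incr0.
have etE m : event_time w n b m.+1 = event_time w' n b m.+1 + h.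
  rewrite !event_timeS tE addrAC; congr (_ + _ + _).
  by apply: eq_bigr => i _; rewrite stm.
have tm0 m : (tagged_jobs (state_after w n b m) != [::]) =
    (tagged_jobs (state_after w' n b m) != [::]).
  case: m => [|m]; last by rewrite stm.
  by rewrite /= -!size_eq0 !size_mkseq.
have xmE m : (x + h < event_time w n b m.+1) = (x < event_time w' n b m.+1).
  by rewrite etE ltrD2r.
split=> /Omega_gtP[m tm xm]; apply/Omega_gtP; exists m.
- by rewrite -tm0.
- by rewrite -xmE.
- by rewrite tm0.
- by rewrite xmE.
Qed.

Lemma bigmin_mem (r : R) rs : \big[Num.min/r]_(z <- rs) z \in r :: rs.
Proof.
elim: rs => [|z rs IHrs]; first by rewrite big_nil mem_head.
rewrite big_cons; case: leP => _; rewrite !inE ?eqxx ?orbT//.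
by move: IHrs; rewrite inE => /orP[->//|->]; rewrite !orbT.
Qed.

Lemma bigmin_ler (r : R) rs z : z \in r :: rs -> \big[Num.min/r]_(z <- rs) z <= z.
Proof.
elim: rs => [|z' rs IHrs] in z *; first by rewrite big_nil inE => /eqP->.
rewrite big_cons ge_min !inE => /or3P[/eqP->|/eqP->|zrs].
- by rewrite IHrs ?mem_head// orbT.
- by rewrite lexx.
- by rewrite IHrs ?orbT// inE zrs orbT.
Qed.

Lemma bigmin_attained y (r : R) rs : y \in r :: rs ->
  (forall z, z \in r :: rs -> y <= z) -> \big[Num.min/r]_(z <- rs) z = y.
Proof.
move=> yr ymin; apply/eqP; rewrite eq_le bigmin_ler//=.
by apply: ymin; exact: bigmin_mem.
Qed.

Lemma phase_length_min s y : y \in present s ->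
  (forall z, z \in present s -> y <= z) ->
  phase_length s = Num.min (until_arrival s) ((size (present s))%:R * y).
Proof.
rewrite /phase_length; case: present => [//|r rs] yr ymin.
by rewrite (bigmin_attained yr ymin).
Qed.

Lemma serve_map (k : nat) (t : R) l : (forall r, r \in l -> t / k%:R < r) ->
  serve k t l = [seq r - t / k%:R | r <- l].
Proof.
move=> lt; rewrite /serve; apply/all_filterP/allP => _ /mapP[r rl ->].
by rewrite subr_gt0 lt.
Qed.

(** Job [i] is the one completed; [bump i] enumerates the other indices in increasing order, so the
    survivors keep their order. *)
Lemma serve_remove (k : nat) (t : R) (f : nat -> R) b i : (i < b)%N ->
  f i <= t / k%:R ->
  (forall j, (j < b.-1)%N -> t / k%:R < f (bump i j)) ->
  serve k t (mkseq f b) = mkseq (fun j => f (bump i j) - t / k%:R) b.-1.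
Proof.
move=> ib fi fj.
have bE : b = (i + (b - i.+1).+1)%N by rewrite -addSnnS subnKC.
have b1E : b.-1 = (i + (b - i.+1))%N by rewrite {1}bE addnS.
have sub1 j : (j < b.-1)%N -> 0 < f (bump i j) - t / k%:R.
  by move=> jb; rewrite subr_gt0 fj.
rewrite {1}bE b1E /mkseq !iotaD /= !map_cat /= !add0n.
rewrite /serve map_cat filter_cat /= subr_gt0 ltNge fi /= -!map_comp.
congr (_ ++ _); rewrite ?(iotaDl 1 i) -?map_comp.
  rewrite [X in seq.filter _ X](_ : _ = [seq f (bump i j) - t / k%:R | j <- iota 0 i]).
    apply/all_filterP/allP => ? /mapP[j]; rewrite mem_iota/= add0n => ji ->.
    by rewrite sub1// b1E ltn_addr.
  apply/eq_in_map => j; rewrite mem_iota/= add0n => ji.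
  by rewrite /bump leqNgt ji.
rewrite [X in seq.filter _ X](_ : _ = [seq f (bump i j) - t / k%:R | j <- iota i (b - i.+1)]).
  apply/all_filterP/allP => ? /mapP[j]; rewrite mem_iota => /andP[_ ji] ->.
  by rewrite sub1// b1E.
apply/eq_in_map => j; rewrite mem_iota => /andP[ij _].
by rewrite /= /bump ij.
Qed.

Lemma step_departure w s y : y \in present s ->
  (forall z, z \in present s -> y <= z) ->
  (size (present s))%:R * y < until_arrival s ->
  phase_length s = (size (present s))%:R * y /\
  step w s = State (serve (size (present s)) ((size (present s))%:R * y) (tagged_jobs s))
     (serve (size (present s)) ((size (present s))%:R * y) (other_jobs s))
     (until_arrival s - (size (present s))%:R * y) (arrived s).
Proof.
move=> ys ymin yu; have tE : phase_length s = (size (present s))%:R * y.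
  by rewrite (phase_length_min ys ymin) min_r// ltW.
by split=> //; rewrite /step tE lt_eqF.
Qed.

Lemma phase_length_arrival s : present s != [::] ->
  (forall z, z \in present s -> until_arrival s < (size (present s))%:R * z) ->
  phase_length s = until_arrival s.
Proof.
rewrite /phase_length; case: present => [//|r rs] _ us.
by rewrite min_l// ltW// us// bigmin_mem.
Qed.

Lemma step_arrival w s : present s != [::] ->
  (forall z, z \in present s -> until_arrival s < (size (present s))%:R * z) ->
  step w s = State (serve (size (present s)) (until_arrival s) (tagged_jobs s))
     (serve (size (present s)) (until_arrival s) (other_jobs s) ++
      mkseq (req w (arrived s)) (batch_size w (arrived s)))
     (gap w (arrived s).+1) (arrived s).+1.
Proof.
by move=> s0 us; rewrite /step phase_length_arrival// eqxx.
Qed.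

Definition time_shift h s : state R :=
  let c := h / (size (present s))%:R in
  State [seq r - c | r <- tagged_jobs s] [seq r - c | r <- other_jobs s]
    (until_arrival s - h) (arrived s).

Lemma present_time_shift h s : present (time_shift h s) =
  [seq r - h / (size (present s))%:R | r <- present s].
Proof. by rewrite /present /time_shift map_cat. Qed.

Lemma phase_length_time_shift h s : present s != [::] ->
  phase_length (time_shift h s) = phase_length s - h.
Proof.
move=> s0; rewrite /phase_length present_time_shift.
case: present s0 => [//|r rs] _ /=; rewrite size_map.
set c := h / _; set M := \big[_/_]_(_ <- rs) _.
rewrite [X in _ * X](_ : _ = M - c).
  rewrite addr_minl; congr Num.min; rewrite mulrBr; congr (_ - _).
  by rewrite /c mulrC divfK// pnatr_eq0.
apply: bigmin_attained; first exact: (map_f (fun z => z - c) (bigmin_mem r rs)).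
move=> ? /(@mapP _ _ (fun z => z - c) (r :: rs))[z zr ->].
by rewrite lerD2r bigmin_ler.
Qed.

(** Serving [r - h / k] for a phase shortened by [h] leaves the same residual as serving [r] for the
    whole phase. *)
Lemma step_time_shift w h s : present s != [::] ->
  step w (time_shift h s) = step w s.
Proof.
move=> s0; have sE : size (present (time_shift h s)) = size (present s).
  by rewrite present_time_shift size_map.
have serveE l : serve (size (present s)) (phase_length s - h)
    [seq r - h / (size (present s))%:R | r <- l] =
    serve (size (present s)) (phase_length s) l.
  rewrite /serve -map_comp; congr seq.filter; apply: eq_map => r /=.
  by rewrite mulrBl opprB addrA subrK.
rewrite /step sE phase_length_time_shift//= !serveE.
rewrite (inj_eq (addIr _)).
by case: ifP => // _; rewrite opprB addrA subrK.
Qed.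

End Dynamics.

(** * Transitions of the queue as relabellings of configurations *)

Section Events.
Context {R : realType}.
Implicit Types (w : source -> R) (n b i m : nat).

(** Batch sizes are stored as reals, like all other coordinates, and read back through
    [Num.trunc]. *)
Definition inputs_of w : inputs R :=
  Inputs (fun i => w (TaggedReq i)) (fun i => w (OtherReq i))
    (fun k => w (Gap k)) (fun k => Num.trunc (w (BatchSize k)))
    (fun k j => w (Req k j)).

Definition clocks b n : seq source :=
  map TaggedReq (iota 0 b) ++ map OtherReq (iota 0 n) ++ [:: Gap 0].

(** Loss of each clock per unit of the reference quantity. For a departure this is the completed
    requirement: each other requirement loses as much ([al = 1]) and the gap loses [b + n] times as
    much. When it is elapsed time, [al] is [1 / (b + n)], while [ga] is 1 if nothing happens and 0
    at an arrival, since the next gap is fresh. *)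
Definition slope b n (al ga : R) (c : source) : R :=
  match c with
  | TaggedReq j => if (j < b)%N then al else 0
  | OtherReq j => if (j < n)%N then al else 0
  | Gap 0 => ga
  | _ => 0
  end.

Definition relabelled (sigma : source -> source) (a : source -> R) (t : R) w :
    source -> R :=
  fun c => w (sigma c) - a c * t.

Definition drop_tagged i (c : source) :=
  if c is TaggedReq j then TaggedReq (bump i j) else c.

Definition drop_other i (c : source) :=
  if c is OtherReq j then OtherReq (bump i j) else c.

(** Batch 0 fills the places [n] to [n + m - 1] among the other jobs. Beyond them, the requirements
    of index at least [n] are moved up by [m], which keeps the map injective; later batches are
    renumbered. *)
Definition accept_batch n m (c : source) :=
  match c with
  | OtherReq j => if (j < n)%N then OtherReq j
                  else if (j < n + m)%N then Req 0 (j - n) else OtherReq (j - m)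
  | Gap k => Gap k.+1
  | BatchSize k => BatchSize k.+1
  | Req k j => Req k.+1 j
  | TaggedReq j => TaggedReq j
  end.

Lemma mem_clocks b n c : (c \in clocks b n) =
  match c with
  | TaggedReq j => (j < b)%N
  | OtherReq j => (j < n)%N
  | Gap k => k == 0%N
  | _ => false
  end.
Proof.
rewrite !mem_cat inE; apply/idP/idP.
  by case/or3P => [/mapP[j]|/mapP[j]|/eqP->//]; rewrite mem_iota add0n => jb ->.
case: c => // [j|j|k].
- by move=> jb; rewrite map_f// mem_iota.
- by move=> jn; rewrite (map_f OtherReq) ?orbT// mem_iota.
- by move/eqP->; rewrite eqxx !orbT.
Qed.

Lemma clocks_uniq b n : uniq (clocks b n).
Proof.
rewrite /clocks !cat_uniq !map_inj_uniq ?iota_uniq//=; first last.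
- by move=> j j' [].
- by move=> j j' [].
rewrite orbF !andbT; apply/andP; split.
  rewrite has_cat/= orbF; apply/norP; split.
    by apply/hasPn => _ /mapP[j _ ->]; apply/negP => /mapP[].
  by apply/negP => /mapP[].
by apply/negP => /mapP[].
Qed.

Lemma slope_ge0 b n al ga c : 0 <= al -> 0 <= ga -> 0 <= slope b n al ga c.
Proof. by case: c => [j|j|[|k]|k|k j]//=; case: ifP. Qed.

Lemma slope0 b n al ga c : c \notin clocks b n -> slope b n al ga c = 0.
Proof. by rewrite mem_clocks; case: c => [j|j|[|k]|k|k j]//= /negbTE->. Qed.

Definition rate (rho : R) (c : source) : R := if c is Gap _ then rho else 1.

Lemma sum_slope b n al ga rho :
  \sum_(c <- clocks b n) rate rho c * slope b n al ga c =
  (b + n)%:R * al + rho * ga.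
Proof.
rewrite /clocks !big_cat big_seq1/= addrA; congr (_ + _).
rewrite natrD mulrDl !big_map; congr (_ + _).
  rewrite (eq_big_seq (fun=> al)) => [|j]; last first.
    by rewrite mem_iota add0n /= => ->; rewrite mul1r.
  by rewrite big_const_seq count_predT size_iota iter_addr_0 mulr_natl.
rewrite (eq_big_seq (fun=> al)) => [|j]; last first.
  by rewrite mem_iota add0n /= => ->; rewrite mul1r.
by rewrite big_const_seq count_predT size_iota iter_addr_0 mulr_natl.
Qed.

Lemma size_present_start (W : inputs R) n b : size (present (start W n b)) = (b + n)%N.
Proof. by rewrite size_cat !size_mkseq. Qed.

Lemma mem_present_start (W : inputs R) n b (P : R -> Prop) :
  (forall j, (j < b)%N -> P (tagged_req W j)) ->
  (forall j, (j < n)%N -> P (other_req W j)) ->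
  forall z, z \in present (start W n b) -> P z.
Proof.
move=> Pt Po z; rewrite mem_cat => /orP[]/mapP[j]; rewrite mem_iota add0n => jb ->.
  exact: Pt.
exact: Po.
Qed.

Lemma eq_mkseq_lt (f g : nat -> R) k :
  (forall j, (j < k)%N -> f j = g j) -> mkseq f k = mkseq g k.
Proof. by move=> fg; apply/eq_in_map => j; rewrite mem_iota add0n; exact: fg. Qed.

(** Positivity of the relabelled clocks says exactly that job [i] finishes strictly first: the other
    requirements exceed [y] and the gap exceeds the time [(b + n) y] that its service takes. *)
Lemma departure_tagged w n b i : (i < b)%N ->
  let y := w (TaggedReq i) in
  let w' := relabelled (drop_tagged i) (slope b.-1 n 1 (b + n)%:R) y w in
  (forall c, c \in clocks b.-1 n -> 0 < w' c) ->
  phase_length (start (inputs_of w) n b) = (b + n)%:R * y /\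
  forall x, (b + n)%:R * y <= x ->
    (x%:E < Omega (inputs_of w) n b)%E <->
    ((x - (b + n)%:R * y)%:E < Omega (inputs_of w') n b.-1)%E.
Proof.
move=> ib y w' w'_gt0.
have bn0 : (b + n)%:R != 0 :> R by rewrite pnatr_eq0 addn_eq0; case: (b) ib.
have tj j : (j < b.-1)%N -> y < w (TaggedReq (bump i j)).
  move=> jb; have := w'_gt0 (TaggedReq j); rewrite mem_clocks jb => /(_ isT).
  by rewrite /w' /relabelled/= jb mul1r subr_gt0.
have oj j : (j < n)%N -> y < w (OtherReq j).
  move=> jb; have := w'_gt0 (OtherReq j); rewrite mem_clocks jb => /(_ isT).
  by rewrite /w' /relabelled/= jb mul1r subr_gt0.
have g0 : (b + n)%:R * y < w (Gap 0).
  have := w'_gt0 (Gap 0); rewrite mem_clocks => /(_ isT).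
  by rewrite /w' /relabelled/= subr_gt0.
have tj' j : (j < b)%N -> y <= w (TaggedReq j).
  move=> jb; have [->//|ji] := eqVneq j i.
  have jE : j = bump i (unbump i j) by rewrite unbumpK// inE.
  rewrite jE ltW// tj//; move: jb; rewrite {1}jE /bump.
  by case: leqP => /=; lia.
set s := start (inputs_of w) n b.
have ys : y \in present s.
  by rewrite mem_cat (map_f (fun j => w (TaggedReq j))) ?mem_iota.
have ymin : forall z, z \in present s -> y <= z.
  by apply: (mem_present_start (P := fun z => y <= z)) => j jb /=; [exact: tj'|exact/ltW/oj].
have yu : (size (present s))%:R * y < until_arrival s by rewrite size_present_start.
have [tE sE] := step_departure (inputs_of w) ys ymin yu.
rewrite size_present_start in tE sE.
split=> // x yx.
have fut : same_future 0 (inputs_of w) (inputs_of w').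
  move=> k; split; rewrite /= ?addn0 /w' /relabelled/= ?mul0r ?subr0//.
  by apply/funext => j; rewrite subr0.
have := Omega_first_event (x := x) (k := 0%N) (w := inputs_of w) (w' := inputs_of w')
  (n := n) (b := b) (n' := n) (b' := b.-1).
rewrite -/s tE; apply => //; first by case: (b) ib.
rewrite sE /incr_arrived /start/=; congr State.
- rewrite (@serve_remove _ _ _ _ _ i)//=.
  + by apply: eq_mkseq_lt => j jb; rewrite /w' /relabelled/= jb mul1r mulrAC divff// mul1r.
  + by rewrite mulrAC divff// mul1r.
  + by move=> j jb; rewrite mulrAC divff// mul1r; exact: tj.
- rewrite serve_map; last first.
    move=> r /mapP[j]; rewrite mem_iota add0n => jn ->.
    by rewrite mulrAC divff// mul1r; exact: oj.
  rewrite -map_comp; apply: eq_mkseq_lt => j jn.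
  by rewrite /w' /relabelled/= jn mul1r mulrAC divff// mul1r.
Qed.

Lemma departure_other w n b i : (0 < b)%N -> (i < n)%N ->
  let y := w (OtherReq i) in
  let w' := relabelled (drop_other i) (slope b n.-1 1 (b + n)%:R) y w in
  (forall c, c \in clocks b n.-1 -> 0 < w' c) ->
  phase_length (start (inputs_of w) n b) = (b + n)%:R * y /\
  forall x, (b + n)%:R * y <= x ->
    (x%:E < Omega (inputs_of w) n b)%E <->
    ((x - (b + n)%:R * y)%:E < Omega (inputs_of w') n.-1 b)%E.
Proof.
move=> b0 ib y w' w'_gt0.
have bn0 : (b + n)%:R != 0 :> R by rewrite pnatr_eq0 addn_eq0; case: (b) b0.
have tj j : (j < b)%N -> y < w (TaggedReq j).
  move=> jb; have := w'_gt0 (TaggedReq j); rewrite mem_clocks jb => /(_ isT).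
  by rewrite /w' /relabelled/= jb mul1r subr_gt0.
have oj j : (j < n.-1)%N -> y < w (OtherReq (bump i j)).
  move=> jb; have := w'_gt0 (OtherReq j); rewrite mem_clocks jb => /(_ isT).
  by rewrite /w' /relabelled/= jb mul1r subr_gt0.
have g0 : (b + n)%:R * y < w (Gap 0).
  have := w'_gt0 (Gap 0); rewrite mem_clocks => /(_ isT).
  by rewrite /w' /relabelled/= subr_gt0.
have oj' j : (j < n)%N -> y <= w (OtherReq j).
  move=> jb; have [->//|ji] := eqVneq j i.
  have jE : j = bump i (unbump i j) by rewrite unbumpK// inE.
  rewrite jE ltW// oj//; move: jb; rewrite {1}jE /bump.
  by case: leqP => /=; lia.
set s := start (inputs_of w) n b.
have ys : y \in present s.
  by rewrite mem_cat (map_f (fun j => w (OtherReq j))) ?orbT// mem_iota.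
have ymin : forall z, z \in present s -> y <= z.
  by apply: (mem_present_start (P := fun z => y <= z)) => j jb /=; [exact/ltW/tj|exact: oj'].
have yu : (size (present s))%:R * y < until_arrival s by rewrite size_present_start.
have [tE sE] := step_departure (inputs_of w) ys ymin yu.
rewrite size_present_start in tE sE.
split=> // x yx.
have fut : same_future 0 (inputs_of w) (inputs_of w').
  move=> k; split; rewrite /= ?addn0 /w' /relabelled/= ?mul0r ?subr0//.
  by apply/funext => j; rewrite subr0.
have := Omega_first_event (x := x) (k := 0%N) (w := inputs_of w) (w' := inputs_of w')
  (n := n) (b := b) (n' := n.-1) (b' := b).
rewrite -/s tE; apply => //.
rewrite sE /incr_arrived /start/=; congr State.
- rewrite serve_map; last first.
    move=> r /mapP[j]; rewrite mem_iota add0n => jn ->.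
    by rewrite mulrAC divff// mul1r; exact: tj.
  rewrite -map_comp; apply: eq_mkseq_lt => j jn.
  by rewrite /w' /relabelled/= jn mul1r mulrAC divff// mul1r.
- rewrite (@serve_remove _ _ _ _ _ i)//=.
  + by apply: eq_mkseq_lt => j jb; rewrite /w' /relabelled/= jb mul1r mulrAC divff// mul1r.
  + by rewrite mulrAC divff// mul1r.
  + by move=> j jb; rewrite mulrAC divff// mul1r; exact: oj.
Qed.

(** Positivity of the relabelled requirements means that each exceeds the work [t / (b + n)]
    received by time [t], so nobody leaves before the arrival. The new pending gap is the old
    [Gap 1], intact. *)
Lemma arrival w n b m : (0 < b)%N ->
  let t := w (Gap 0) in
  let w' := relabelled (accept_batch n m) (slope b n (b + n)%:R^-1 0) t w in
  (forall c, c \in clocks b n -> 0 < w' c) -> w (BatchSize 0) = m%:R ->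
  phase_length (start (inputs_of w) n b) = t /\
  forall x, t <= x ->
    (x%:E < Omega (inputs_of w) n b)%E <->
    ((x - t)%:E < Omega (inputs_of w') (n + m) b)%E.
Proof.
move=> b0 t w' w'_gt0 wm.
have bn0 : 0 < (b + n)%:R :> R by rewrite ltr0n addn_gt0 b0.
have tj j : (j < b)%N -> t / (b + n)%:R < w (TaggedReq j).
  move=> jb; have := w'_gt0 (TaggedReq j); rewrite mem_clocks jb => /(_ isT).
  by rewrite /w' /relabelled/= jb mulrC subr_gt0.
have oj j : (j < n)%N -> t / (b + n)%:R < w (OtherReq j).
  move=> jb; have := w'_gt0 (OtherReq j); rewrite mem_clocks jb => /(_ isT).
  by rewrite /w' /relabelled/= jb mulrC subr_gt0.
set s := start (inputs_of w) n b.
have s0 : present s != [::].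
  by rewrite -size_eq0 size_present_start addn_eq0; case: (b) b0.
have us : forall z, z \in present s -> until_arrival s < (size (present s))%:R * z.
  rewrite size_present_start.
  apply: (mem_present_start (P := fun z => until_arrival s < (b + n)%:R * z)) => j jb /=.
    by rewrite -ltr_pdivrMl// mulrC tj.
  by rewrite -ltr_pdivrMl// mulrC oj.
have tE := phase_length_arrival s0 us.
have sE := step_arrival (inputs_of w) s0 us.
rewrite size_present_start in sE.
split=> // x tx.
have fut : same_future 1 (inputs_of w) (inputs_of w').
  move=> k; split; rewrite /= ?addn1 /w' /relabelled/= ?mul0r ?subr0//.
  by apply/funext => j; rewrite subr0.
have := Omega_first_event (x := x) (k := 1%N) (w := inputs_of w) (w' := inputs_of w')
  (n := n) (b := b) (n' := (n + m)%N) (b' := b).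
rewrite -/s tE; apply => //.
rewrite sE /incr_arrived /start/=; congr State.
- rewrite serve_map; last first.
    by move=> r /mapP[j]; rewrite mem_iota add0n => jn ->; exact: tj.
  rewrite -map_comp; apply: eq_mkseq_lt => j jn.
  by rewrite /w' /relabelled/= jn mulrC.
- rewrite serve_map; last first.
    by move=> r /mapP[j]; rewrite mem_iota add0n => jn ->; exact: oj.
  rewrite wm natrK /mkseq iotaD map_cat -map_comp add0n; congr (_ ++ _).
    apply: eq_mkseq_lt => j jn.
    by rewrite /w' /relabelled/= jn mulrC.
  rewrite (_ : iota n m = map (addn n) (iota 0 m)); last by rewrite -iotaDl addn0.
  rewrite -[in RHS]map_comp; apply: eq_mkseq_lt => j jm.
  rewrite /= /w' /relabelled/= ltnNge leq_addr/= ltn_add2l jm mul0r subr0.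
  by rewrite addKn.
- by rewrite /w' /relabelled/= mul0r subr0.
Qed.

(** An identity between phases: removing [h / (b + n)] from each requirement and [h] from the gap
    shortens the current phase by [h] and leads to the same next state. *)
Lemma no_event w n b h x : (0 < b)%N ->
  let w' := relabelled id (slope b n (b + n)%:R^-1 1) h w in
  ((x + h)%:E < Omega (inputs_of w) n b)%E <->
  (x%:E < Omega (inputs_of w') n b)%E.
Proof.
move=> b0 w'.
set s := start (inputs_of w) n b.
have s0 : present s != [::].
  by rewrite -size_eq0 size_present_start addn_eq0; case: (b) b0.
have sE : start (inputs_of w') n b = time_shift h s.
  rewrite /time_shift size_present_start /start/= /w' /relabelled/=.
  congr State; last by rewrite mul1r.
  - by rewrite -map_comp; apply: eq_mkseq_lt => j jb /=; rewrite jb mulrC.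
  - by rewrite -map_comp; apply: eq_mkseq_lt => j jb /=; rewrite jb mulrC.
have fut : same_future 0 (inputs_of w) (inputs_of w').
  move=> k; split; rewrite /= ?addn0 /w' /relabelled/= ?mul0r ?subr0//.
  by apply/funext => j; rewrite subr0.
apply: Omega_time_shift => //.
- rewrite sE -/s -(step_time_shift (inputs_of w) h s0).
  rewrite /step; case: ifP => // _.
  have [_ bE rE] := fut (arrived (time_shift h s)).
  have [gE _ _] := fut (arrived (time_shift h s)).
  by rewrite addn0 in bE rE gE; rewrite bE rE gE.
- by rewrite sE -/s phase_length_time_shift// subrK.
Qed.

End Events.

(** * The competing outcomes of the first event *)

Section Outcomes.
Context {R : realType}.
Variables (rho q : R) (n b : nat).

(* The first event is indexed by [e]: departure of the [e]-th tagged job if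
   [e < b], of the [(e - b)]-th other job if [b <= e < b + n], and otherwise
   arrival of a batch of size [(e - (b + n)).+1]. *)
Definition outcome_relabelling e : source -> source :=
  if (e < b)%N then drop_tagged e
  else if (e < b + n)%N then drop_other (e - b) else accept_batch n (e - (b + n)).+1.

Definition outcome_slope e : source -> R :=
  if (e < b)%N then slope b.-1 n 1 (b + n)%:R
  else if (e < b + n)%N then slope b n.-1 1 (b + n)%:R
  else slope b n (b + n)%:R^-1 0.

Definition outcome_clock e : source :=
  if (e < b)%N then TaggedReq e
  else if (e < b + n)%N then OtherReq (e - b) else Gap 0.

Definition outcome_clocks e : seq source :=
  if (e < b)%N then clocks b.-1 n
  else if (e < b + n)%N then clocks b n.-1 else clocks b n.

Definition outcome_batches e : seq source :=
  if (e < b + n)%N then [::] else [:: BatchSize 0].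

Definition outcome_others e : nat :=
  if (e < b)%N then n else if (e < b + n)%N then n.-1 else (n + (e - (b + n)).+1)%N.

Definition outcome_tagged e : nat := if (e < b)%N then b.-1 else b.

(** The bound [h] on the time of the event, in the unit of the ringing clock: a completed
    requirement [y] takes the time [(b + n) y]. *)
Definition outcome_horizon h e : R := if (e < b + n)%N then h / (b + n)%:R else h.

(** Probability that the first event is [e]. Measured in requirements, [b + n] clocks of rate 1
    compete with a gap of rate [rho (b + n)], so each departure wins with probability
    [1 / ((b + n) (1 + rho))]. An arrival wins with probability [rho / (1 + rho)], multiplied by the
    geometric mass of its batch size. *)
Definition outcome_weight e : R :=
  if (e < b + n)%N then ((b + n)%:R * (1 + rho))^-1
  else rho / (1 + rho) * ((1 - q) * q ^+ (e - (b + n))).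

Definition outcome_state e (w : source -> R) : source -> R :=
  relabelled (outcome_relabelling e) (outcome_slope e) (w (outcome_clock e)) w.

Definition outcome h e (C : set (config R)) : set (config R) :=
  [set w | [/\ 0 <= w (outcome_clock e) <= outcome_horizon h e,
    forall c, c \in outcome_clocks e -> 0 < w (outcome_relabelling e c) -
      outcome_slope e c * w (outcome_clock e),
    forall c, c \in outcome_batches e -> [set ((e - (b + n)).+1)%:R : R] (w c) &
    C (outcome_state e w)]].

Lemma measurable_outcome h e C : measurable C -> measurable (outcome h e C).
Proof.
move=> mC.
apply: (@measurable_relabel_jump R _ _ _ _ (fun=> [set ((e - (b + n)).+1)%:R : R])) => //.
Qed.

Lemma outcome_weight_ge0 e : 0 < rho -> 0 <= q -> q < 1 ->
  0 <= outcome_weight e.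
Proof.
move=> rho_gt0 q_ge0 q_lt1; have L_gt0 : 0 < 1 + rho by rewrite addr_gt0.
rewrite /outcome_weight; case: ifP => _.
  by rewrite invr_ge0 mulr_ge0// ltW.
by rewrite mulr_ge0// ?divr_ge0// ?mulr_ge0 ?exprn_ge0 ?subr_ge0// ltW.
Qed.

Lemma outcome_relabelling_inj e : injective (outcome_relabelling e).
Proof.
rewrite /outcome_relabelling; case: ifP => _; last case: ifP => _.
- by move=> [j|j|j|j|j j'] [i|i|i|i|i i'] //= []
    /(can_inj (bumpK e))->.
- by move=> [j|j|j|j|j j'] [i|i|i|i|i i'] //= []
    /(can_inj (bumpK _))->.
set m := (e - _).+1.
move=> [j|j|j|j|j j'] [i|i|i|i|i i'] //=;
  do ?[case: ltnP => ? //]; do ?[case: ltnP => ? //];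
  case; intros; subst => //; f_equal; lia.
Qed.

Lemma slope_outcome_ge0 e c : 0 <= outcome_slope e c.
Proof.
rewrite /outcome_slope; case: ifP => _; last case: ifP => _; exact: slope_ge0.
Qed.

Lemma slope_outcome0 e c : c \notin outcome_clocks e -> outcome_slope e c = 0.
Proof.
rewrite /outcome_slope/outcome_clocks.
by case: ifP => _; last case: ifP => _; exact: slope0.
Qed.

Lemma outcome_relabelling_clock e c : outcome_relabelling e c != outcome_clock e.
Proof.
rewrite /outcome_relabelling/outcome_clock.
apply/eqP; case: ifP => _; last case: ifP => _; case: c => //= j.
- by case=> /esym/eqP; rewrite (negbTE (neq_bump _ _)).
- by case=> /esym/eqP; rewrite (negbTE (neq_bump _ _)).
- by case: ifP => // _; case: ifP.
Qed.

Lemma outcome_relabelling_batches e c :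
  outcome_relabelling e c \notin outcome_batches e.
Proof.
rewrite /outcome_relabelling/outcome_batches; case: ifP => eb.
  by rewrite (leq_trans eb)// leq_addr.
case: ifP => //= _; rewrite inE; apply/eqP; case: c => //= j.
by case: ifP => // _; case: ifP.
Qed.

Lemma outcome_clock_batches e : outcome_clock e \notin outcome_batches e.
Proof.
rewrite /outcome_clock/outcome_batches; case: ifP => eb.
  by rewrite (leq_trans eb)// leq_addr.
by case: ifP => // _; rewrite inE; apply/eqP.
Qed.

Hypothesis b_gt0 : (0 < b)%N.

Let kR_gt0 : 0 < (b + n)%:R :> R. Proof. by rewrite ltr0n addn_gt0 b_gt0. Qed.

Definition competitor (w : source -> R) j : R :=
  if (j < b)%N then w (TaggedReq j) else w (OtherReq (j - b)).

(** [outcome] speaks through a relabelling that varies with [e]; here the victory is expressed in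
    the original coordinates, where different outcomes can be confronted. *)
Definition wins e (w : source -> R) : Prop :=
  if (e < b + n)%N then
    (forall j, (j < b + n)%N -> j != e -> competitor w e < competitor w j) /\
    (b + n)%:R * competitor w e < w (Gap 0)
  else
    (forall j, (j < b + n)%N -> w (Gap 0) < (b + n)%:R * competitor w j) /\
    w (BatchSize 0) = ((e - (b + n)).+1)%:R.

Lemma wins_inj e e' w : wins e w -> wins e' w -> e = e'.
Proof.
wlog ee' : e e' / (e < e')%N => [wlg|].
  by case: (ltngtP e e') => // h ew e'w; [exact: wlg|apply/esym/wlg].
rewrite /wins; case: ltnP => eb.
  move=> [ew eg]; case: ltnP => e'b [e'w e'g].
    have e'e : e' != e by rewrite neq_ltn ee' orbT.
    have := lt_trans (ew _ e'b e'e) (e'w _ eb _).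
    by rewrite ltxx eq_sym => /(_ e'e).
  by have := lt_trans eg (e'w _ eb); rewrite ltxx.
rewrite ltnNge (leq_trans eb (ltnW ee'))/= => -[_ ->] [_ /eqP].
by rewrite eqr_nat; lia.
Qed.

Lemma outcome_wins h e C w : outcome h e C w ->
  wins e w /\ 0 <= w (outcome_clock e) <= outcome_horizon h e.
Proof.
move=> [we0 wc wb _]; split=> //.
move: wc wb; rewrite /wins /outcome_relabelling /outcome_slope /outcome_clock
  /outcome_clocks /outcome_batches.
have [eb|be] := ltnP e b.
  rewrite (leq_trans eb) ?leq_addr// => wc _; split.
    move=> j jbn je; rewrite /competitor eb; case: ltnP => jb.
      have jE : j = bump e (unbump e j) by rewrite unbumpK// inE.
      have ub : (unbump e j < b.-1)%N.
        by move: jb je eb; rewrite /unbump; case: ltnP => /=; lia.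
      have := wc (TaggedReq (unbump e j)); rewrite mem_clocks ub => /(_ isT).
      by rewrite /= ub -jE mul1r subr_gt0.
    have jn : (j - b < n)%N by lia.
    have := wc (OtherReq (j - b)); rewrite mem_clocks jn => /(_ isT).
    by rewrite /= jn mul1r subr_gt0.
  have := wc (Gap 0); rewrite mem_clocks => /(_ isT).
  by rewrite /= subr_gt0 /competitor eb.
have [ebn|bne] := ltnP e (b + n) => wc wb; split.
- move=> j jbn je; rewrite /competitor (ltnNge e) be /=; case: ltnP => jb.
    have := wc (TaggedReq j); rewrite mem_clocks jb => /(_ isT).
    by rewrite /= jb mul1r subr_gt0.
  have jE : (j - b)%N = bump (e - b) (unbump (e - b) (j - b)).
    by rewrite unbumpK// inE; lia.
  have ub : (unbump (e - b) (j - b) < n.-1)%N.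
    by move: jb je be; rewrite /unbump; case: ltnP => /=; lia.
  have := wc (OtherReq (unbump (e - b) (j - b))); rewrite mem_clocks ub => /(_ isT).
  by rewrite /= ub -jE mul1r subr_gt0.
- have := wc (Gap 0); rewrite mem_clocks => /(_ isT).
  by rewrite /= subr_gt0 /competitor ltnNge be.
- move=> j jbn; rewrite /competitor -ltr_pdivrMl// mulrC; case: ltnP => jb.
    have := wc (TaggedReq j); rewrite mem_clocks jb => /(_ isT).
    by rewrite /= jb subr_gt0 mulrC.
  have jn : (j - b < n)%N by lia.
  have := wc (OtherReq (j - b)); rewrite mem_clocks jn => /(_ isT).
  by rewrite /= jn subr_gt0 mulrC.
- by apply: wb; rewrite mem_head.
Qed.

(** The time of the event stays existential: its membership in [[0, h]] is all that the sandwich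
    uses. *)
Lemma outcome_Omega h e w : 0 <= h -> outcome h e setT w ->
  exists t, 0 <= t <= h /\ forall x, t <= x ->
    (x%:E < Omega (inputs_of w) n b)%E <->
    ((x - t)%:E < Omega (inputs_of (outcome_state e w))
                      (outcome_others e) (outcome_tagged e))%E.
Proof.
move=> h0; rewrite /outcome /outcome_state /outcome_relabelling /outcome_slope
  /outcome_clock /outcome_clocks /outcome_batches /outcome_others
  /outcome_tagged /outcome_horizon /=.
have [eb|be] := ltnP e b.
  rewrite (leq_trans eb) ?leq_addr// => -[/andP[w0 wh] wc _ _].
  exists ((b + n)%:R * w (TaggedReq e)); split.
    by rewrite mulr_ge0//= mulrC -ler_pdivlMr.
  by have [_] := departure_tagged eb wc.
have [ebn|bne] := ltnP e (b + n) => -[/andP[w0 wh] wc wb _].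
  exists ((b + n)%:R * w (OtherReq (e - b))); split.
    by rewrite mulr_ge0//= mulrC -ler_pdivlMr.
  have en : (e - b < n)%N by lia.
  by have [_] := departure_other b_gt0 en wc.
exists (w (Gap 0)); split; first by rewrite w0.
have wm := wb (BatchSize 0) (mem_head _ _).
by have [_] := arrival b_gt0 wc wm.
Qed.

End Outcomes.

(** * The backward equations *)

Section Sandwich.
Context {R : realType}.
Variable mu : probability (config R) R.
Variable law : source -> probability R R.
Variables (rho q : R).
Hypotheses (rho_gt0 : 0 < rho) (q_ge0 : 0 <= q) (q_lt1 : q < 1).
Hypothesis muE : has_product_law mu law.
Hypothesis lawT : forall i, exponential_law law (TaggedReq i) 1.
Hypothesis lawO : forall i, exponential_law law (OtherReq i) 1.
Hypothesis lawG : forall i, exponential_law law (Gap i) rho.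
Hypothesis lawR : forall i j, exponential_law law (Req i j) 1.
Hypothesis lawB : forall i A, measurable A ->
  law (BatchSize i) A = law (BatchSize 0) A.
Hypothesis lawB0 : forall m,
  law (BatchSize 0) [set m.+1%:R] = ((1 - q) * q ^+ m)%:E.

Let L := 1 + rho.
Let L_gt0 : 0 < L. Proof. by rewrite addr_gt0. Qed.

Definition busy n b x : set (config R) :=
  [set w | (x%:E < Omega (inputs_of w) n b)%E].

Lemma measurable_busy n b x : measurable (busy n b x).
Proof.
apply: measurable_Omega_gt => [i|i|k|k|k j] /=; try exact: measurable_coord.
apply: measurable_fun_nat => -[|m].
  (* [Num.trunc] vanishes on the whole half-line below 1, negative reals included. *)
  rewrite (_ : [set _ | _] = (fun w : config R => w (BatchSize k)) @^-1` `]-oo, 1[%classic).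
    by rewrite -[X in measurable X]setTI; exact: measurable_coord.
  apply/seteqP; split=> w /=; rewrite in_itv/=.
    by move/truncn0Pn; rewrite -ltNge.
  by move=> w1; apply/truncn0Pn; rewrite -ltNge.
rewrite (_ : [set _ | _] = (fun w : config R => w (BatchSize k)) @^-1`
    `[m.+1%:R, m.+2%:R[%classic).
  by rewrite -[X in measurable X]setTI; exact: measurable_coord.
apply/seteqP; split=> w /=; rewrite in_itv/=; last exact: truncn_def.
move=> wE; rewrite -truncn_gt_nat wE ltnSn /=.
by rewrite -truncn_le_nat wE.
Qed.

Definition etail n b x : R := fine (mu (busy n b x)).

Lemma mu_busy n b x : mu (busy n b x) = (etail n b x)%:E.
Proof. by rewrite fineK// fin_num_measure//; exact: measurable_busy. Qed.

Lemma etail_ge0 n b x : 0 <= etail n b x.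
Proof. by rewrite fine_ge0. Qed.

Lemma etail_le1 n b x : etail n b x <= 1.
Proof. by rewrite -lee_fin -mu_busy probability_le1//; exact: measurable_busy. Qed.

Lemma etail_nojob n x : etail n 0 x = 0.
Proof.
rewrite /etail (_ : busy n 0 x = set0) ?measure0//.
by apply/seteqP; split=> w // /Omega_gt0jobs.
Qed.

Lemma law_exponential_clock c b n : c \in clocks b n ->
  exponential_law law c (rate rho c).
Proof. by rewrite mem_clocks; case: c => /=. Qed.

Lemma rate_gt0 c : 0 < rate rho c.
Proof. by case: c => //=. Qed.

Lemma outcome_law_relabelling n b e c A : measurable A ->
  law (outcome_relabelling n b e c) A = law c A.
Proof.
move=> mA; rewrite /outcome_relabelling; case: ifP => _; last case: ifP => _.
- by case: c => //= j; rewrite !lawT.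
- by case: c => //= j; rewrite !lawO.
- case: c => //= [j|j|j|j l]; rewrite ?lawG ?lawB ?lawR//.
  by case: ifP => // _; case: ifP => _; rewrite ?lawR ?lawO.
Qed.

Lemma mu_outcome n b h e C : (0 < b)%N -> 0 <= h -> measurable C ->
  mu (outcome n b h e C) =
  ((outcome_weight rho q n b e * (1 - expR (- L * h)))%:E * mu C)%E.
Proof.
move=> b_gt0 h0 mC.
have k0 : (b + n)%:R != 0 :> R by rewrite pnatr_eq0; lia.
pose p : R := if (e < b + n)%N then 1 else (1 - q) * q ^+ (e - (b + n)).
pose r0 : R := if (e < b + n)%N then 1 else rho.
pose S := outcome_clocks n b e.
have p0 : 0 <= p.
  by rewrite /p; case: ifP => _ //; rewrite mulr_ge0 ?exprn_ge0// subr_ge0 ltW.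
have r0_gt0 : 0 < r0 by rewrite /r0; case: ifP.
have lawX : (\prod_(c <- outcome_batches n b e)
    law c [set ((e - (b + n)).+1)%:R] = p%:E)%E.
  rewrite /outcome_batches /p; case: ifP => _; first by rewrite big_nil.
  by rewrite big_seq1 lawB0.
have h'0 : 0 <= outcome_horizon n b h e.
  by rewrite /outcome_horizon; case: ifP => // _; rewrite divr_ge0.
have lawc : exponential_law law (outcome_clock n b e) r0.
  rewrite /outcome_clock /r0; case: ifP => eb; last by case: ifP.
  by rewrite (leq_trans eb) ?leq_addr.
have uS : uniq S by rewrite /S /outcome_clocks; case: ifP => _; last case: ifP => _; exact: clocks_uniq.
have uX : uniq (outcome_batches n b e) by rewrite /outcome_batches; case: ifP.
have lawS c : c \in S -> exponential_law law c (rate rho c).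
  by rewrite /S /outcome_clocks; case: ifP => _; last case: ifP => _; exact: law_exponential_clock.
have -> := relabel_jump muE uS uX (@outcome_relabelling_inj n b e)
  (@outcome_relabelling_batches n b e) (A1 := fun=> [set ((e - (b + n)).+1)%:R])
  (fun=> measurable_set1 _) p0 lawX (@slope_outcome_ge0 R n b e)
  (@slope_outcome0 R n b e) (fun c _ => rate_gt0 c) lawS
  (@outcome_law_relabelling n b e) r0_gt0 lawc (@outcome_clock_batches n b e)
  (@outcome_relabelling_clock n b e) h'0 mC.
congr (_%:E * _)%E.
set K := \sum_(c <- _) _.
(* Total rates of the race: [1 + (b + n - 1) + rho (b + n)] for a departure and
   [rho + (b + n) / (b + n)] for an arrival. Times the respective horizons [h / (b + n)] and [h],
   both give the exponent [L * h]. *)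
suff KE : r0 + K = (if (e < b + n)%N then (b + n)%:R * L else L).
  rewrite KE /outcome_weight /outcome_horizon /r0 /p /L; case: ifP => _.
    rewrite mulr1 div1r; congr (_ * (1 - expR _)).
    by field; rewrite -natrD.
  by rewrite mulrAC.
rewrite /K /S /r0 /outcome_clocks /outcome_slope /L.
have [eb|be] := ltnP e b.
  rewrite (leq_trans eb) ?leq_addr// sum_slope mulr1 mulrDr mulr1 addrA (mulrC rho).
  by congr (_ + _); rewrite -(natrD _ 1); congr _%:R; lia.
have [ebn|bne] := ltnP e (b + n).
  rewrite sum_slope mulr1 mulrDr mulr1 addrA (mulrC rho).
  by congr (_ + _); rewrite -(natrD _ 1); congr _%:R; lia.
by rewrite sum_slope mulr0 addr0 divff// addrC.
Qed.

Lemma is_cvg_discounted (g : nat -> R) : (forall e, 0 <= g e <= 1) ->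
  cvgn (series (fun m => q ^+ m * g m)).
Proof.
move=> g01; apply: (@series_le_cvg _ _ (geometric 1 q)) => [m|m|m|].
- by have /andP[g0 _] := g01 m; rewrite mulr_ge0// exprn_ge0.
- by rewrite /= mul1r exprn_ge0.
- by have /andP[_ g1] := g01 m; rewrite /= mul1r ler_piMr// exprn_ge0.
- by apply: is_cvg_geometric_series; rewrite ger0_norm.
Qed.

Lemma sum_outcome_weight n b (g : nat -> R) : (0 < b)%N ->
  (forall e, 0 <= g e <= 1) ->
  (\sum_(0 <= e <oo) (outcome_weight rho q n b e * g e)%:E =
   (((b + n)%:R * L)^-1 * (\sum_(0 <= e < b + n) g e) +
    rho / L * (1 - q) *
      limn (series (fun m => q ^+ m * g (m + (b + n))%N)))%:E)%E.
Proof.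
move=> b0 g01.
have wg0 e : (0 <= (outcome_weight rho q n b e * g e)%:E)%E.
  by rewrite lee_fin mulr_ge0 ?outcome_weight_ge0//; have /andP[] := g01 e.
rewrite (nneseries_split 0 (b + n))// add0n EFinD; congr (_ + _)%E.
  rewrite sumEFin mulr_sumr; congr (_%:E); apply: eq_big_nat => e /andP[_ eb].
  by rewrite /outcome_weight eb.
rewrite -nneseries_addn//.
have cg : cvgn (series (fun m => q ^+ m * g (m + (b + n))%N)).
  by apply: is_cvg_discounted => m; exact: g01.
transitivity (\sum_(0 <= m <oo) ((rho / L * (1 - q))%:E *
    (q ^+ m * g (m + (b + n))%N)%:E))%E.
  apply: eq_eseriesr => m _; rewrite -EFinM; congr (_%:E).
  rewrite /outcome_weight ltnNge leq_addl/= addnK.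
  by rewrite !mulrA.
rewrite nneseriesZl; last first.
  move=> m _; rewrite lee_fin mulr_ge0 ?exprn_ge0//.
  by have /andP[] := g01 (m + (b + n))%N.
rewrite [RHS]EFinM -EFin_lim//; congr (_ * limn _)%E.
by apply/funext => m /=; rewrite sumEFin.
Qed.

(** [1 / L + rho / L = 1], the geometric masses adding up to 1. This is what makes the outcomes
    exhaustive up to a null set. *)
Lemma sum_outcome_weight1 n b : (0 < b)%N ->
  (\sum_(0 <= e <oo) (outcome_weight rho q n b e)%:E = 1)%E.
Proof.
move=> b0.
have := @sum_outcome_weight n b (fun=> 1) b0 (fun=> introT andP (conj ler01 (lexx _))).
under eq_eseriesr do rewrite mulr1.
move=> ->; congr (_%:E).
rewrite sumr_const_nat subn0.
rewrite (_ : series _ = series (geometric 1 q)); last first.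
  by congr series; apply/funext => m; rewrite /= mulr1 mul1r.
rewrite (cvg_lim _ (cvg_geometric_series _))// ?ger0_norm//.
have q1 : 1 - q != 0 by rewrite gt_eqF// subr_gt0.
have bn : (b + n)%:R != 0 :> R by rewrite pnatr_eq0; lia.
by rewrite /L; field; rewrite -natrD bn q1 gt_eqF.
Qed.

Definition next_tail n b x e : R := etail (outcome_others n b e) (outcome_tagged b e) x.

(** Closed form of the mean over outcomes. At [n = 0] the truncated predecessor is harmless because
    its coefficient is 0. *)
Definition mean_next_tail n b x : R :=
  ((b + n)%:R * L)^-1 * (b%:R * etail n b.-1 x + n%:R * etail n.-1 b x) +
  rho / L * (1 - q) * limn (series (fun m => q ^+ m * etail (n + m.+1) b x)).

Lemma sum_next_tail n b x : (0 < b)%N ->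
  (\sum_(0 <= e <oo) (outcome_weight rho q n b e * next_tail n b x e)%:E =
   (mean_next_tail n b x)%:E)%E.
Proof.
move=> b0; rewrite sum_outcome_weight//; last first.
  by move=> e; rewrite etail_ge0 etail_le1.
congr (_%:E); rewrite /mean_next_tail; congr (_ * _ + _ * _).
  rewrite (big_cat_nat _ (n := b))//= ?leq_addr//; congr (_ + _).
    rewrite (eq_big_nat _ _ (F2 := fun=> etail n b.-1 x)) => [|e /andP[_ eb]].
      by rewrite sumr_const_nat subn0 mulr_natl.
    by rewrite /next_tail /outcome_others /outcome_tagged eb.
  rewrite (eq_big_nat _ _ (F2 := fun=> etail n.-1 b x)) => [|e /andP[be ebn]].
    by rewrite sumr_const_nat addKn mulr_natl.
  by rewrite /next_tail /outcome_others /outcome_tagged ltnNge be ebn.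
congr (limn (series _)); apply/funext => m; congr (_ * _).
rewrite /next_tail /outcome_others /outcome_tagged.
rewrite ltnNge (leq_trans (leq_addr n b)) ?leq_addl//=.
by rewrite ltnNge leq_addl/= addnK.
Qed.

(* Over [0, h] the time of the first event is only used through the monotony of
   the tails, which avoids integrating over it. *)
Lemma etail_sandwich n b x h : (0 < b)%N -> 0 <= x -> 0 <= h ->
  (1 - expR (- L * h)) * mean_next_tail n b (x + h) <=
  etail n b (x + h) - expR (- L * h) * etail n b x <=
  (1 - expR (- L * h)) * mean_next_tail n b x.
Proof.
move=> b0 x0 h0.
have k0 : (b + n)%:R != 0 :> R by rewrite pnatr_eq0; lia.
have k_gt0 : 0 < (b + n)%:R :> R by rewrite ltr0n; lia.
set s := 1 - expR (- L * h).
have s0 : 0 <= s by rewrite subr_ge0 -expR0 ler_expR mulNr oppr_le0 mulr_ge0// ltW.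
pose quiet (C : set (config R)) : set (config R) := [set w | [/\
  forall c, c \in clocks b n -> 0 < w (id c) - slope b n (b + n)%:R^-1 1 c * h,
  forall c, c \in [::] -> [set: R] (w c) &
  C (fun c => w (id c) - slope b n (b + n)%:R^-1 1 c * h)]].
have mquiet C : measurable C -> measurable (quiet C).
  move=> mC.
  exact: (@measurable_relabel_shift R (clocks b n) [::] id _ (fun=> setT)).
have mu_quiet C : measurable C -> mu (quiet C) = ((expR (- L * h))%:E * mu C)%E.
  move=> mC.
  rewrite (@relabel_shift R mu law muE (clocks b n) [::] id
    (slope b n (b + n)%:R^-1 1) (rate rho) (fun=> setT) _ _ _ _ _ 1)//.
  - by rewrite sum_slope divff// !mulr1.
  - exact: clocks_uniq.
  - by rewrite big_nil.
  - by move=> c; apply: slope_ge0 => //; rewrite invr_ge0.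
  - by move=> c; exact: slope0.
  - by move=> c; exact: law_exponential_clock.
pose D := quiet setT.
have mD : measurable D by exact: mquiet.
have muD : mu D = (expR (- L * h))%:E by rewrite mu_quiet// probability_setT mule1.
pose B := busy n b (x + h).
have mB : measurable B by exact: measurable_busy.
(* On a period without event the residual sojourn time is that of the shifted configuration, whose
   law is again [mu]. *)
have BD : B `&` D = quiet (busy n b x).
  apply/seteqP; split=> w.
    by move=> [Bw [w1 w2 _]]; split=> //; exact/(no_event w n h x b0).
  by move=> [w1 w2 w3]; split => //; exact/(no_event w n h x b0).
have muBD : mu (B `&` D) = (expR (- L * h) * etail n b x)%:E.
  by rewrite BD mu_quiet ?mu_busy//; exact: measurable_busy.
pose F e := outcome n b h e setT.
have mF e : measurable (F e) by exact: measurable_outcome.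
have tF : trivIset setT F.
  apply/trivIsetP => e e' _ _ ee'; rewrite -subset0 => w [].
  move=> /(outcome_wins b0)[ew _] /(outcome_wins b0)[e'w _].
  by move/eqP: ee'; apply; exact: (wins_inj b0 ew e'w).
have muF e : mu (F e) = (s%:E * (outcome_weight rho q n b e)%:E)%E.
  by rewrite mu_outcome// probability_setT mule1 muleC -EFinM.
pose U := \bigcup_e F e.
have mU : measurable U by exact: bigcupT_measurable.
have muU : mu U = s%:E.
  rewrite (measure_semi_bigcup mu mF tF mU).
  transitivity (\sum_(0 <= e <oo) (s%:E * (outcome_weight rho q n b e)%:E))%E.
    apply: eq_eseriesr => e _; exact: muF.
  rewrite nneseriesZl ?sum_outcome_weight1 ?mule1// => e _.
  by rewrite lee_fin outcome_weight_ge0.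
have UD : U `<=` ~` D.
  move=> w [e _ /(outcome_wins b0)[ew /andP[_ wh]]] [wD _ _].
  have wt j : (j < b)%N -> h / (b + n)%:R < w (TaggedReq j).
    move=> jb; have := wD (TaggedReq j); rewrite mem_clocks jb => /(_ isT).
    by rewrite /= jb subr_gt0 mulrC.
  have wo j : (j < n)%N -> h / (b + n)%:R < w (OtherReq j).
    move=> jb; have := wD (OtherReq j); rewrite mem_clocks jb => /(_ isT).
    by rewrite /= jb subr_gt0 mulrC.
  have wg : h < w (Gap 0).
    have := wD (Gap 0); rewrite mem_clocks => /(_ isT).
    by rewrite /= mul1r subr_gt0.
  move: wh; rewrite /outcome_clock /outcome_horizon leNgt.
  have [eb|be] := ltnP e b; first by rewrite (leq_trans eb) ?leq_addr// wt.
  by have [ebn|_] := ltnP e (b + n); rewrite ?wg// wo//; lia.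
have mND : measurable (~` D) by exact: measurableC.
have muND : mu (~` D) = s%:E.
  by rewrite probability_setC// muD.
(* The union of the outcomes lies in the complement of [D] and has the same probability [s]; the
   remainder is null without any study of ties. *)
have muR : mu (~` D `\` U) = 0%E.
  have muNDoo : (mu (~` D) < +oo)%E by rewrite muND ltry.
  have -> : mu (~` D `\` U) = (mu (~` D) - mu (~` D `&` U))%E := measureD mND mU muNDoo.
  by rewrite setIidr// muND muU subee.
have muBU : (mu B - mu (B `&` D) = mu (B `&` U))%E.
  have muB : mu B = (mu (B `\` D) + mu (B `&` D))%E := measureDI mu mB mD.
  rewrite muB muBD addeK//; apply/eqP; rewrite eq_le; apply/andP; split.
    rewrite -[leRHS]adde0 -muR.
    apply: (@le_trans _ _ (mu ((B `&` U) `|` (~` D `\` U)))).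
      apply: le_measure; rewrite ?inE.
      - exact: measurableD.
      - by apply: measurableU; [exact: measurableI|exact: measurableD].
      - by move=> w [Bw Dw]; have [Uw|Uw] := pselect (U w); [left|right].
    by apply: measureU2; [exact: measurableI|exact: measurableD].
  apply: le_measure; rewrite ?inE.
  - exact: measurableI.
  - exact: measurableD.
  - by move=> w [Bw /UD].
have muBUE : mu (B `&` U) = (\sum_(0 <= e <oo) mu (B `&` F e))%E.
  rewrite setI_bigcupr.
  rewrite (@measure_semi_bigcup _ _ _ mu (fun e => B `&` F e))//.
  - by move=> e; exact: measurableI.
  - exact: trivIset_setIl.
  - by apply: bigcupT_measurable => e; exact: measurableI.
have busyE y e : measurable (busy (outcome_others n b e) (outcome_tagged b e) y).
  exact: measurable_busy.
have mu_out y e : mu (outcome n b h e (busy (outcome_others n b e) (outcome_tagged b e) y))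
   = (s%:E * (outcome_weight rho q n b e * next_tail n b y e)%:E)%E.
  by rewrite mu_outcome// mu_busy -!EFinM mulrA (mulrC s).
(* If the first event occurs at [t] in [[0, h]], exceeding [x + h] means exceeding [x + h - t]
   afterwards. This level lies between [x] and [x + h], which gives this bound and the next one. *)
have lower e : (s%:E * (outcome_weight rho q n b e * next_tail n b (x + h) e)%:E <=
    mu (B `&` F e))%E.
  rewrite -mu_out; apply: le_measure; rewrite ?inE.
  - exact: measurable_outcome.
  - exact: measurableI.
  move=> w [w1 w2 w3 w4].
  have Fw : F e w by split.
  split=> //; have [t [/andP[t0 th] tE]] := outcome_Omega b0 h0 Fw.
  apply/(tE (x + h)); first by rewrite (le_trans th)// lerDr.
  by apply: le_lt_trans w4; rewrite lee_fin; lra.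
have upper e : (mu (B `&` F e) <=
    s%:E * (outcome_weight rho q n b e * next_tail n b x e)%:E)%E.
  rewrite -mu_out; apply: le_measure; rewrite ?inE.
  - exact: measurableI.
  - exact: measurable_outcome.
  move=> w [Bw Fw]; have [w1 w2 w3 _] := Fw; split=> //.
  have [t [/andP[t0 th] tE]] := outcome_Omega b0 h0 Fw.
  have xh : t <= x + h by rewrite (le_trans th)// lerDr.
  apply: le_lt_trans (iffLR (tE _ xh) Bw).
  by rewrite lee_fin; lra.
have sumE y : (\sum_(0 <= e <oo) (s%:E * (outcome_weight rho q n b e * next_tail n b y e)%:E)
    = (s * mean_next_tail n b y)%:E)%E.
  rewrite nneseriesZl ?sum_next_tail ?EFinM// => e _.
  by rewrite lee_fin mulr_ge0 ?outcome_weight_ge0// etail_ge0.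
rewrite -!lee_fin EFinB -mu_busy -/B -muBD muBU muBUE -!sumE; apply/andP; split.
  apply: lee_nneseries => // e _ _.
  by rewrite -EFinM lee_fin mulr_ge0// mulr_ge0 ?outcome_weight_ge0// etail_ge0.
by apply: lee_nneseries.
Qed.

Definition backlog n b x : R := limn (series (fun m => q ^+ m * etail (n + m.+1) b x)).

(** The last bound comes from [(1 + z) * expR (- z) <= 1], which gives [1 - expR (- z) >= z / (1 +
    z) >= z - z ^+ 2]. *)
Let expRN_bounds (z : R) : 0 <= z ->
  [/\ 0 <= 1 - expR (- z), 1 - expR (- z) <= z & z - z ^+ 2 <= 1 - expR (- z)].
Proof.
move=> z0; have e1 : expR (- z) <= 1 by rewrite -expR0 ler_expR oppr_le0.
split; first by rewrite subr_ge0.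
  by have := expR_ge1Dx (- z); lra.
have ez : (1 + z) * expR (- z) <= 1.
  by rewrite -[leRHS]expR0 -(subrr z) expRD ler_wpM2r ?expR_ge0 ?expR_ge1Dx.
have := expR_ge0 (- z); nra.
Qed.

Lemma mean_next_tail_itv n b x : (0 < b)%N -> 0 <= mean_next_tail n b x <= 1.
Proof.
move=> b0; rewrite -!lee_fin -sum_next_tail//; apply/andP; split.
  apply: nneseries_ge0 => e _ _.
  by rewrite lee_fin mulr_ge0 ?outcome_weight_ge0// etail_ge0.
rewrite -[leRHS](sum_outcome_weight1 n b0); apply: lee_nneseries => // [e _ _|e _].
  by rewrite lee_fin mulr_ge0 ?outcome_weight_ge0// etail_ge0.
by rewrite lee_fin ler_piMr ?outcome_weight_ge0// etail_le1.
Qed.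

(** With [s = 1 - expR (- L * h) <= L * h], the sandwich places the increment between [s (H' - E)]
    and [s (H - E)], where all values lie in [[0, 1]]. The row [b = 0] is included because a
    departure may lead to it. *)
Lemma etail_lipschitz n b x h : 0 <= x -> 0 <= h ->
  `|etail n b (x + h) - etail n b x| <= L * h.
Proof.
move=> x0 h0; have Lh : 0 <= L * h by rewrite mulr_ge0// ltW.
case: b => [|b]; first by rewrite !etail_nojob subrr normr0.
have [s0 sL _] := expRN_bounds Lh.
have := etail_sandwich n (ltn0Sn b) x0 h0; rewrite mulNr.
have := mean_next_tail_itv n x (ltn0Sn b).
have := mean_next_tail_itv n (x + h) (ltn0Sn b).
have := etail_ge0 n b.+1 x; have := etail_le1 n b.+1 x.
set s := 1 - _ in s0 sL *; rewrite (_ : expR _ = 1 - s); last by rewrite /s; ring.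
set E := etail _ _ x; set E' := etail _ _ (x + h).
move: (mean_next_tail _ _ _) (mean_next_tail _ _ _) => H H' E1 E0 /andP[H0 H1] /andP[H'0 H'1].
move=> /andP[lo up]; rewrite ler_norml; apply/andP; split; nra.
Qed.

(** An average with weights of sum 1 inherits the Lipschitz constant common to its terms. *)
Lemma mean_next_tail_lipschitz n b x h : (0 < b)%N -> 0 <= x -> 0 <= h ->
  `|mean_next_tail n b (x + h) - mean_next_tail n b x| <= L * h.
Proof.
move=> b0 x0 h0; have Lh : 0 <= L * h by rewrite mulr_ge0// ltW.
have main y z : (forall e, next_tail n b y e <= next_tail n b z e + L * h) ->
    mean_next_tail n b y <= mean_next_tail n b z + L * h.
  move=> yz; rewrite -lee_fin -(sum_next_tail n y b0) EFinD -(sum_next_tail n z b0).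
  have -> : (L * h)%:E = (\sum_(0 <= e <oo) ((L * h)%:E * (outcome_weight rho q n b e)%:E))%E.
    by rewrite nneseriesZl ?sum_outcome_weight1 ?mule1// => e _; rewrite lee_fin outcome_weight_ge0.
  rewrite -nneseriesD//; last 2 first.
  - by move=> e _ _; rewrite lee_fin mulr_ge0 ?outcome_weight_ge0// etail_ge0.
  - by move=> e _ _; rewrite -EFinM lee_fin mulr_ge0 ?outcome_weight_ge0.
  apply: lee_nneseries => [e _ _|e _].
    by rewrite lee_fin mulr_ge0 ?outcome_weight_ge0// etail_ge0.
  rewrite -EFinM -EFinD lee_fin [X in _ + X]mulrC -mulrDr ler_wpM2l//.
  exact: outcome_weight_ge0.
have m1 : mean_next_tail n b x <= mean_next_tail n b (x + h) + L * h.
  apply: main => e.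
  have := etail_lipschitz (outcome_others n b e) (outcome_tagged b e) x0 h0.
  by rewrite ler_norml /next_tail; lra.
have m2 : mean_next_tail n b (x + h) <= mean_next_tail n b x + L * h.
  apply: main => e.
  have := etail_lipschitz (outcome_others n b e) (outcome_tagged b e) x0 h0.
  by rewrite ler_norml /next_tail; lra.
by rewrite ler_norml; lra.
Qed.

Definition etail_drift n b x : R := L * (mean_next_tail n b x - etail n b x).

Lemma etail_driftE n b x : (0 < b)%N ->
  (n + b)%:R * etail_drift n b x =
  - (1 + rho) * (n + b)%:R * etail n b x + b%:R * etail n b.-1 x +
  n%:R * etail n.-1 b x + rho * (1 - q) * ((n + b)%:R * backlog n b x).
Proof.
move=> b0; have k0 : (b + n)%:R != 0 :> R by rewrite pnatr_eq0; lia.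
have L0 : 1 + rho != 0 by rewrite gt_eqF.
rewrite /etail_drift /mean_next_tail -/(backlog n b x) /L addnC.
by field; rewrite L0 -natrD k0.
Qed.

Lemma etail_drift_bound n b x : (0 < b)%N -> `|etail_drift n b x| <= L.
Proof.
move=> b0; rewrite /etail_drift normrM (gtr0_norm L_gt0).
apply: ler_piMr; first exact: ltW.
have := mean_next_tail_itv n x b0; have := etail_ge0 n b x.
by have := etail_le1 n b x; rewrite ler_norml; lra.
Qed.

Lemma etail_taylor n b x y : (0 < b)%N -> 0 <= x -> 0 <= y ->
  `|etail n b y - etail n b x - (y - x) * etail_drift n b x| <=
  4 * L ^+ 2 * (y - x) ^+ 2.
Proof.
move=> b0 x0 y0.
(* With [t = L * h], replacing [s] by [t] costs at most [t ^+ 2], and so does replacing [H'] by [H]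
   in the lower bound: hence the factor 2. *)
have forward z h : 0 <= z -> 0 <= h ->
    `|etail n b (z + h) - etail n b z - h * etail_drift n b z| <= 2 * L ^+ 2 * h ^+ 2.
  move=> z0 h0; have Lh : 0 <= L * h by rewrite mulr_ge0// ltW.
  have [s0 sL sL2] := expRN_bounds Lh.
  have := etail_sandwich n b0 z0 h0; rewrite mulNr.
  have := mean_next_tail_itv n z b0.
  have := mean_next_tail_lipschitz n b0 z0 h0.
  have := etail_ge0 n b z; have := etail_le1 n b z.
  set s := 1 - _ in s0 sL sL2 *; rewrite (_ : expR _ = 1 - s); last by rewrite /s; ring.
  rewrite /etail_drift; set E := etail _ _ z; set E' := etail _ _ (z + h).
  set H := mean_next_tail _ _ z; set H' := mean_next_tail _ _ (z + h).
  rewrite (_ : h * (L * (H - E)) = L * h * (H - E)); last by ring.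
  rewrite (_ : 2 * L ^+ 2 * h ^+ 2 = 2 * (L * h) ^+ 2); last by ring.
  move: s0 sL sL2 Lh; move: (L * h) => t s0 st st2 t0 E1 E0.
  rewrite ler_norml => /andP[HH1 HH2] /andP[H0 H1] /andP[lo up].
  have a1 : s * H' - s * H >= - (t * t).
    rewrite -mulrBr; apply: (@le_trans _ _ (s * - t)); last by rewrite ler_wpM2l.
    by rewrite mulrN lerN2 ler_wpM2r.
  have a2 : `|(s - t) * (H - E)| <= t ^+ 2.
    rewrite normrM -[leRHS]mulr1; apply: ler_pM => //; rewrite ler_norml; lra.
  move: a2; rewrite ler_norml => /andP[a2 a3]; rewrite ler_norml expr2 in a2 a3 *.
  by apply/andP; split; lra.
have [xy|yx] := leP x y.
  have yx0 : 0 <= y - x by rewrite subr_ge0.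
  have := forward x (y - x) x0 yx0; rewrite (_ : x + (y - x) = y); last by ring.
  move/le_trans; apply.
  by have := mulr_ge0 (sqr_ge0 L) (sqr_ge0 (y - x)); lra.
(* For [y < x] the expansion is taken at [y]. Moving the drift from [y] to [x] adds [t ^+ 2] for [H]
   and [t ^+ 2] for [E], which raises the factor from 2 to 4. *)
have h0 : 0 <= x - y by rewrite subr_ge0 ltW.
have := forward y (x - y) y0 h0; have := etail_lipschitz n b y0 h0.
have := mean_next_tail_lipschitz n b0 y0 h0.
rewrite (_ : y + (x - y) = x); last by ring.
rewrite /etail_drift -(opprB x y) sqrrN.
move: (etail _ _ _) (etail _ _ _) (mean_next_tail _ _ _) (mean_next_tail _ _ _).
move: (x - y) h0 => h h0 Ey Ex Hy Hx.
rewrite (_ : h * (L * (Hy - Ey)) = L * h * (Hy - Ey)); last by ring.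
rewrite (_ : - h * (L * (Hx - Ex)) = - (L * h * (Hx - Ex))); last by ring.
rewrite (_ : 2 * L ^+ 2 * h ^+ 2 = 2 * (L * h) ^+ 2); last by ring.
rewrite (_ : 4 * L ^+ 2 * h ^+ 2 = 4 * (L * h) ^+ 2); last by ring.
have : 0 <= L * h by rewrite mulr_ge0// ltW.
move: (L * h) => t t0; rewrite ![`|_ - _| <= t]ler_norml => hE hH.
rewrite !ler_norml => hT.
have a1 : `|t * (Hx - Hy)| <= t ^+ 2.
  by rewrite normrM (ger0_norm t0) expr2 ler_wpM2l// ler_norml; lra.
have a2 : `|t * (Ex - Ey)| <= t ^+ 2.
  by rewrite normrM (ger0_norm t0) expr2 ler_wpM2l// ler_norml; lra.
rewrite !ler_norml in a1 a2.
lra.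
Qed.

Let is_cvg_backlog n b x :
  cvgn (series (fun m => q ^+ m * etail (n + m.+1) b x)).
Proof. by apply: is_cvg_discounted => m; rewrite etail_ge0 etail_le1. Qed.

Lemma backlog_rec n b x :
  backlog n b x = etail n.+1 b x + q * backlog n.+1 b x.
Proof.
apply/cvg_lim => //.
rewrite -(cvg_shiftS (series _)).
rewrite (_ : (fun _ => _) = (fun m => etail n.+1 b x +
    q * series (fun m => q ^+ m * etail (n.+1 + m.+1) b x) m)).
  apply: cvgD; first exact: cvg_cst.
  by apply: cvgMr; exact: is_cvg_backlog.
apply/funext => m; rewrite /series/= big_nat_recl// expr0 mul1r addn1.
congr (_ + _); rewrite mulr_sumr; apply: eq_bigr => i _.
by rewrite exprS mulrA addSnnS.
Qed.

Lemma backlog_itv n b x : 0 <= backlog n b x <= (1 - q)^-1.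
Proof.
apply/andP; split.
  apply: limr_ge; first exact: is_cvg_backlog.
  by apply: nearW => m; apply: sumr_ge0 => i _; rewrite mulr_ge0 ?exprn_ge0 ?etail_ge0.
have q1 : `|q| < 1 by rewrite ger0_norm.
rewrite -[(1 - q)^-1]mul1r -(cvg_lim _ (cvg_geometric_series q1))//.
apply: ler_lim; [exact: is_cvg_backlog|exact: is_cvg_geometric_series|].
apply: nearW => m; apply: ler_sum => i _.
by rewrite /= mul1r ler_piMr ?exprn_ge0 ?etail_le1.
Qed.

End Sandwich.

(** * The law of the inputs of the queue on the configuration space *)

Section FromQueue.
Context {d : measure_display} {T : measurableType d} {R : realType}
        (P : probability T R).
Variables (rho q : R) (X : random_inputs P).
Hypothesis queue : MX_M_1_inputs X rho q.

Definition coordinate (c : source) (w : T) : R :=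
  match c with
  | TaggedReq i => rtagged_req X i w
  | OtherReq i => rother_req X i w
  | Gap k => rgap X k w
  | BatchSize k => (rbatch_size X k w)%:R
  | Req k j => rreq X k j w
  end.

Lemma measurable_coordinate c : measurable_fun [set: T] (coordinate c).
Proof.
case: c => [i|i|k|k|k j] /=; try exact: measurable_funP.
apply: (measurableT_comp (f := fun n : nat => n%:R : R)) => //.
Qed.

HB.instance Definition _ c := isMeasurableFun.Build _ _ T R (coordinate c)
  (measurable_coordinate c).

Definition configuration (w : T) : config R := fun c => coordinate c w.

Lemma measurable_configuration : measurable_fun [set: T] configuration.
Proof. by apply: measurable_to_config; exact: measurable_coordinate. Qed.

HB.instance Definition _ := isMeasurableFun.Build _ _ T (config R) configuration
  measurable_configuration.

Definition configuration_law : probability (config R) R :=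
  distribution P configuration.

Definition coordinate_law (c : source) : probability R R :=
  distribution P (coordinate c).

Lemma configuration_has_product_law :
  has_product_law configuration_law coordinate_law.
Proof.
move=> I K f A uK mA.
pose B i := coordinate (f i) @^-1` A i.
have evB i : events X (f i) (B i).
  rewrite /B; case: (f i) => [j|j|j|j|j l] /=;
    try by exists (A i) => //; rewrite setTI.
  by exists [set n : nat | A i n%:R] => //; rewrite setTI.
have := inputs_independent queue (f := fun j : 'I_(size K) => f (tnth (in_tuple K) j))
  (A := fun j => B (tnth (in_tuple K) j)).
rewrite -(big_tnth _ _ K xpredT B) -(big_tnth _ _ K xpredT (fun i => P (B i))) => PB.
rewrite [LHS](_ : _ = P (\big[setI/setT]_(i <- K) B i)).
  apply: PB => // j j' fjj'; apply/val_inj/eqP.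
  pose i0 := tnth (in_tuple K) j.
  rewrite -(nth_uniq (f i0) _ _ uK) ?size_map ?ltn_ord//.
  rewrite !(nth_map i0) ?ltn_ord//; apply/eqP.
  by move: fjj'; rewrite !(tnth_nth i0).
congr (P _); apply/seteqP.
elim: K {uK PB} => [|i K IHK]; first by rewrite big_nil; split.
rewrite big_cons; split=> w /=.
  move=> wA; split; first by apply: wA; rewrite mem_head.
  by apply: IHK.1 => j jK; apply: wA; rewrite inE jK orbT.
move=> [wi wK] j; rewrite inE => /predU1P[->//|]; exact: IHK.2.
Qed.

Lemma configuration_sample w : sample X w = inputs_of (configuration w).
Proof.
rewrite /sample /inputs_of; congr Inputs.
by apply/funext => k; rewrite /configuration/= natrK.
Qed.

Lemma tail_etail n b x : tail X n b x = etail configuration_law n b x.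
Proof.
rewrite /tail /etail; congr (fine _); rewrite /configuration_law /distribution/=.
rewrite /pushforward; congr (P _).
by apply/seteqP; split=> w /=; rewrite /busy/= configuration_sample.
Qed.

(** The geometric law prescribes the masses at [b >= 1]; the mass at 0 is the complement of their
    sum, hence also common to all batches. *)
Lemma batch_size_law_eq k A : measurable A ->
  coordinate_law (BatchSize k) A = coordinate_law (BatchSize 0) A.
Proof.
move=> mA.
pose N k j := P (rbatch_size X k @^-1` [set j]).
have NE k' j : N k' j.+1 = N 0%N j.+1.
  by rewrite /N !(batch_size_law queue).
have mN k' (B : set nat) : measurable (rbatch_size X k' @^-1` B).
  by rewrite -[X in measurable X]setTI; exact: measurable_funP.
have sumN k' (B : set nat) : P (rbatch_size X k' @^-1` B) =
    (\sum_(0 <= j <oo) if j \in B then N k' j else 0)%E.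
  pose F j := rbatch_size X k' @^-1` (B `&` [set j]).
  have FE : rbatch_size X k' @^-1` B = \bigcup_j F j.
    apply/seteqP; split=> w /=; first by exists (rbatch_size X k' w).
    by move=> [j _ []].
  have mF j : measurable (F j) by exact: mN.
  rewrite FE (measure_semi_bigcup P mF).
  - apply: eq_eseriesr => j _; case: ifPn => jB.
      by congr (P _); rewrite /F setIidr// => _ ->; rewrite inE in jB.
    rewrite (_ : F j = set0) ?measure0//; apply/seteqP; split=> w //= [Bw wj].
    by move/negP: jB; rewrite inE -wj.
  - apply/trivIsetP => i j _ _ ij; rewrite -subset0 => w [[_ /= wi] [_ /= wj]].
    by move/eqP: ij; rewrite -wi -wj.
  - by apply: bigcupT_measurable.
have N0 k' : N k' 0%N = N 0%N 0%N.
  have NC k'' : N k'' 0%N = (1 - P (rbatch_size X k'' @^-1` (~` [set 0%N])))%E.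
    rewrite -(probability_setC P (mN k'' _)) /N; congr (P _).
    rewrite -preimage_setC setCK. reflexivity.
  rewrite !NC; congr (_ - _)%E; rewrite !sumN; apply: eq_eseriesr => -[_|j _].
    by rewrite memNset//; apply.
  by rewrite NE.
change (P (rbatch_size X k @^-1` [set j | A j%:R]) =
  P (rbatch_size X 0 @^-1` [set j | A j%:R])).
by rewrite !sumN; apply: eq_eseriesr => -[_|j _]; rewrite ?N0 ?NE.
Qed.

Lemma first_batch_law m :
  coordinate_law (BatchSize 0) [set m.+1%:R] = ((1 - q) * q ^+ m)%:E.
Proof.
rewrite -[RHS](batch_size_law queue 0 (ltn0Sn m)).
change (P ((fun w => (rbatch_size X 0 w)%:R) @^-1` [set m.+1%:R : R]) =
  P (rbatch_size X 0 @^-1` [set m.+1])).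
congr (P _); apply/seteqP; split=> w /=; last by move=> ->.
by move/eqP; rewrite eqr_nat => /eqP.
Qed.

Lemma tagged_coordinate_law i : exponential_law coordinate_law (TaggedReq i) 1.
Proof. by move=> A mA; exact: (tagged_req_law queue). Qed.

Lemma other_coordinate_law i : exponential_law coordinate_law (OtherReq i) 1.
Proof. by move=> A mA; exact: (other_req_law queue). Qed.

Lemma gap_coordinate_law k : exponential_law coordinate_law (Gap k) rho.
Proof. by move=> A mA; exact: (gap_law queue). Qed.

Lemma req_coordinate_law k j : exponential_law coordinate_law (Req k j) 1.
Proof. by move=> A mA; exact: (req_law queue). Qed.

End FromQueue.

(** * Power series over the complex numbers *)

Section ComplexSeries.
Context {R : realType}.
Local Notation C := (Cplx R).
Implicit Types (f g : nat -> C) (a : nat -> R).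

Lemma ofRD (x y : R) : ofR (x + y) = ofR x + ofR y :> C.
Proof. exact: (rmorphD (real_complex R)). Qed.
Lemma ofRB (x y : R) : ofR (x - y) = ofR x - ofR y :> C.
Proof. exact: (rmorphB (real_complex R)). Qed.
Lemma ofRN (x : R) : ofR (- x) = - ofR x :> C.
Proof. exact: (rmorphN (real_complex R)). Qed.
Lemma ofRM (x y : R) : ofR (x * y) = ofR x * ofR y :> C.
Proof. exact: (rmorphM (real_complex R)). Qed.
Lemma ofRX (x : R) n : ofR (x ^+ n) = ofR x ^+ n :> C.
Proof. exact: (rmorphXn (real_complex R)). Qed.
Lemma ofR_nat n : ofR n%:R = n%:R :> C.
Proof. exact: (rmorph_nat (real_complex R)). Qed.
Lemma ofR0 : ofR 0 = 0 :> C. Proof. by []. Qed.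
Lemma ofR1 : ofR 1 = 1 :> C. Proof. by []. Qed.
Lemma ofR_sum (I : Type) (s : seq I) (P : pred I) (F : I -> R) :
  ofR (\sum_(i <- s | P i) F i) = \sum_(i <- s | P i) ofR (F i) :> C.
Proof. exact: (rmorph_sum (real_complex R)). Qed.
Lemma ofR_le (x y : R) : (ofR x <= ofR y :> C) = (x <= y).
Proof. exact: lecR. Qed.
Lemma ofR_lt (x y : R) : (ofR x < ofR y :> C) = (x < y).
Proof. exact: ltcR. Qed.
Lemma ofR_norm (x : R) : `|ofR x : C| = ofR `|x|.
Proof. by rewrite /ofR normc_def/= expr0n addr0 sqrtr_sqr. Qed.
(** A modulus is itself an element of [C]; this turns inequalities between moduli into real ones. *)
Lemma norm_ofR_Re (z : C) : `|z| = ofR (complex.Re `|z|).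
Proof. by rewrite normc_def. Qed.
Lemma ge0_ofR (z : C) : 0 <= z -> z = ofR (complex.Re z).
Proof. by move=> z0; rewrite -(ger0_norm z0) -norm_ofR_Re. Qed.

Definition csum f : C := limn (series f).

Definition dominated f a := (forall n, `|f n| <= ofR (a n)) /\ cvgn (series a).

Lemma dominated_ge0 f a n : dominated f a -> 0 <= a n.
Proof.
by case=> fa _; rewrite -(ofR_le 0); apply: le_trans (fa n); rewrite normr_ge0.
Qed.

Lemma normc_le_ReIm (z : C) : `|z| <= ofR (`|complex.Re z| + `|complex.Im z|).
Proof.
rewrite normc_def ofR_le.
rewrite -ler_sqr ?nnegrE ?sqrtr_ge0 ?addr_ge0// sqr_sqrtr ?addr_ge0 ?sqr_ge0//.
rewrite sqrrD !real_normK ?num_real//.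
by rewrite -addrA lerD2l lerDr mulrn_wge0// mulr_ge0.
Qed.

(** The real and imaginary parts converge absolutely by comparison with [a]; each then accounts for
    half of the tolerance. *)
Lemma is_cvg_csum f a : dominated f a -> cvgn (series f).
Proof.
move=> fa; have [fle ca] := fa.
have cvgpart (g : nat -> R) : (forall n, `|g n| <= a n) -> cvgn (series g).
  move=> ga; apply: normed_cvg; apply: (series_le_cvg _ _ _ ca) => [n|n|n] /=.
  - exact: normr_ge0.
  - exact: dominated_ge0 fa.
  - exact: ga.
have /cvg_ex[/= l1 cr] : cvgn (series (fun n => complex.Re (f n))).
  apply: cvgpart => n; rewrite -ofR_le; apply: le_trans (fle n).
  exact: normc_ge_Re.
have /cvg_ex[/= l2 ci] : cvgn (series (fun n => complex.Im (f n))).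
  apply: cvgpart => n; rewrite -ofR_le; apply: le_trans (fle n).
  rewrite normc_def ofR_le -sqrtr_sqr ler_sqrt; last by rewrite addr_ge0 ?sqr_ge0.
  by rewrite lerDr sqr_ge0.
apply: (cvgP (Complex l1 l2 : C)); apply/cvgrPdist_le => eps eps0.
have epsE := ge0_ofR (ltW eps0).
move: eps0; rewrite epsE -[0]ofR0 ofR_lt => e0; set e := complex.Re eps in e0 *.
have e2 : 0 < e / 2 by rewrite divr_gt0.
move/cvgrPdist_le : cr => /(_ _ e2) cr; move/cvgrPdist_le : ci => /(_ _ e2) ci.
have partE n : series f n = Complex (series (fun n => complex.Re (f n)) n)
                                    (series (fun n => complex.Im (f n)) n).
  rewrite /series/=; elim: n => [|m IHm]; first by rewrite !big_geq.
  by rewrite !big_nat_recr//= IHm; case: (f m).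
near=> n.
apply: (le_trans (normc_le_ReIm _)); rewrite ofR_le [e]splitr partE /=.
by apply: lerD; near: n.
Unshelve. all: by end_near. Qed.

Lemma csum_bound f a : dominated f a -> `|csum f| <= ofR (limn (series a)).
Proof.
move=> fa; have cf := is_cvg_csum fa; have [fle ca] := fa.
have a0 n := dominated_ge0 n fa.
rewrite norm_ofR_Re ofR_le; apply/ler_addgt0Pr => e e0.
rewrite -ofR_le -norm_ofR_Re ofRD.
have := cf; rewrite -/(csum f) => /cvgrPdist_le /(_ (ofR e)).
rewrite -[X in X < _]ofR0 ofR_lt => /(_ e0)[N _ /(_ N (leqnn N)) /= H].
rewrite -[csum f](subrK (series f N)) (le_trans (ler_normD _ _))// addrC lerD//.
rewrite /series/= (le_trans (ler_norm_sum _ _ _))//.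
apply: (@le_trans _ _ (ofR (series a N))).
  by rewrite /series/= ofR_sum; apply: ler_sum.
rewrite ofR_le; apply: nondecreasing_cvgn_le => //.
by apply: nondecreasing_series => n _ _; exact: a0.
Qed.

Lemma csumD f g a b : dominated f a -> dominated g b ->
  csum (fun n => f n + g n) = csum f + csum g.
Proof.
move=> fa gb; apply/cvg_lim; first exact: norm_hausdorff.
rewrite (_ : series _ = series f + series g); last first.
  by apply/funext => n; rewrite /series/= big_split.
by apply: cvgD; [exact: is_cvg_csum fa|exact: is_cvg_csum gb].
Qed.

Lemma csumZ (c : C) f a : dominated f a ->
  csum (fun n => c * f n) = c * csum f.
Proof.
move=> fa; apply/cvg_lim; first exact: norm_hausdorff.
rewrite (_ : series _ = fun n => c * series f n); last first.
  by apply/funext => n; rewrite /series/= mulr_sumr.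
by apply: cvgMr; exact: is_cvg_csum fa.
Qed.

Lemma csumS f a : dominated f a -> csum f = f 0%N + csum (fun n => f n.+1).
Proof.
move=> fa; apply/cvg_lim; first exact: norm_hausdorff.
have cf := is_cvg_csum fa.
have cf' : cvgn (series (fun n => f n.+1)).
  apply: (cvgP (csum f - f 0%N)).
  rewrite (_ : series _ = fun n => series f n.+1 - f 0%N).
    by apply: cvgB; [rewrite (cvg_shiftS (series f))|exact: cvg_cst].
  by apply/funext => n; rewrite /series/= big_nat_recl// addrAC subrr add0r.
rewrite -(cvg_shiftS (series f)).
rewrite (_ : (fun _ => _) = fun n => f 0%N + series (fun n => f n.+1) n).
  by apply: cvgD; [exact: cvg_cst|exact: cf'].
by apply/funext => n; rewrite /series/= big_nat_recl.
Qed.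

End ComplexSeries.

(** * Power series in two variables and their domination *)

Section DoubleSeries.
Context {R : realType}.
Local Notation C := (Cplx R).
Variable r : R.
Hypotheses (r_gt0 : 0 < r) (r_lt1 : r < 1).

(* Dominates the terms of the power series at radius [r], their derivatives and
   their second order increments. *)
Definition weight n : R := r ^- 2 * (n.+1 * n.+2)%:R * r ^+ n.

Lemma weight_ge0 n : 0 <= weight n.
Proof. by rewrite !mulr_ge0 ?invr_ge0 ?exprn_ge0// ltW. Qed.

Lemma is_cvg_weight : cvgn (series weight).
Proof.
have s0 : 0 < 1 - r by rewrite subr_gt0.
(* Multiplication by [1 - r] lowers the degree in n of the coefficients by one, up to a nonpositive
   boundary term, so three successive bounds suffice. *)
have T0 N : \sum_(0 <= n < N) r ^+ n <= (1 - r)^-1.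
  rewrite -[leRHS]mul1r ler_pdivlMr// mulrC.
  have -> : (1 - r) * \sum_(0 <= n < N) r ^+ n = 1 - r ^+ N.
    elim: N => [|N IHN]; first by rewrite big_geq// expr0; ring.
    by rewrite big_nat_recr//= mulrDr IHN exprS; ring.
  by rewrite lerBlDl lerDr exprn_ge0// ltW.
have T1 N : \sum_(0 <= n < N) n.+1%:R * r ^+ n <= (1 - r)^-1 / (1 - r).
  rewrite ler_pdivlMr// mulrC; apply: le_trans (T0 N).
  have -> : (1 - r) * (\sum_(0 <= n < N) n.+1%:R * r ^+ n) =
      \sum_(0 <= n < N) r ^+ n - N%:R * r ^+ N.
    elim: N => [|N IHN]; first by rewrite !big_geq//; ring.
    by rewrite !big_nat_recr//= mulrDr IHN exprS -natr1; ring.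
  by rewrite lerBlDl lerDr mulr_ge0// exprn_ge0// ltW.
have T2 N : \sum_(0 <= n < N) (n.+1 * n.+2)%:R * r ^+ n <= 2 * ((1 - r)^-1 / (1 - r)) / (1 - r).
  rewrite ler_pdivlMr// mulrC.
  have -> : (1 - r) * (\sum_(0 <= n < N) (n.+1 * n.+2)%:R * r ^+ n) =
      2 * (\sum_(0 <= n < N) n.+1%:R * r ^+ n) - (N * N.+1)%:R * r ^+ N.
    elim: N => [|N IHN]; first by rewrite !big_geq//; ring.
    by rewrite !big_nat_recr//= mulrDr IHN exprS !natrM -!natr1; ring.
  rewrite lerBlDl ler_wpDl//; first by rewrite mulr_ge0// exprn_ge0// ltW.
  by rewrite ler_wpM2l.
apply: nondecreasing_is_cvgn.
  by apply: nondecreasing_series => n _ _; exact: weight_ge0.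
exists (r ^- 2 * (2 * ((1 - r)^-1 / (1 - r)) / (1 - r))) => _ [N _ <-].
rewrite /series/= /weight; under eq_bigr do rewrite -mulrA.
rewrite -mulr_sumr ler_wpM2l//; last by rewrite invr_ge0 exprn_ge0// ltW.
Qed.

Definition total_weight : R := limn (series weight).

(** The boolean tells whether the monomial is differentiated; at [n = 0] the derivative is 0
    whatever the truncated exponent. *)
Definition power_term (k : bool) (u : C) n : C :=
  if k then n%:R * u ^+ n.-1 else u ^+ n.

Lemma power_term_le k u n : `|u| <= ofR r -> `|power_term k u n| <= ofR (weight n).
Proof.
move=> ur; have rn m : `|u ^+ m| <= ofR (r ^+ m).
  by rewrite normrX ofRX lerXn2r// nnegrE// ?normr_ge0// -[0]ofR0 ofR_le ltW.
have r2 : 1 <= r ^- 2 by rewrite invf_ge1 ?exprn_gt0// exprn_ile1// ltW.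
case: k => /=.
  rewrite normrM normr_nat -ofR_nat.
  apply: (@le_trans _ _ (ofR (n%:R * r ^+ n.-1))).
    by rewrite ofRM ler_wpM2l// ?ofR_nat.
  rewrite ofR_le /weight; case: n => [|n] /=.
    by rewrite mul0r mulr_ge0// mulr_ge0 ?invr_ge0 ?exprn_ge0// ltW.
  rewrite [r ^+ n.+1]exprS mulrA ler_wpM2r ?exprn_ge0 ?(ltW r_gt0)//.
  have -> : r ^- 2 * (n.+2 * n.+3)%:R * r = r^-1 * (n.+2 * n.+3)%:R.
    by field; rewrite gt_eqF.
  apply: (@le_trans _ _ (n.+2 * n.+3)%:R); first by rewrite ler_nat; nia.
  by rewrite ler_peMl// invf_ge1// ltW.
apply: (le_trans (rn n)); rewrite ofR_le /weight ler_peMl ?exprn_ge0 ?(ltW r_gt0)//.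
by rewrite -[leLHS]mul1r ler_pM// ler1n.
Qed.

Lemma power_term_mul u n : u * power_term true u n = n%:R * u ^+ n.
Proof. by case: n => [|n]; rewrite /= ?mul0r ?mulr0// exprS mulrCA. Qed.

(** The error at [n.+1] is [u + h] times the error at [n], plus [h ^+ 2] times the derivative at
    [n]. Induction thus gives [n ^ 2 r ^ (n - 2)], and the factor [r ^+ 2] in [main] avoids negative
    powers. *)
Lemma power_term_taylor u h n : `|u| <= ofR r -> `|u + h| <= ofR r ->
  `|(u + h) ^+ n - u ^+ n - h * power_term true u n| <= `|h| ^+ 2 * ofR (weight n).
Proof.
move=> ur uhr.
have rC0 : 0 < ofR r :> C by rewrite -[0]ofR0 ofR_lt.
have main : `|(u + h) ^+ n - u ^+ n - h * power_term true u n| * ofR r ^+ 2 <=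
    `|h| ^+ 2 * (n%:R ^+ 2 * ofR r ^+ n).
  elim: n => [|n IHn].
    by rewrite !expr0 subrr /= mul0r mulr0 subr0 normr0 mul0r expr0n/= mul0r mulr0.
  have -> : (u + h) ^+ n.+1 - u ^+ n.+1 - h * power_term true u n.+1 =
    (u + h) * ((u + h) ^+ n - u ^+ n - h * power_term true u n) +
    h ^+ 2 * power_term true u n.
    have -> : power_term true u n.+1 = u ^+ n + u * power_term true u n.
      by rewrite power_term_mul /= -natr1; ring.
    by rewrite !exprS; ring.
  have r20 : 0 <= ofR r ^+ 2 :> C by rewrite exprn_ge0// ltW.
  apply: (le_trans (ler_wpM2r r20 (ler_normD _ _))); rewrite mulrDl.
  rewrite normrM -mulrA.
  apply: (@le_trans _ _ (ofR r * (`|h| ^+ 2 * (n%:R ^+ 2 * ofR r ^+ n)) +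
      `|h| ^+ 2 * (n%:R * ofR r ^+ n.+1))).
    apply: lerD; first by rewrite ler_pM// mulr_ge0.
    rewrite normrM normrX -mulrA ler_wpM2l ?exprn_ge0//.
    rewrite /= normrM normr_nat -mulrA; case: n {IHn} => [|n]; first by rewrite !mul0r.
    rewrite ler_wpM2l// -[n.+2]addn2 exprD ler_wpM2r// normrX.
    by rewrite lerXn2r ?nnegrE// ltW.
  have -> : ofR r * (`|h| ^+ 2 * (n%:R ^+ 2 * ofR r ^+ n)) + `|h| ^+ 2 * (n%:R * ofR r ^+ n.+1) =
     `|h| ^+ 2 * ((n%:R ^+ 2 + n%:R) * ofR r ^+ n.+1) by rewrite [ofR r ^+ n.+1]exprS; ring.
  rewrite ler_wpM2l ?exprn_ge0// ler_wpM2r ?exprn_ge0 ?(ltW rC0)//.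
  by rewrite -natrX -natrD -natrX ler_nat; nia.
rewrite -(ler_pM2r (exprn_gt0 2 rC0)); apply: (le_trans main).
rewrite -[leRHS]mulrA ler_wpM2l ?exprn_ge0//.
rewrite -ofRX -ofRX -ofR_nat -ofRX -!ofRM ofR_le /weight.
have -> : r ^- 2 * (n.+1 * n.+2)%:R * r ^+ n * r ^+ 2 = (n.+1 * n.+2)%:R * r ^+ n.
  by field; rewrite gt_eqF.
by rewrite ler_wpM2r ?exprn_ge0 ?(ltW r_gt0)// -natrX ler_nat; nia.
Qed.

End DoubleSeries.

Section DSum.
Context {R : realType}.
Local Notation C := (Cplx R).
Variable r : R.
Hypotheses (r_gt0 : 0 < r) (r_lt1 : r < 1).
Let w := weight r.
Let w_ge0 n : 0 <= w n := weight_ge0 r_gt0 n.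
Implicit Types (c : nat -> nat -> C) (M : R).

Definition dominated2 M c := forall n b, `|c n b| <= ofR (M * (w n * w b)).

Definition dsum c : C := csum (fun b => csum (fun n => c n b)).

Lemma dominated2_inner M c b : dominated2 M c ->
  dominated (fun n => c n b) (fun n => M * w b * w n).
Proof.
move=> cM; split=> [n|]; first by rewrite -mulrA (mulrC (w b)).
rewrite (_ : series _ = fun N => M * w b * series w N).
  by apply: is_cvgMr; exact: is_cvg_weight.
by apply/funext => N; rewrite /series/= mulr_sumr.
Qed.

Lemma dominated2_outer M c : dominated2 M c ->
  dominated (fun b => csum (fun n => c n b))
    (fun b => M * total_weight r * w b).
Proof.
move=> cM; split=> [b|]; last first.
  rewrite (_ : series _ = fun N => M * total_weight r * series w N).
    by apply: is_cvgMr; exact: is_cvg_weight.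
  by apply/funext => N; rewrite /series/= mulr_sumr.
apply: le_trans (csum_bound (dominated2_inner b cM)) _; rewrite ofR_le.
rewrite (_ : series _ = fun N => M * w b * series w N).
  rewrite (cvg_lim _ (cvgMr (is_cvg_weight r_gt0 r_lt1))) //.
  by rewrite mulrAC.
by apply/funext => N; rewrite /series/= mulr_sumr.
Qed.

Lemma dsum_bound M c : dominated2 M c ->
  `|dsum c| <= ofR (M * (total_weight r * total_weight r)).
Proof.
move=> cM; apply: le_trans (csum_bound (dominated2_outer cM)) _; rewrite ofR_le.
rewrite (_ : series _ = fun N => M * total_weight r * series w N).
  rewrite (cvg_lim _ (cvgMr (is_cvg_weight r_gt0 r_lt1))) //.
  by rewrite mulrA.
by apply/funext => N; rewrite /series/= mulr_sumr.
Qed.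

(** The domination travels with the value, so that a linear relation between sums reduces, by
    [sums_to_uniq], to an identity between general terms. *)
Definition sums_to c (x : C) := x = dsum c /\ exists M, dominated2 M c.

Lemma sums_toD c c' x y : sums_to c x -> sums_to c' y ->
  sums_to (fun n b => c n b + c' n b) (x + y).
Proof.
move=> [-> [M cM]] [-> [M' cM']]; split; last first.
  exists (M + M') => n b; rewrite mulrDl ofRD.
  exact: (le_trans (ler_normD _ _) (lerD (cM n b) (cM' n b))).
rewrite -(csumD (dominated2_outer cM) (dominated2_outer cM')).
congr csum; apply/funext => b.
by rewrite -(csumD (dominated2_inner b cM) (dominated2_inner b cM')).
Qed.

Lemma sums_toZ (k : C) c x : sums_to c x ->
  sums_to (fun n b => k * c n b) (k * x).
Proof.
move=> [-> [M cM]]; split; last first.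
  exists (complex.Re `|k| * M) => n b.
  by rewrite normrM norm_ofR_Re -mulrA ofRM ler_wpM2l// -norm_ofR_Re.
rewrite -(csumZ k (dominated2_outer cM)).
congr csum; apply/funext => b.
by rewrite -(csumZ k (dominated2_inner b cM)).
Qed.

Lemma sums_toB c c' x y : sums_to c x -> sums_to c' y ->
  sums_to (fun n b => c n b - c' n b) (x - y).
Proof.
move=> cx cy; have := sums_toD cx (sums_toZ (-1) cy).
rewrite mulN1r (_ : (fun n b => _) = (fun n b => c n b - c' n b)) //.
by apply/funext => n; apply/funext => b; rewrite mulN1r.
Qed.

Lemma sums_to_uniq c c' x y : sums_to c x -> sums_to c' y ->
  (forall n b, c n b = c' n b) -> x = y.
Proof.
move=> [-> _] [-> _] cc'; congr dsum.
by apply/funext => n; apply/funext => b.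
Qed.

Lemma dsum_shift1 c x : sums_to c x -> (forall b, c 0%N b = 0) ->
  x = dsum (fun n b => c n.+1 b).
Proof.
move=> [-> [M cM]] c0; congr csum; apply/funext => b.
by rewrite (csumS (dominated2_inner b cM)) c0 add0r.
Qed.

Lemma dsum_shift2 c x : sums_to c x -> (forall n, c n 0%N = 0) ->
  x = dsum (fun n b => c n b.+1).
Proof.
move=> [-> [M cM]] c0; rewrite /dsum (csumS (dominated2_outer cM)).
rewrite (_ : csum _ = 0) ?add0r//.
have := csum_bound (f := fun n => c n 0%N) (a := fun=> 0).
rewrite (_ : series (fun=> 0) = fun=> 0); last first.
  by apply/funext => N; rewrite /series/= big1.
rewrite lim_cst// => H; apply/eqP; rewrite -normr_le0; apply: H; split.
  by move=> n; rewrite c0 normr0.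
by rewrite (_ : series _ = fun=> 0); [exact: is_cvg_cst|
  apply/funext => N; rewrite /series/= big1].
Qed.

Variables (u v : C).
Hypotheses (ur : `|u| <= ofR r) (vr : `|v| <= ofR r).
Implicit Type a : nat -> nat -> R.

Definition gterm a (k l : bool) (u v : C) n b : C :=
  ofR (a n b) * (power_term k u n * power_term l v b).

Lemma gterm_dominated a M k l u' : `|u'| <= ofR r ->
  (forall n b, `|a n b| <= M) -> dominated2 M (gterm a k l u' v).
Proof.
move=> u'r aM n b; rewrite /gterm normrM ofRM ler_pM//.
  by rewrite ofR_norm ofR_le.
by rewrite normrM ofRM ler_pM// power_term_le.
Qed.

Definition bounded2 a := exists M, forall n b, `|a n b| <= M.

Lemma sums_to_gterm a k l : bounded2 a ->
  sums_to (gterm a k l u v) (dsum (gterm a k l u v)).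
Proof. by move=> [M aM]; split=> //; exists M; exact: gterm_dominated. Qed.

(** The series of [a] is a part free of [u] plus [u] times the series of [a']; this is its
    derivative by the product rule. *)
Lemma dsum_gterm_shift1 a a' l : bounded2 a -> bounded2 a' ->
  (forall n b, a n.+1 b = a' n b) ->
  dsum (gterm a true l u v) =
  dsum (gterm a' false l u v) + u * dsum (gterm a' true l u v).
Proof.
move=> ba ba' aa'.
rewrite (dsum_shift1 (sums_to_gterm true l ba)); last first.
  by move=> b; rewrite /gterm/= mul0r mul0r mulr0.
have [-> _] := sums_toD (sums_to_gterm false l ba') (sums_toZ u (sums_to_gterm true l ba')).
congr dsum; apply/funext => n; apply/funext => b.
rewrite /gterm aa'.
rewrite (_ : u * (_ * (_ * _)) =
  ofR (a' n b) * (u * power_term true u n * power_term l v b)); last by ring.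
by rewrite power_term_mul /= -natr1; ring.
Qed.

Lemma dsum_gterm_shift2 a a' k : bounded2 a -> bounded2 a' ->
  (forall n b, a n b.+1 = a' n b) ->
  dsum (gterm a k true u v) =
  dsum (gterm a' k false u v) + v * dsum (gterm a' k true u v).
Proof.
move=> ba ba' aa'.
rewrite (dsum_shift2 (sums_to_gterm k true ba)); last first.
  by move=> n; rewrite /gterm/= mul0r mulr0 mulr0.
have [-> _] := sums_toD (sums_to_gterm k false ba') (sums_toZ v (sums_to_gterm k true ba')).
congr dsum; apply/funext => n; apply/funext => b.
rewrite /gterm aa'.
rewrite (_ : v * (_ * (_ * _)) =
  ofR (a' n b) * (power_term k u n * (v * power_term true v b))); last by ring.
by rewrite power_term_mul /= -natr1; ring.
Qed.

Lemma dsum_gterm_mul1 a a' l : bounded2 a -> bounded2 a' ->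
  (forall n b, a' n.+1 b = a n b) -> (forall b, a' 0%N b = 0) ->
  u * dsum (gterm a false l u v) = dsum (gterm a' false l u v).
Proof.
move=> ba ba' aa' a'0.
rewrite (dsum_shift1 (sums_to_gterm false l ba')); last first.
  by move=> b; rewrite /gterm a'0 mul0r.
have [-> _] := sums_toZ u (sums_to_gterm false l ba).
congr dsum; apply/funext => n; apply/funext => b.
by rewrite /gterm aa' /= exprS; ring.
Qed.

End DSum.

(** * The partial differential equation *)

Section Limits.
Context {R : realType}.
Local Notation C := (Cplx R).

Lemma cvg_linear_error (T : Type) (F : set_system T) (f : T -> C) (l : C)
    (g : T -> R) (K : R) : Filter F -> g t @[t --> F] --> (0 : R) ->
  (\forall t \near F, `|f t - l| <= ofR (K * g t)) -> f t @[t --> F] --> l.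
Proof.
move=> FF g0 fl; apply/cvgrPdist_le => eps eps0.
have epsE := ge0_ofR (ltW eps0).
move: eps0; rewrite epsE -[0]ofR0 ofR_lt => e0; set e := complex.Re eps in e0 *.
have : K * g t @[t --> F] --> K * 0 by apply: cvgMr.
rewrite mulr0 => /cvgrPdist_le /(_ e e0) Kg.
near=> t; rewrite distrC.
have h1 : `|f t - l| <= ofR (K * g t) by near: t.
apply: (le_trans h1); rewrite ofR_le.
have : `|0 - K * g t| <= e by near: t.
by rewrite sub0r normrN; apply: le_trans; exact: ler_norm.
Unshelve. all: by end_near. Qed.

Lemma derivable_quadratic_error (f : C -> C) (u l : C) (K del : R) : 0 < del ->
  (forall h : C, `|h| <= ofR del -> `|f (u + h) - f u - h * l| <= ofR K * `|h| ^+ 2) ->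
  derivable f u 1 /\ derive1 f u = l.
Proof.
move=> del0 fl.
have H : h^-1 *: ((f \o shift u) (h *: (1 : C)) - f u) @[h --> (0 : C)^'] --> l.
  apply: (cvg_linear_error (g := fun h => complex.Re `|h|) (K := K)).
    apply/cvgrPdist_le => eps eps0.
    have epsC : 0 < ofR eps :> C by rewrite -[0]ofR0 ofR_lt.
    near=> h; rewrite sub0r normrN -ofR_le -ofR_norm -norm_ofR_Re normr_id.
    by near: h; exact: (@dnbhs0_le (Cplx R) (Cplx R) _ epsC).
  have delC : 0 < ofR del :> C by rewrite -[0]ofR0 ofR_lt.
  near=> h.
  have h0 : h != 0 by near: h; exact: (@nbhs_dnbhs_neq C).
  have hd : `|h| <= ofR del by near: h; exact: (@dnbhs0_le (Cplx R) (Cplx R) _ delC).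
  rewrite /= scaler1 -[h + u]addrC ofRM -norm_ofR_Re.
  have h_gt0 : 0 < `|h| by rewrite normr_gt0.
  rewrite -(ler_pM2l h_gt0) -normrM mulrBr -[_ *: _]/(_ * _) mulrA mulfV// mul1r.
  by apply: (le_trans (fl h hd)); rewrite expr2 mulrCA.
split; first exact: cvgP H.
by rewrite derive1E; apply/cvg_lim; [exact: norm_hausdorff|exact: H].
Unshelve. all: by end_near. Qed.

(** Points to the right of [x] are available even at [x = 0]; properness is what makes the limit of
    the difference quotients unique. *)
Lemma within_ge0_proper (x : R) : 0 <= x ->
  ProperFilter (within [set y : R | 0 <= y] x^').
Proof.
move=> x0; apply: Build_ProperFilter.
rewrite /within/= => H; apply: (@filter_not_empty _ x^'+).
have H' : nbhs x (fun y => y != x -> 0 <= y -> False) := H.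
have : nbhs x (fun y => x < y -> set0 y).
  apply: filterS H' => y Hy xy.
  by apply: Hy; [rewrite gt_eqF|rewrite (le_trans x0)// ltW].
exact.
Qed.

Lemma cvg_diff_quotient (f : R -> C) (x : R) (l : C) (K : R) : 0 <= x ->
  (forall y, 0 <= y -> `|f y - f x - ofR (y - x) * l| <= ofR (K * (y - x) ^+ 2)) ->
  ofR (y - x)^-1 * (f y - f x) @[y --> within [set y | 0 <= y] x^'] --> l.
Proof.
move=> x0 fl.
have FF : Filter (within [set y : R | 0 <= y] x^').
  exact: (within_filter _ (dnbhs_filter x)).
apply: (cvg_linear_error (g := fun y => `|y - x|) (K := K)).
  have h : `|y - x| @[y --> x] --> `|x - x|.
    by apply: cvg_norm; apply: cvgB; [exact: cvg_id|exact: cvg_cst].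
  rewrite subrr normr0 in h.
  apply: cvg_within_filter; apply: cvg_trans h; apply: cvg_app.
  exact: nbhs_dnbhs.
near=> y.
have yx : y != x.
  near: y; apply: cvg_within.
  exact: (@nbhs_dnbhs_neq R x).
have y0 : 0 <= y by near: y; exact: withinT.
have yx0 : y - x != 0 by rewrite subr_eq0.
have n0 : 0 < ofR `|y - x| :> C by rewrite -[0]ofR0 ofR_lt normr_gt0.
rewrite -(ler_pM2l n0) -{1}ofR_norm -normrM mulrBr mulrA -ofRM mulfV// mul1r.
apply: (le_trans (fl y y0)); rewrite -ofRM ofR_le.
rewrite (_ : `|y - x| * (K * `|y - x|) = K * `|y - x| ^+ 2); last by ring.
by rewrite real_normK// num_real.
Unshelve. all: by end_near. Qed.

End Limits.

(** * The equation for an abstract bounded solution of the backward equations *)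

Section PDE.
Context {R : realType}.
Local Notation C := (Cplx R).
Variables (e D dr : nat -> nat -> R -> R) (rho q L M K : R).
Hypotheses (q_ge0 : 0 <= q) (q_lt1 : q < 1).
Hypothesis e01 : forall n b x, 0 <= e n b x <= 1.
Hypothesis e0 : forall n x, e n 0 x = 0.
Hypothesis D_itv : forall n b x, 0 <= D n b x <= M.
Hypothesis D_rec : forall n b x, D n b x = e n.+1 b x + q * D n.+1 b x.
Hypothesis dr_bound : forall n b x, `|dr n b x| <= L.
Hypothesis drE : forall n b x, (n + b)%:R * dr n b x =
  - (1 + rho) * (n + b)%:R * e n b x + b%:R * e n b.-1 x +
  n%:R * e n.-1 b x + rho * (1 - q) * ((n + b)%:R * D n b x).
Hypothesis taylor : forall n b x y, 0 <= x -> 0 <= y ->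
  `|e n b y - e n b x - (y - x) * dr n b x| <= K * (y - x) ^+ 2.

Definition gen_term (a : nat -> nat -> R -> R) (x : R) k l (u v : C) : C :=
  dsum (gterm (fun n b => a n b x) k l u v).

Let be x : bounded2 (fun n b => e n b x).
Proof. by exists 1 => n b; have /andP[h1 h2] := e01 n b x; rewrite ger0_norm. Qed.

Let bD x : bounded2 (fun n b => D n b x).
Proof. by exists M => n b; have /andP[h1 h2] := D_itv n b x; rewrite ger0_norm. Qed.

Let bd x : bounded2 (fun n b => dr n b x).
Proof. by exists L => n b. Qed.

Section Point.
Variables (r : R) (u v : C).
Hypotheses (r_gt0 : 0 < r) (r_lt1 : r < 1).
Hypotheses (ur : `|u| <= ofR r) (vr : `|v| <= ofR r).
Local Notation rep := (@sums_to_gterm R r r_gt0 r_lt1 u v ur vr).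

Let sumD := @sums_toD R r r_gt0 r_lt1.
Let sumZ := @sums_toZ R r r_gt0 r_lt1.
Let sumB := @sums_toB R r r_gt0 r_lt1.

Lemma drift_equation x :
  u * gen_term dr x true false u v + v * gen_term dr x false true u v =
  - ofR (1 + rho) * (u * gen_term e x true false u v + v * gen_term e x false true u v)
  + u * (gen_term e x false false u v + u * gen_term e x true false u v)
  + v * (gen_term e x false false u v + v * gen_term e x false true u v)
  + ofR (rho * (1 - q)) * (u * gen_term D x true false u v + v * gen_term D x false true u v).
Proof.
(* [e1] and [e2] are the coefficients of u E and v E. They differ from [e n.-1 b] and [e n b.-1] at
   index 0 only, where the factors [n] and [b] vanish. *)
pose e1 n b x := if n is n'.+1 then e n' b x else 0.
pose e2 n b x := if b is b'.+1 then e n b' x else 0.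
have b1 : bounded2 (fun n b => e1 n b x).
  by exists 1 => -[|n] b /=; rewrite ?normr0//; have /andP[? ?] := e01 n b x; rewrite ger0_norm.
have b2 : bounded2 (fun n b => e2 n b x).
  by exists 1 => n [|b] /=; rewrite ?normr0//; have /andP[? ?] := e01 n b x; rewrite ger0_norm.
have <- := @dsum_gterm_shift1 R r r_gt0 r_lt1 u v ur vr _ _ false b1 (be x) (fun _ _ => erefl).
have <- := @dsum_gterm_shift2 R r r_gt0 r_lt1 u v ur vr _ _ false b2 (be x) (fun _ _ => erefl).
apply: (@sums_to_uniq R r).
- apply: sumD; apply: sumZ; exact: rep (bd x).
- apply: sumD; last by apply: sumZ; apply: sumD; apply: sumZ; exact: rep (bD x).
  apply: sumD; last by apply: sumZ; exact: rep b2.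
  apply: sumD; last by apply: sumZ; exact: rep b1.
  by apply: sumZ; apply: sumD; apply: sumZ; exact: rep (be x).
move=> n b; rewrite /gterm.
have uE (a : C) y : u * (a * (power_term true u n * y)) = a * (n%:R * u ^+ n * y).
  by rewrite -power_term_mul; ring.
have vE (a : C) y : v * (a * (y * power_term true v b)) = a * (y * (b%:R * v ^+ b)).
  by rewrite -power_term_mul; ring.
rewrite !uE !vE.
have e1E : n%:R * e1 n b x = n%:R * e n.-1 b x by case: (n) => [|n']; rewrite ?mul0r.
have e2E : b%:R * e2 n b x = b%:R * e n b.-1 x by case: (b) => [|b']; rewrite ?mul0r.
have := congr1 (@ofR R) (drE n b x); rewrite -e1E -e2E.
rewrite natrD !(ofRD, ofRM, ofRN, ofR_nat).
set X := power_term false u n; set Y := power_term false v b.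
rewrite -[u ^+ n]/X -[v ^+ b]/Y => H.
transitivity ((n%:R + b%:R) * ofR (dr n b x) * (X * Y)); first by ring.
by rewrite H; ring.
Qed.

(* The last sum is the value of the [e]-series at [u = q]: it does not depend on
   [u], and the left-hand side vanishes at [u = q]. *)
Lemma shift_equation x l :
  (u - ofR q) * gen_term D x false l u v =
  gen_term e x false l u v -
  dsum (gterm (fun n b => if n == 0%N then e n b x + q * D n b x else 0) false l u v).
Proof.
pose D1 n b := if n is n'.+1 then D n' b x else 0.
have bD1 : bounded2 D1.
  exists M => -[|n] b /=; last by have /andP[? ?] := D_itv n b x; rewrite ger0_norm.
  by rewrite normr0; have /andP[h1 h2] := D_itv 0%N 0%N x; exact: le_trans h2.
have bK : bounded2 (fun n b => if n == 0%N then e n b x + q * D n b x else 0).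
  exists (1 + M) => n b; have /andP[? ?] := D_itv n b x; have /andP[? ?] := e01 n b x.
  have M0 : 0 <= M by lra.
  have qD : 0 <= q * D n b x <= M.
    by rewrite mulr_ge0//= (le_trans _ (ler_piMl M0 (ltW q_lt1)))// ler_wpM2l.
  by case: ifP => _; rewrite ?normr0 ?ger0_norm; lra.
rewrite mulrBl (@dsum_gterm_mul1 R r r_gt0 r_lt1 u v ur vr _ D1 l (bD x) bD1)//.
apply: (@sums_to_uniq R r).
- apply: sumB; first exact: rep bD1.
  by apply: sumZ; exact: rep (bD x).
- by apply: sumB; [exact: rep (be x)|exact: rep bK].
move=> n b; rewrite /gterm /D1; case: n => [|n] /=.
  by rewrite ofRD ofRM; ring.
by rewrite D_rec ofRD ofRM; ring.
Qed.

(** The derivative in [u] of the relation [(u - q)] D(u) = E(u) - E(q), derived from the recursion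
    of the coefficients and thus free of any division. *)
Lemma derivative_equation x l :
  gen_term e x true l u v =
  gen_term D x false l u v + (u - ofR q) * gen_term D x true l u v.
Proof.
have bs : bounded2 (fun n b => e n b x + q * D n b x).
  exists (1 + M) => n b; have /andP[? ?] := D_itv n b x; have /andP[? ?] := e01 n b x.
  have M0 : 0 <= M by lra.
  have qD : 0 <= q * D n b x <= M.
    by rewrite mulr_ge0//= (le_trans _ (ler_piMl M0 (ltW q_lt1)))// ler_wpM2l.
  by rewrite ger0_norm; lra.
have := @dsum_gterm_shift1 R r r_gt0 r_lt1 u v ur vr _ _ l bs (bD x)
  (fun n b => esym (D_rec n b x)).
have -> : dsum (gterm (fun n b => e n b x + q * D n b x) true l u v) =
    gen_term e x true l u v + ofR q * gen_term D x true l u v.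
  apply: (@sums_to_uniq R r); first exact: rep bs.
    by apply: sumD; [exact: rep (be x)|apply: sumZ; exact: rep (bD x)].
  by move=> n b; rewrite /gterm ofRD ofRM; ring.
by move=> H; rewrite mulrBl addrA -H addrK.
Qed.

Lemma gen_term_u_error a Ma h l : (forall n b, `|a n b| <= Ma) ->
  `|u + h| <= ofR r ->
  `|dsum (gterm a false l (u + h) v) - dsum (gterm a false l u v) -
    h * dsum (gterm a true l u v)| <=
  ofR (Ma * (total_weight r * total_weight r)) * `|h| ^+ 2.
Proof.
move=> aM uhr; have ba : bounded2 a by exists Ma.
have [-> _] := sumB (sumB (@sums_to_gterm R r r_gt0 r_lt1 (u + h) v uhr vr _ false l ba)
  (rep false l ba)) (sumZ h (rep true l ba)).
set eta := complex.Re `|h|.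
have hE : `|h| = ofR eta := norm_ofR_Re h.
apply: (le_trans (@dsum_bound R r r_gt0 r_lt1 (Ma * eta ^+ 2) _ _)).
  move=> n b; rewrite /gterm /=.
  rewrite (_ : _ - _ = ofR (a n b) * (((u + h) ^+ n - u ^+ n - h * power_term true u n) *
    power_term l v b)); last by rewrite /=; ring.
  rewrite normrM -mulrA ofRM; apply: ler_pM => //.
    by rewrite ofR_norm ofR_le.
  rewrite normrM mulrA ofRM; apply: ler_pM => //; last exact: power_term_le.
  by rewrite ofRM ofRX -hE; exact: power_term_taylor.
by rewrite hE -ofRX -ofRM ofR_le (_ : _ * _ * _ = Ma * (total_weight r * total_weight r) * eta ^+ 2)//; ring.
Qed.

Lemma gen_term_v_error a Ma h k : (forall n b, `|a n b| <= Ma) ->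
  `|v + h| <= ofR r ->
  `|dsum (gterm a k false u (v + h)) - dsum (gterm a k false u v) -
    h * dsum (gterm a k true u v)| <=
  ofR (Ma * (total_weight r * total_weight r)) * `|h| ^+ 2.
Proof.
move=> aM uhr; have ba : bounded2 a by exists Ma.
have [-> _] := sumB (sumB (@sums_to_gterm R r r_gt0 r_lt1 u (v + h) ur uhr _ k false ba)
  (rep k false ba)) (sumZ h (rep k true ba)).
set eta := complex.Re `|h|.
have hE : `|h| = ofR eta := norm_ofR_Re h.
apply: (le_trans (@dsum_bound R r r_gt0 r_lt1 (Ma * eta ^+ 2) _ _)).
  move=> n b; rewrite /gterm /=.
  rewrite (_ : _ - _ = ofR (a n b) * (power_term k u n *
    ((v + h) ^+ b - v ^+ b - h * power_term true v b))); last by rewrite /=; ring.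
  rewrite normrM -mulrA ofRM; apply: ler_pM => //.
    by rewrite ofR_norm ofR_le.
  rewrite normrM (_ : eta ^+ 2 * _ = weight r n * (eta ^+ 2 * weight r b)); last by ring.
  rewrite ofRM; apply: ler_pM => //; first exact: power_term_le.
  by rewrite ofRM ofRX -hE; exact: power_term_taylor.
by rewrite hE -ofRX -ofRM ofR_le (_ : _ * _ * _ = Ma * (total_weight r * total_weight r) * eta ^+ 2)//; ring.
Qed.

(** Since [K] does not depend on [n] and [b], termwise differentiation in [x] is legitimate; taking
    [k] or [l] true yields the mixed derivatives. *)
Lemma gen_term_x_error x y k l : 0 <= x -> 0 <= y ->
  `|gen_term e y k l u v - gen_term e x k l u v - ofR (y - x) * gen_term dr x k l u v| <=
  ofR (K * (total_weight r * total_weight r) * (y - x) ^+ 2).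
Proof.
move=> x0 y0.
have [-> _] := sumB (sumB (rep k l (be y)) (rep k l (be x))) (sumZ (ofR (y - x)) (rep k l (bd x))).
apply: (le_trans (@dsum_bound R r r_gt0 r_lt1 (K * (y - x) ^+ 2) _ _)).
  move=> n b; rewrite /gterm /=.
  rewrite (_ : _ - _ = ofR (e n b y - e n b x - (y - x) * dr n b x) *
     (power_term k u n * power_term l v b)); last by rewrite !ofRB ofRM ofRB; ring.
  rewrite normrM ofRM; apply: ler_pM => //.
    by rewrite ofR_norm ofR_le; exact: taylor.
  by rewrite normrM ofRM ler_pM// power_term_le.
by rewrite ofR_le (_ : _ * _ * _ = K * (total_weight r * total_weight r) * (y - x) ^+ 2)//; ring.
Qed.

End Point.

Lemma shift_constant x l (u u' v : C) :
  dsum (gterm (fun n b => if n == 0%N then e n b x + q * D n b x else 0) false l u v) =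
  dsum (gterm (fun n b => if n == 0%N then e n b x + q * D n b x else 0) false l u' v).
Proof.
congr dsum; apply/funext => n; apply/funext => b; rewrite /gterm.
by case: n => [|n] /=; rewrite ?expr0// !mul0r.
Qed.

Lemma inner_partial_sumE x (u v : C) b :
  inner_partial_sum e x u v b =
  series (fun n => gterm (fun n b => e n b x) false false u v n b).
Proof.
apply/funext => N; rewrite /inner_partial_sum /series/=.
by apply: eq_bigr => n _; rewrite /gterm /= mulrA.
Qed.

Lemma outer_partial_sumE x (u v : C) :
  outer_partial_sum e x u v =
  series (fun b => csum (fun n => gterm (fun n b => e n b x) false false u v n b)).
Proof.
apply/funext => B; rewrite /outer_partial_sum /series/=.
under eq_bigr do rewrite inner_partial_sumE -/(csum _).
case: B => [|B]; first by rewrite !big_geq.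
(* The generating function starts at [b = 1] and [dsum] at [b = 0], where the coefficients vanish by
   [e0]. *)
rewrite [RHS]big_ltn// [X in X + _](_ : _ = 0) ?add0r//.
rewrite /csum (_ : series _ = fun=> 0); last first.
  by apply/funext => N; rewrite /series/= big1// => n _; rewrite /gterm e0 mul0r.
by apply: lim_cst; exact: norm_hausdorff.
Qed.

Lemma gen_funE x (u v : C) : gen_fun e x u v = gen_term e x false false u v.
Proof. by rewrite /gen_fun outer_partial_sumE. Qed.

(** [r] is midway between 1 and the largest of |u|, |v| and [q]. The margin [del] leaves room for
    increments, and [q <= r] allows evaluation at [q]. *)
Lemma exists_radius (u v : C) : `|u| < 1 -> `|v| < 1 ->
  exists r del : R, [/\ 0 < r, r < 1, q <= r, 0 < del &
    `|u| + ofR del <= ofR r /\ `|v| + ofR del <= ofR r].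
Proof.
rewrite (norm_ofR_Re u) (norm_ofR_Re v) -[1]ofR1 !ofR_lt.
set a := complex.Re _; set b := complex.Re _ => a1 b1.
have a0 : 0 <= a by rewrite -ofR_le -norm_ofR_Re ofR0 normr_ge0.
have b0 : 0 <= b by rewrite -ofR_le -norm_ofR_Re ofR0 normr_ge0.
pose m := Num.max (Num.max a b) q.
have m1 : m < 1 by rewrite !gt_max a1 b1.
have [am bm qm] : [/\ a <= m, b <= m & q <= m].
  by rewrite /m !le_max !lexx !orbT.
exists ((1 + m) / 2), ((1 - m) / 2); rewrite -!ofRD !ofR_le.
by split; [lra|lra|lra|lra|split; lra].
Qed.

Lemma derivable_gen_term_u x l (u v : C) : `|u| < 1 -> `|v| < 1 ->
  derivable (fun z => gen_term e x false l z v) u 1 /\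
  derive1 (fun z => gen_term e x false l z v) u = gen_term e x true l u v.
Proof.
move=> u1 v1; have [r [del [r0 r1 _ del0 [udel vdel]]]] := exists_radius u1 v1.
have del0C : 0 <= ofR del :> C by rewrite -[0]ofR0 ofR_le ltW.
have ur : `|u| <= ofR r by apply: le_trans udel; rewrite lerDl.
have vr : `|v| <= ofR r by apply: le_trans vdel; rewrite lerDl.
apply: (derivable_quadratic_error del0 (K := 1 * (total_weight r * total_weight r))) => h hdel.
apply: gen_term_u_error => //.
  by move=> n b; have /andP[? ?] := e01 n b x; rewrite ger0_norm.
apply: (le_trans (ler_normD _ _)); apply: le_trans udel.
by rewrite lerD2l.
Qed.

Lemma derivable_gen_term_v x k (u v : C) : `|u| < 1 -> `|v| < 1 ->
  derivable (fun z => gen_term e x k false u z) v 1 /\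
  derive1 (fun z => gen_term e x k false u z) v = gen_term e x k true u v.
Proof.
move=> u1 v1; have [r [del [r0 r1 _ del0 [udel vdel]]]] := exists_radius u1 v1.
have del0C : 0 <= ofR del :> C by rewrite -[0]ofR0 ofR_le ltW.
have ur : `|u| <= ofR r by apply: le_trans udel; rewrite lerDl.
have vr : `|v| <= ofR r by apply: le_trans vdel; rewrite lerDl.
apply: (derivable_quadratic_error del0 (K := 1 * (total_weight r * total_weight r))) => h hdel.
apply: gen_term_v_error => //.
  by move=> n b; have /andP[? ?] := e01 n b x; rewrite ger0_norm.
apply: (le_trans (ler_normD _ _)); apply: le_trans vdel.
by rewrite lerD2l.
Qed.

Local Notation E := (gen_fun e).

Lemma partial_uE x (u v : C) : `|u| < 1 -> `|v| < 1 ->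
  partial_u E x u v = gen_term e x true false u v.
Proof.
move=> u1 v1; rewrite /partial_u.
rewrite (_ : (fun z => _) = (fun z => gen_term e x false false z v)).
  by have [] := derivable_gen_term_u x false u1 v1.
by apply/funext => z; rewrite gen_funE.
Qed.

Lemma partial_vE x (u v : C) : `|u| < 1 -> `|v| < 1 ->
  partial_v E x u v = gen_term e x false true u v.
Proof.
move=> u1 v1; rewrite /partial_v.
rewrite (_ : (fun z => _) = (fun z => gen_term e x false false u z)).
  by have [] := derivable_gen_term_v x false u1 v1.
by apply/funext => z; rewrite gen_funE.
Qed.

Lemma diff_quotients_cvg x (F : R -> C -> C -> C) k l (u v : C) :
  0 <= x -> `|u| < 1 -> `|v| < 1 ->
  (forall y, F y u v = gen_term e y k l u v) ->
  cvg (diff_quotients_x F x u v) /\ partial_x F x u v = gen_term dr x k l u v.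
Proof.
move=> x0 u1 v1 FE.
have [r [del [r0 r1 _ del0 [udel vdel]]]] := exists_radius u1 v1.
have del0C : 0 <= ofR del :> C by rewrite -[0]ofR0 ofR_le ltW.
have ur : `|u| <= ofR r by apply: le_trans udel; rewrite lerDl.
have vr : `|v| <= ofR r by apply: le_trans vdel; rewrite lerDl.
have H : diff_quotients_x F x u v --> gen_term dr x k l u v.
  apply: (cvg_diff_quotient (K := K * (total_weight r * total_weight r))) => // y y0.
  by rewrite !FE; exact: gen_term_x_error.
split; first exact: cvgP H.
have := within_ge0_proper x0 => PF.
by apply/cvg_lim; [exact: norm_hausdorff|exact: H].
Qed.

(** [G] and [Gv] stand for the backlog series and its derivative in v. Once the differences at [p]
    and [fu] are expressed through them, the poles cancel and a rational identity remains. *)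
Lemma pde_lhs_eq0 (F : fieldType) (u v p r xu xv f fq fu fv fvq G Gu Gv : F) :
  u - p != 0 -> f - fq = (u - p) * G -> fv - fvq = (u - p) * Gv ->
  fu = G + (u - p) * Gu ->
  u * xu + v * xv = - (1 + r) * (u * fu + v * fv) + u * (f + u * fu) +
    v * (f + v * fv) + r * (1 - p) * (u * Gu + v * Gv) ->
  u * xu + v * xv + u * (u - 1) * (r + p - u) / (u - p) * fu +
  v * (1 + r - v) * fv - r * (1 - p) * v / (u - p) * (fv - fvq) -
  (u + v) * f + r * (1 - p) * u / (u - p) ^+ 2 * (f - fq) = 0.
Proof.
by move=> up -> -> -> ->; field.
Qed.

Lemma pde_lhsE (F : R -> C -> C -> C) x (u v xu xv f fq fu fv fvq : C) :
  partial_x (partial_u F) x u v = xu -> partial_x (partial_v F) x u v = xv ->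
  F x u v = f -> F x (ofR q) v = fq -> partial_u F x u v = fu ->
  partial_v F x u v = fv -> partial_v F x (ofR q) v = fvq ->
  pde_lhs rho q F x u v =
  u * xu + v * xv + u * (u - 1) * (ofR rho + ofR q - u) / (u - ofR q) * fu +
  v * (1 + ofR rho - v) * fv -
  ofR rho * (1 - ofR q) * v / (u - ofR q) * (fv - fvq) -
  (u + v) * f + ofR rho * (1 - ofR q) * u / (u - ofR q) ^+ 2 * (f - fq).
Proof. by move=> <- <- <- <- <- <- <-. Qed.

Lemma pde_off_singularity x (u v : C) : 0 <= x -> `|u| < 1 -> `|v| < 1 ->
  u <> ofR q -> pde_lhs rho q E x u v = 0.
Proof.
move=> x0 u1 v1 uq.
have q1C : `|ofR q : C| < 1.
  by rewrite ofR_norm ger0_norm// -[1]ofR1 ofR_lt.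
have [r [del [r0 r1 qr del0 [udel vdel]]]] := exists_radius u1 v1.
have del0C : 0 <= ofR del :> C by rewrite -[0]ofR0 ofR_le ltW.
have ur : `|u| <= ofR r by apply: le_trans udel; rewrite lerDl.
have vr : `|v| <= ofR r by apply: le_trans vdel; rewrite lerDl.
have qrC : `|ofR q : C| <= ofR r by rewrite ofR_norm ofR_le ger0_norm.
have [_ xuE] := diff_quotients_cvg x0 u1 v1 (fun y => partial_uE y u1 v1).
have [_ xvE] := diff_quotients_cvg x0 u1 v1 (fun y => partial_vE y u1 v1).
have atq l : gen_term e x false l u v - gen_term e x false l (ofR q) v =
    (u - ofR q) * gen_term D x false l u v.
  have eq1 := shift_equation r0 r1 ur vr x l.
  have eq2 := shift_equation r0 r1 qrC vr x l.
  rewrite subrr mul0r (shift_constant x l (ofR q) u) in eq2.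
  move/esym/subr0_eq : eq2 => eq2.
  exact: (etrans (congr1 (fun t => gen_term e x false l u v - t) eq2) (esym eq1)).
have drift := drift_equation r0 r1 ur vr x.
have deriv := derivative_equation r0 r1 ur vr x false.
have uq0 : u - ofR q != 0 by rewrite subr_eq0; apply/eqP.
have rE : ofR (1 + rho) = 1 + ofR rho :> C by rewrite ofRD.
have cE : ofR (rho * (1 - q)) = ofR rho * (1 - ofR q) :> C by rewrite ofRM ofRB.
rewrite rE cE in drift.
have := pde_lhs_eq0 uq0 (atq false) (atq true) deriv drift.
exact: (etrans (pde_lhsE xuE xvE (gen_funE x u v) (gen_funE x (ofR q) v)
  (partial_uE x u1 v1) (partial_vE x u1 v1) (partial_vE x q1C v1))).
Qed.

Theorem gen_fun_pde x (u v : C) : 0 <= x -> `|u| < 1 -> `|v| < 1 ->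
  [/\ (forall b : nat, (1 <= b)%N -> cvgn (inner_partial_sum e x u v b)),
      cvgn (outer_partial_sum e x u v),
      derivable (fun z : C => E x z v) u 1
        /\ derivable (fun z : C => E x u z) v 1,
      cvg (diff_quotients_x (partial_u E) x u v)
        /\ cvg (diff_quotients_x (partial_v E) x u v) &
      (u <> ofR q -> pde_lhs rho q E x u v = 0)
        /\ (u = ofR q -> pde_lhs rho q E x z v @[z --> u^'] --> (0 : C))].
Proof.
move=> x0 u1 v1.
have [r [del [r0 r1 qr del0 [udel vdel]]]] := exists_radius u1 v1.
have del0C : 0 < ofR del :> C by rewrite -[0]ofR0 ofR_lt.
have ur : `|u| <= ofR r by apply: le_trans udel; rewrite lerDl ltW.
have vr : `|v| <= ofR r by apply: le_trans vdel; rewrite lerDl ltW.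
have [Mt domE] : exists Mt, dominated2 r Mt
    (gterm (fun n b => e n b x) false false u v).
  by have [_] := sums_to_gterm r0 r1 ur vr false false (be x).
split.
- move=> b _; rewrite inner_partial_sumE.
  exact: is_cvg_csum (dominated2_inner r0 r1 b domE).
- rewrite outer_partial_sumE.
  exact: is_cvg_csum (dominated2_outer r0 r1 domE).
- have [du _] := derivable_gen_term_u x false u1 v1.
  have [dv _] := derivable_gen_term_v x false u1 v1.
  have uE : (fun z => E x z v) = (fun z => gen_term e x false false z v).
    by apply/funext => z; exact: gen_funE.
  have vE : (fun z => E x u z) = (fun z => gen_term e x false false u z).
    by apply/funext => z; exact: gen_funE.
  exact: (conj (eq_ind_r (fun f => derivable f u 1) du uE)
               (eq_ind_r (fun f => derivable f v 1) dv vE)).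
- have [cu _] := diff_quotients_cvg x0 u1 v1 (fun y => partial_uE y u1 v1).
  have [cv _] := diff_quotients_cvg x0 u1 v1 (fun y => partial_vE y u1 v1).
  by split.
split; first exact: pde_off_singularity.
(* At [u = q] the expression is zero at all nearby [z] other than [q], so the limit is that of a
   constant. *)
move=> uq; apply: cvg_near_cst.
have near1 : \forall z \near u^', `|z| < 1.
  apply: nbhs_dnbhs; apply/nbhs_ballP.
  exists (1 - `|u|) => /=; first by rewrite subr_gt0.
  move=> z /= uz; rewrite -[z](subrK u) addrC.
  apply: (le_lt_trans (ler_normD _ _)); rewrite -ltrBrDl distrC.
  exact: uz.
have nearq : \forall z \near u^', z != u by exact: (@nbhs_dnbhs_neq C u).
near=> z; apply: pde_off_singularity => //.
  by near: z.
by rewrite -uq; apply/eqP; near: z.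
Unshelve. all: by end_near. Qed.

End PDE.

(** * Application to the tails of the sojourn time *)

Section FromQueueToPDE.
Context {d : measure_display} {T : measurableType d} {R : realType}
        (P : probability T R).
Variables (rho q : R) (X : random_inputs P).
Hypotheses (q_ge0 : 0 <= q) (q_lt1 : q < 1) (rho_gt0 : 0 < rho).
Hypothesis queue : MX_M_1_inputs X rho q.

Let mu := configuration_law X.
Let law := coordinate_law X.
Let muE : has_product_law mu law := configuration_has_product_law queue.
Let lawT := tagged_coordinate_law queue.
Let lawO := other_coordinate_law queue.
Let lawG := gap_coordinate_law queue.
Let lawR := req_coordinate_law queue.
Let lawB := batch_size_law_eq queue.
Let lawB0 := first_batch_law queue.

(** The row [b = 0], where the tails vanish, is completed by 0 so that the drift relations hold for
    all indices. *)
Definition tail_drift n b x : R :=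
  if b is 0%N then 0 else etail_drift mu rho q n b x.

Lemma tail_drift_bound n b x : `|tail_drift n b x| <= 1 + rho.
Proof.
case: b => [|b]; first by rewrite normr0 addr_ge0// ltW.
exact: (etail_drift_bound mu rho_gt0 q_ge0 q_lt1).
Qed.

Lemma tail_driftE n b x : (n + b)%:R * tail_drift n b x =
  - (1 + rho) * (n + b)%:R * etail mu n b x + b%:R * etail mu n b.-1 x +
  n%:R * etail mu n.-1 b x + rho * (1 - q) * ((n + b)%:R * backlog mu q n b x).
Proof.
case: b => [|b]; last exact: (etail_driftE mu rho_gt0 q_ge0 q_lt1).
have -> : backlog mu q n 0 x = 0.
  rewrite /backlog (_ : series _ = fun=> 0) ?lim_cst//.
  by apply/funext => N; rewrite /series/= big1// => i _; rewrite etail_nojob mulr0.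
by rewrite /= !etail_nojob !mulr0 !addr0.
Qed.

Lemma tail_taylor n b x y : 0 <= x -> 0 <= y ->
  `|etail mu n b y - etail mu n b x - (y - x) * tail_drift n b x| <=
  4 * (1 + rho) ^+ 2 * (y - x) ^+ 2.
Proof.
case: b => [|b] x0 y0; last exact: (etail_taylor rho_gt0 q_ge0 q_lt1 muE lawT lawO lawG lawR lawB lawB0).
rewrite !etail_nojob mulr0 !subr0 normr0.
by rewrite mulr_ge0 ?sqr_ge0// mulr_ge0 ?sqr_ge0.
Qed.

Lemma gen_fun_tail_pde x (u v : Cplx R) : 0 <= x -> `|u| < 1 -> `|v| < 1 ->
  let E := gen_fun (tail X) in
  [/\ (forall b : nat, (1 <= b)%N -> cvgn (inner_partial_sum (tail X) x u v b)),
      cvgn (outer_partial_sum (tail X) x u v),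
      derivable (fun z : Cplx R => E x z v) u 1
        /\ derivable (fun z : Cplx R => E x u z) v 1,
      cvg (diff_quotients_x (partial_u E) x u v)
        /\ cvg (diff_quotients_x (partial_v E) x u v) &
      (u <> ofR q -> pde_lhs rho q E x u v = 0)
        /\ (u = ofR q -> pde_lhs rho q E x z v @[z --> u^'] --> (0 : Cplx R))].
Proof.
have -> : tail X = etail mu.
  by apply/funext => n; apply/funext => b; apply/funext => y; exact: tail_etail.
move=> x0 u1 v1 E; apply: (gen_fun_pde (D := backlog mu q) (dr := tail_drift)
  (L := 1 + rho) (M := (1 - q)^-1) (K := 4 * (1 + rho) ^+ 2)) => //.
- by move=> n b y; rewrite etail_ge0 etail_le1.
- exact: etail_nojob.
- exact: (backlog_itv mu q_ge0 q_lt1).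
- exact: (backlog_rec mu q_ge0 q_lt1).
- exact: tail_drift_bound.
- exact: tail_driftE.
- exact: tail_taylor.
Qed.

End FromQueueToPDE.

Theorem proposition3p1 (R : realType) (d : measure_display)
    (T : measurableType d) (P : probability T R)
    (rho q : R) (X : random_inputs P)
    (q_ge0 : 0 <= q) (q_lt1 : q < 1)
    (rho_gt0 : 0 < rho) (rho_lt : rho < 1 - q)
    (queue : MX_M_1_inputs X rho q) :
  let e := tail X in
  let E := gen_fun e in
  forall (x : R) (u v : Cplx R), 0 <= x -> `|u| < 1 -> `|v| < 1 ->
    [/\ (forall b : nat, (1 <= b)%N -> cvgn (inner_partial_sum e x u v b)),
        cvgn (outer_partial_sum e x u v),
        derivable (fun z : Cplx R => E x z v) u 1
          /\ derivable (fun z : Cplx R => E x u z) v 1,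
        cvg (diff_quotients_x (partial_u E) x u v)
          /\ cvg (diff_quotients_x (partial_v E) x u v) &
        (u <> ofR q -> pde_lhs rho q E x u v = 0)
          /\ (u = ofR q -> pde_lhs rho q E x z v @[z --> u^'] --> (0 : Cplx R))].
Proof.
move=> e E x u v x0 u1 v1.
exact: (gen_fun_tail_pde q_ge0 q_lt1 rho_gt0 queue x0 u1 v1).
Qed.
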